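(* Let $0<q<1$, $N\ge2$, and let $\psi$ be a generating functional on $SU_q(N)$. Then $\psi$ decomposes uniquely into a sum $\psi=\psi_1+\dots+\psi_N$ such that: - $\psi_1$ is a gaussian generating functional; - for $2\le n\le N$, $\psi_n=\tilde\psi_n\circ s_{n,N}$ for some irreductible generating functional $\tilde\psi_n$ on $SU_q(n)$ satisfying $\tilde\psi_n\circ\mathcal P=\tilde\psi_n$ (with $\mathcal P$ the projection for $SU_q(n)$).
   Context: **The algebra.** Fix $0<q<1$. For $N\ge1$, $SU_q(N)$ is the unital complex algebra generated by $u_{jk}$ $(1\le j,k\le N)$ subject to: $u_{ij}u_{kj}=qu_{kj}u_{ij}$ for $i<k$; $u_{ij}u_{il}=qu_{il}u_{ij}$ for $j<l$; $u_{ij}u_{kl}=u_{kl}u_{ij}$ for $i<k,\ j>l$; $u_{ij}u_{kl}=u_{kl}u_{ij}-(q^{-1}-q)u_{il}u_{kj}$ for $i<k,\ j<l$; and $D=\mathbf 1$, where $D=\sum_{\sigma\in S_N}(-q)^{i(\sigma)}u_{1,\sigma(1)}\cdots u_{N,\sigma(N)}$ and $i(\sigma)$ is the number of inversions of $\sigma$. It is a $*$-algebra with $u_{jk}^*=(-q)^{k-j}D^{jk}$, where $D^{jk}$ is the quantum determinant (same formula, inversions counted with respect to the natural order of the remaining indices) of the matrix $(u_{il})$ with row $j$ and column $k$ removed. One has $\sum_su_{js}u_{ks}^*=\delta_{jk}\mathbf 1=\sum_su_{sj}^*u_{sk}$. ($SU_q(1)=\mathbb C$.) The counit is the unital $*$-homomorphism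 $\varepsilon\colon SU_q(N)\to\mathbb C$, $\varepsilon(u_{jk})=\delta_{jk}$. Put $K_n=\mathrm{span}\,(\ker\varepsilon)^n$; $K_1=\ker\varepsilon$. **Functionals.** A generating functional is a linear functional $\psi$ that is hermitian, satisfies $\psi(\mathbf 1)=0$, and $\psi(b^*b)\ge0$ for $b\in K_1$. It is gaussian if it vanishes on $K_3$ and a drift if it vanishes on $K_2$. A $*$-representation is a unital $*$-homomorphism into $B(H)$, $H$ a Hilbert space ($\{0\}$ allowed). A $\pi$-$\varepsilon$-cocycle is a linear map $\eta\colon SU_q(N)\to H$ with $\eta(ab)=\pi(a)\eta(b)+\eta(a)\varepsilon(b)$; it is cyclic if its range is dense. The Schürmann triple of a generating functional $\psi$ is the (up to unitary equivalence unique) triple $(\pi,\eta,\psi)$ with $\pi$ a $*$-representation, $\eta$ a cyclic $\pi$-$\varepsilon$-cocycle and $\langle\eta(a),\eta(b)\rangle=\psi(a^*b)-\psi(a^* )\varepsilon(b)-\varepsilon(a^* )\psi(b)$ for all $a,b$. $\psi$ is completely non-gaussian if $\{0\}$ is the only invariant subspace on which the representation $\pi$ of its Schürmann triple vanishes on $K_1$. **Projection.** With $d_j=\frac{u_{jj}-u_{jj}^*}{2i}$, $\mathcal P$ is the linear projection of $SU_q(N)$ onto $K_2$ with kernel $\mathrm{span}\{\mathbf 1,d_2,\dots,d_N\}$ (for each $N$). **Homomorphisms.** For $n\le N$, $s_{n,N}\colon SU_q(N)\to SU_q(n)$ is the surjective unital $*$-homomorphism $u_{jk}\mapsto u_{jk}$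 for $j,k\le n$ and $u_{jk}\mapsto\delta_{jk}\mathbf 1$ if $j>n$ or $k>n$; $s_N:=s_{N-1,N}$. **Irreductible.** A generating functional $\psi$ on $SU_q(N)$ ($N\ge2$) is irreductible if it is completely non-gaussian and if, for every generating functional $\tilde\psi$ on $SU_q(N-1)$, whenever $\psi-\tilde\psi\circ s_N$ is a generating functional, then $\tilde\psi\circ s_N$ is a drift. *)

(* Defs.v *)
From HB Require Import structures.
From mathcomp Require Import all_boot all_order all_fingroup all_algebra.
From mathcomp Require Import boolp classical_sets reals complex sesquilinear.
From mathcomp.multinomials Require Import monalg.

Set Implicit Arguments.
Unset Strict Implicit.
Unset Printing Implicit Defensive.

Import Order.TTheory GRing.Theory Num.Theory.
Local Open Scope ring_scope.
Local Open Scope complex_scope.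
Local Open Scope quotient_scope.

(* Representatives of classes, not of cosets of finite groups. *)
Local Notation repr := generic_quotient.repr.

(* Indices start at 0: (j, k) : 'I_N * 'I_N stands for the generator
   u_{j+1,k+1}; only differences and comparisons of indices are ever used. *)
Notation gen N := ('I_N * 'I_N)%type.
Notation free_alg R N := {malg R[i][{fmonom (gen N)}]}.

Definition free_gen (R : realType) (N : nat) (j k : 'I_N) : free_alg R N :=
  mkmalgU (fmu (j, k)) 1.

Section Evaluation.
Variables (R : realType) (N : nat) (S : nzRingType).

Definition word_eval (g : gen N -> S) (w : {fmonom (gen N)}) : S :=
  \prod_(p <- (w : seq (gen N))) g p.

Lemma word_eval_multiplicative g : monalg.mmorphism (word_eval g).
Proof.
split=> [x y|]; rewrite /word_eval; first by rewrite fmM big_cat.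
by rewrite fm1 big_nil.
Qed.
HB.instance Definition _ g :=
  monalg.isMultiplicative.Build _ _ (word_eval g) (word_eval_multiplicative g).

(* If [f] is a ring morphism with central values, [free_eval f g] is the ring
   morphism that extends [f] on the scalars and [g] on the generators. *)
Definition free_eval (f : R[i] -> S) (g : gen N -> S) : free_alg R N -> S :=
  mmap f (word_eval g).

End Evaluation.

Definition inversions (n : nat) (s : 'S_n) : nat :=
  #|[set p : 'I_n * 'I_n | (p.1 < p.2)%N && (s p.2 < s p.1)%N]|.

Definition qdet (R : realType) (q : R) (A : lalgType R[i]) (n : nat)
    (U : 'M[A]_n) : A :=
  \sum_(s : 'S_n) (- q%:C) ^+ inversions s *: \prod_(i < n) U i (s i).

Section SUq.
Variables (R : realType) (q : R) (N : nat).
Local Notation C := R[i].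
Local Notation F := (free_alg R N).
Local Notation u := (@free_gen R N).

Inductive SUq_relator : F -> Prop :=
| SUq_rel_column (i k j : 'I_N) of (i < k)%N :
    SUq_relator (u i j * u k j - q%:C *: (u k j * u i j))
| SUq_rel_row (i j l : 'I_N) of (j < l)%N :
    SUq_relator (u i j * u i l - q%:C *: (u i l * u i j))
| SUq_rel_antidiagonal (i k j l : 'I_N) of (i < k)%N & (l < j)%N :
    SUq_relator (u i j * u k l - u k l * u i j)
| SUq_rel_diagonal (i k j l : 'I_N) of (i < k)%N & (j < l)%N :
    SUq_relator (u i j * u k l
      - (u k l * u i j - (q%:C^-1 - q%:C) *: (u i l * u k j)))
| SUq_rel_det : SUq_relator (qdet q (\matrix_(j, k) u j k) - 1).

Inductive SUq_ideal : F -> Prop :=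
| SUq_ideal0 : SUq_ideal 0
| SUq_idealD x a r b of SUq_ideal x & SUq_relator r :
    SUq_ideal (x + a * r * b).

Lemma SUq_idealB x y : SUq_ideal x -> SUq_ideal y -> SUq_ideal (x - y).
Proof.
move=> Ix; elim: y / => [|y a r b _ IH Hr]; first by rewrite subr0.
by rewrite opprD addrA -!mulNr; exact: SUq_idealD.
Qed.

Lemma SUq_idealMl c x : SUq_ideal x -> SUq_ideal (c * x).
Proof.
elim: x / => [|x a r b _ IH Hr]; first by rewrite mulr0; exact: SUq_ideal0.
by rewrite mulrDr !mulrA; exact: SUq_idealD.
Qed.

Lemma SUq_idealMr c x : SUq_ideal x -> SUq_ideal (x * c).
Proof.
elim: x / => [|x a r b _ IH Hr]; first by rewrite mul0r; exact: SUq_ideal0.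
by rewrite mulrDl -!mulrA [a * _]mulrA; exact: SUq_idealD.
Qed.

Lemma SUq_idealZ (c : C) x : SUq_ideal x -> SUq_ideal (c *: x).
Proof. by rewrite -mul_malgC; exact: SUq_idealMl. Qed.

Definition free_counit : F -> C :=
  free_eval idfun (fun p => (p.1 == p.2)%:R).
HB.instance Definition _ := GRing.RMorphism.on free_counit.
HB.instance Definition _ := GRing.Linear.on free_counit.

Lemma free_counit_gen j k : free_counit (u j k) = (j == k)%:R.
Proof.
by rewrite /free_counit /free_eval /free_gen mmapU mul1r /word_eval fmU
           big_seq1.
Qed.

Lemma free_counit_relator r : SUq_relator r -> free_counit r = 0.
Proof.
have epsM x y : free_counit (x * y) = free_counit x * free_counit y.
  exact: rmorphM.
have epsB x y : free_counit (x - y) = free_counit x - free_counit y.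
  exact: raddfB.
have epsZ c x : free_counit (c *: x) = c * free_counit x by exact: linearZ.
have delta0 (i j k l : 'I_N) : (i == j -> k == l -> False) ->
    (i == j)%:R * (k == l)%:R = 0 :> C.
  by do 2!case: eqP => _; rewrite ?mul0r ?mulr0 // => /(_ isT isT).
case=> [i k j ik|i j l jl|i k j l ik lj|i k j l ik jl|];
  rewrite !(epsB, epsM, epsZ) ?free_counit_gen.
- rewrite [(k == j)%:R * _]mulrC delta0 ?mulr0 ?subrr // => /eqP ij /eqP kj.
  by rewrite ij kj ltnn in ik.
- rewrite [(i == l)%:R * _]mulrC delta0 ?mulr0 ?subrr // => /eqP ij /eqP il.
  by rewrite -ij -il ltnn in jl.
- by rewrite mulrC subrr.
- rewrite [X in X - _]mulrC opprB addrCA subrr addr0 delta0 ?mulr0 //.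
  move=> /eqP il /eqP kj; rewrite kj in ik.
  by move: (ltn_trans ik jl); rewrite il ltnn.
rewrite [free_counit 1]rmorph1 /qdet [X in X - _]raddf_sum /=.
have eps_term (s : 'S_N) :
    free_counit ((- q%:C) ^+ inversions s *:
      \prod_(i < N) (\matrix_(j, k) u j k) i (s i)) =
    (- q%:C) ^+ inversions s * \prod_(i < N) (i == s i)%:R.
  rewrite epsZ [free_counit _]rmorph_prod; congr (_ * _).
  by apply: eq_bigr => i _; rewrite mxE; exact: free_counit_gen.
under eq_bigr => s _ do rewrite eps_term.
rewrite (bigD1 1%g) //= [X in _ + X - _]big1 => [|s s1].
  rewrite [X in _ * X]big1 => [|i _]; last by rewrite perm1 eqxx.
  rewrite mulr1 addr0 /inversions (_ : [set _ | _]%SET = finset.set0) ?cards0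
    ?subrr //.
  apply/setP => p; rewrite !inE !perm1; apply/negP => /andP[h1 h2].
  by move: (ltn_trans h1 h2); rewrite ltnn.
have [i si]: exists i, s i != i.
  apply/existsP; rewrite -negb_forall; apply: contra s1 => /forallP h.
  by apply/eqP/permP => i; rewrite perm1; exact/eqP/h.
by rewrite (bigD1 i) //= [i == _]eq_sym (negbTE si) mul0r mulr0.
Qed.

Lemma free_counit_ideal x : SUq_ideal x -> free_counit x = 0.
Proof.
elim: x / => [|x a r b _ IH Hr]; first by rewrite raddf0.
by rewrite rmorphD !rmorphM /= IH (free_counit_relator Hr) mulr0 mul0r addr0.
Qed.

Definition SUq_ideal_pred : {pred F} := fun x => `[< SUq_ideal x >].

Fact SUq_ideal_zmod_closed : zmod_closed SUq_ideal_pred.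
Proof.
split; first exact/asboolP/SUq_ideal0.
by move=> x y /asboolP Ix /asboolP Iy; exact/asboolP/SUq_idealB.
Qed.
HB.instance Definition _ :=
  GRing.isZmodClosed.Build F SUq_ideal_pred SUq_ideal_zmod_closed.

Definition SUq := Quotient.quot SUq_ideal_pred.
HB.instance Definition _ := GRing.Zmodule.on SUq.
HB.instance Definition _ := Quotient.on SUq.

Definition SUq_pi : F -> SUq := \pi_SUq.

Lemma SUq_piP x y : SUq_pi x = SUq_pi y <-> SUq_ideal (x - y).
Proof.
split=> [/eqmodP|h]; first by rewrite /= /Quotient.equiv => /asboolP.
by apply/eqmodP; rewrite /= /Quotient.equiv; exact/asboolP.
Qed.

Lemma SUq_piK (a : SUq) : SUq_pi (repr a) = a. Proof. exact: reprK. Qed.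

Lemma SUq_pi_repr x : SUq_ideal (repr (SUq_pi x) - x).
Proof. by apply/SUq_piP; rewrite SUq_piK. Qed.

Lemma SUq_piD x y : SUq_pi (x + y) = SUq_pi x + SUq_pi y.
Proof. by rewrite /SUq_pi !piE. Qed.

Definition SUq_one : SUq := SUq_pi 1.
Definition SUq_mul (a b : SUq) : SUq := SUq_pi (repr a * repr b).
Definition SUq_scale (c : C) (a : SUq) : SUq := SUq_pi (c *: repr a).

Lemma SUq_piM x y : SUq_pi (x * y) = SUq_mul (SUq_pi x) (SUq_pi y).
Proof.
apply/esym/SUq_piP; set x' := repr _; set y' := repr _.
have -> : x' * y' - x * y = x' * (y' - y) - (x - x') * y.
  by rewrite mulrBr mulrBl opprB addrA subrK.
apply: SUq_idealB; first exact/SUq_idealMl/SUq_pi_repr.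
by apply/SUq_idealMr/SUq_piP; rewrite SUq_piK.
Qed.

Lemma SUq_piZ c x : SUq_pi (c *: x) = SUq_scale c (SUq_pi x).
Proof.
by apply/esym/SUq_piP; rewrite -scalerBr; exact/SUq_idealZ/SUq_pi_repr.
Qed.

Fact SUq_mulA : associative SUq_mul.
Proof.
move=> a b c; rewrite -[a]SUq_piK -[b]SUq_piK -[c]SUq_piK.
by rewrite -!SUq_piM mulrA.
Qed.

Fact SUq_mul1a : left_id SUq_one SUq_mul.
Proof. by move=> a; rewrite -[a]SUq_piK -SUq_piM mul1r. Qed.

Fact SUq_mula1 : right_id SUq_one SUq_mul.
Proof. by move=> a; rewrite -[a]SUq_piK -SUq_piM mulr1. Qed.

Fact SUq_mulDl : left_distributive SUq_mul +%R.
Proof.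
move=> a b c; rewrite -[a]SUq_piK -[b]SUq_piK -[c]SUq_piK.
by rewrite -SUq_piD -!SUq_piM mulrDl SUq_piD.
Qed.

Fact SUq_mulDr : right_distributive SUq_mul +%R.
Proof.
move=> a b c; rewrite -[a]SUq_piK -[b]SUq_piK -[c]SUq_piK.
by rewrite -SUq_piD -!SUq_piM mulrDr SUq_piD.
Qed.

Fact SUq_one_neq0 : SUq_one != 0.
Proof.
apply/eqP; have -> : 0 = SUq_pi 0 by rewrite /SUq_pi piE.
move=> /SUq_piP /free_counit_ideal /eqP.
by rewrite subr0 rmorph1 oner_eq0.
Qed.

HB.instance Definition _ := GRing.Zmodule_isNzRing.Build SUq
  SUq_mulA SUq_mul1a SUq_mula1 SUq_mulDl SUq_mulDr SUq_one_neq0.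

Fact SUq_scaleA c d a : SUq_scale c (SUq_scale d a) = SUq_scale (c * d) a.
Proof. by rewrite -[a]SUq_piK -!SUq_piZ scalerA. Qed.

Fact SUq_scale1 : left_id 1 SUq_scale.
Proof. by move=> a; rewrite -[a]SUq_piK -SUq_piZ scale1r. Qed.

Fact SUq_scaleDr : right_distributive SUq_scale +%R.
Proof.
move=> c a b; rewrite -[a]SUq_piK -[b]SUq_piK -SUq_piD -!SUq_piZ.
by rewrite scalerDr SUq_piD.
Qed.

Fact SUq_scaleDl a : {morph SUq_scale^~ a : c d / c + d}.
Proof.
by move=> c d; rewrite -[a]SUq_piK -!SUq_piZ scalerDl SUq_piD.
Qed.

HB.instance Definition _ := GRing.Zmodule_isLmodule.Build C SUq
  SUq_scaleA SUq_scale1 SUq_scaleDr SUq_scaleDl.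

Fact SUq_scaleAl (c : C) (a b : SUq) : c *: (a * b) = (c *: a) * b.
Proof.
rewrite -[a]SUq_piK -[b]SUq_piK.
change (SUq_scale c (SUq_mul (SUq_pi (repr a)) (SUq_pi (repr b))) =
  SUq_mul (SUq_scale c (SUq_pi (repr a))) (SUq_pi (repr b))).
by rewrite -SUq_piM -!SUq_piZ -SUq_piM scalerAl.
Qed.
HB.instance Definition _ := GRing.Lmodule_isLalgebra.Build C SUq SUq_scaleAl.

Lemma free_scaleAr (c : C) (x y : F) : c *: (x * y) = x * (c *: y).
Proof.
apply/malgP => w; rewrite mcoeffZ !(@mcoeffMlw _ _ (msupp x) (msupp y)) //.
  rewrite mulr_sumr; apply: eq_bigr => v _; rewrite mulr_sumr.
  by apply: eq_bigr => v' _; rewrite mcoeffZ mulrnAr mulrCA.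
exact: msuppZ_le.
Qed.

Fact SUq_scaleAr (c : C) (a b : SUq) : c *: (a * b) = a * (c *: b).
Proof.
rewrite -[a]SUq_piK -[b]SUq_piK.
change (SUq_scale c (SUq_mul (SUq_pi (repr a)) (SUq_pi (repr b))) =
  SUq_mul (SUq_pi (repr a)) (SUq_scale c (SUq_pi (repr b)))).
by rewrite -SUq_piM -!SUq_piZ -SUq_piM free_scaleAr.
Qed.
HB.instance Definition _ := GRing.Lalgebra_isAlgebra.Build C SUq SUq_scaleAr.

End SUq.

Section Structure.
Variables (R : realType) (q : R).
Local Notation C := R[i].

Definition SUq_gen (N : nat) (j k : 'I_N) : SUq q N := SUq_pi q (free_gen R j k).

(* The maps below are defined on representatives.  They are independent of the
   representative because the counit, the map [SUq_res n N] for n <= N, and the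
   adjoint respect the defining relations. *)

Definition counit (N : nat) (a : SUq q N) : C := free_counit (repr a).

Lemma counit_pi (N : nat) (x : free_alg R N) :
  counit (SUq_pi q x) = free_counit x.
Proof.
apply/eqP; rewrite -subr_eq0 /counit; apply/eqP.
have <- := free_counit_ideal (SUq_pi_repr q x).
by rewrite raddfB.
Qed.

(* u_jk^* = (-q)^(k-j) D^jk, extended antimultiplicatively and
   conjugate-linearly. *)
Definition SUq_gen_star (N : nat) (j k : 'I_N) : SUq q N :=
  (- q%:C) ^ ((k : nat)%:Z - (j : nat)%:Z) *:
    qdet q (row' j (col' k (\matrix_(i, l) SUq_gen i l))).

Definition SUq_star (N : nat) (a : SUq q N) : SUq q N :=
  mmap (fun c : C => (Num.conj c)%:A)
    (fun w : {fmonom (gen N)} =>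
       \prod_(p <- rev (w : seq (gen N))) SUq_gen_star p.1 p.2)
    (repr a).

(* Generators with an index that is not in 'I_n are sent to delta_jk. *)
Definition SUq_res (n N : nat) (a : SUq q N) : SUq q n :=
  free_eval (fun c : C => c%:A)
    (fun p : gen N =>
       match insub (p.1 : nat), insub (p.2 : nat) with
       | Some j, Some k => SUq_gen (j : 'I_n) (k : 'I_n)
       | _, _ => (p.1 == p.2)%:R
       end)
    (repr a).

(* The span of the products of n elements of the kernel of the counit. *)
Definition Kn (N n : nat) (a : SUq q N) : Prop :=
  exists m (c : 'I_m -> C) (x : 'I_m -> 'I_n -> SUq q N),
    (forall i j, counit (x i j) = 0) /\
    a = \sum_(i < m) c i *: \prod_(j < n) x i j.

Definition generating_functional (N : nat) (psi : SUq q N -> C) : Prop :=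
  [/\ scalar psi,
      forall a, psi (SUq_star a) = Num.conj (psi a),
      psi 1 = 0
    & forall b, counit b = 0 -> 0 <= psi (SUq_star b * b)].

Definition gaussian (N : nat) (psi : SUq q N -> C) : Prop :=
  generating_functional psi /\ (forall a, Kn 3 a -> psi a = 0).

Definition drift (N : nat) (psi : SUq q N -> C) : Prop :=
  generating_functional psi /\ (forall a, Kn 2 a -> psi a = 0).

Definition dgen (N : nat) (j : 'I_N) : SUq q N :=
  (2 * 'i)^-1 *: (SUq_gen j j - SUq_star (SUq_gen j j)).

Definition span_1d (N : nat) (a : SUq q N) : Prop :=
  exists (c0 : C) (c : 'I_N -> C),
    a = c0 *: 1 + \sum_(j < N | (0 < j)%N) c j *: dgen j.

(* The projection onto K_2 along span {1, d_2, ..., d_N}: the K_2-component of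
   [a] in the direct sum decomposition of SU_q(N) into these two subspaces. *)
Definition projK2 (N : nat) (a : SUq q N) : SUq q N :=
  xget 0 [set b | Kn 2 b /\ span_1d (a - b)]%classic.

(* [hdot] is linear in its first argument and conjugate-linear in the second,
   so that the inner product <x, y> that is linear in y is [hdot y x]. *)
Record hilbertSpace := HilbertSpace {
  hspace :> lmodType C;
  hdot : {dot hspace for Num.conj};
  hcomplete : forall v : nat -> hspace,
    (forall e : C, 0 < e -> exists m, forall k l, (m <= k)%N -> (m <= l)%N ->
       hdot (v k - v l) (v k - v l) < e) ->
    exists x, forall e : C, 0 < e -> exists m, forall k, (m <= k)%N ->
       hdot (v k - x) (v k - x) < e
}.

Definition bounded_operator (H : hilbertSpace) (T : H -> H) : Prop :=
  linear T /\ exists M : C, forall x, hdot H (T x) (T x) <= M * hdot H x x.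

Definition star_representation (N : nat) (H : hilbertSpace)
    (pi : SUq q N -> H -> H) : Prop :=
  [/\ forall a, bounded_operator (pi a),
      forall c a b x, pi (c *: a + b) x = c *: pi a x + pi b x,
      forall x, pi 1 x = x,
      forall a b x, pi (a * b) x = pi a (pi b x)
    & forall a x y, hdot H (pi (SUq_star a) x) y = hdot H x (pi a y)].

Definition cocycle (N : nat) (H : hilbertSpace) (pi : SUq q N -> H -> H)
    (eta : SUq q N -> H) : Prop :=
  linear eta /\
  forall a b, eta (a * b) = pi a (eta b) + counit b *: eta a.

Definition cyclic_cocycle (N : nat) (H : hilbertSpace) (pi : SUq q N -> H -> H)
    (eta : SUq q N -> H) : Prop :=
  cocycle pi eta /\
  forall (x : H) (e : C), 0 < e ->
    exists a, hdot H (x - eta a) (x - eta a) < e.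

Definition schurmann_triple (N : nat) (H : hilbertSpace)
    (pi : SUq q N -> H -> H) (eta : SUq q N -> H) (psi : SUq q N -> C) : Prop :=
  [/\ star_representation pi, cyclic_cocycle pi eta, generating_functional psi
    & forall a b, hdot H (eta b) (eta a) =
        psi (SUq_star a * b) - psi (SUq_star a) * counit b
          - counit (SUq_star a) * psi b].

Definition invariant_subspace (N : nat) (H : hilbertSpace)
    (pi : SUq q N -> H -> H) (V : H -> Prop) : Prop :=
  [/\ V 0, forall c x y, V x -> V y -> V (c *: x + y)
    & forall a x, V x -> V (pi a x)].

(* Schuermann triples exist and are unique up to unitary equivalence, so it is
   immaterial which triple of [psi] is used. *)
Definition completely_non_gaussian (N : nat) (psi : SUq q N -> C) : Prop :=
  exists (H : hilbertSpace) (pi : SUq q N -> H -> H) (eta : SUq q N -> H),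
    schurmann_triple pi eta psi /\
    forall V : H -> Prop, invariant_subspace pi V ->
      (forall a x, counit a = 0 -> V x -> pi a x = 0) ->
      forall x, V x -> x = 0.

Definition irreductible (N : nat) (psi : SUq q N -> C) : Prop :=
  [/\ generating_functional psi, completely_non_gaussian psi
    & forall psi' : SUq q N.-1 -> C, generating_functional psi' ->
        generating_functional (psi \- (psi' \o SUq_res N.-1 (N:=N))) ->
        drift (psi' \o SUq_res N.-1 (N:=N))].

End Structure.

(* Main.v *)
From HB Require Import structures.
Require Import Defs.
From mathcomp Require Import all_boot all_order all_fingroup all_algebra.
From mathcomp Require Import boolp classical_sets reals complex sesquilinear.
From mathcomp Require Import ring lra.
From mathcomp.multinomials Require Import monalg.

(* Let h_k be the Cesaro means of the powers of the last diagonal generator u_nn,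
   and realise psi by its GNS cocycle eta.  By the mean ergodic theorem h_k tends to
   the projection Q onto the vectors fixed by u_nn.  Since u_jn u_nn = q u_nn u_jn
   with q < 1 and u_nn is a contraction, the off-diagonal generators of the last row
   and column vanish on these vectors, so Q commutes with the representation, which
   lives on SU_q(n-1) on the range of Q.  The part (1 - Q) eta vanishes on
   u_jk - delta_jk as soon as j or k exceeds n, hence factors through s_{n,N}; it is
   pure, that is, h_k maps it to 0 in the limit.  A pure cocycle is the limit of the
   coboundaries of the vectors - eta (h_k), so the corresponding vector functionals
   converge on K_2 and eta is the cocycle of a generating functional.  Descending
   from n = N to n = 2 leaves a cocycle for a multiple of the counit, that is, a
   gaussian rest.

   Pure functionals are irreductible, because a functional that factors through
   s_n does not see the difference between a and h_k a.  Conversely the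
   decomposition of an irreductible functional into pure ones consists of its top
   term and a drift, so that it is pure as well.  For uniqueness, all the lower
   terms vanish at a^* (1 - h_k) b for a, b in K_1, whereas the top term at
   a^* h_k b tends to 0: the top term is the limit of psi (a^* (1 - h_k) b). *)

Set Implicit Arguments.
Unset Strict Implicit.
Unset Printing Implicit Defensive.

Import Order.TTheory GRing.Theory Num.Theory.
Local Open Scope ring_scope.
Local Open Scope complex_scope.

Local Notation repr := generic_quotient.repr.

(** * Quantum determinants *)

(** That a cocycle comes from a generating functional is not automatic, so an orthogonal splitting
    of eta does not yet split psi. This is what the coboundaries are for: the coboundary of a vector
    comes from a vector functional, and positivity passes to limits. Convergence is available on K_2
    only, since eta (b h_k) tends to 0 for b in the kernel of the counit. Away from K_2 the values
    are a free choice, which the condition psi o P = psi settles; it leaves the whole drift to the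
    gaussian term.

    Cesaro means replace a spectral projection because they are elements of the algebra: they can be
    put inside the argument of a functional, their counit is 1, and every s_{m,N} with m < n maps
    them to 1. Purity thus becomes a condition on psi alone, independent of a representation.

    The involution is given on representatives, by cofactors. Its compatibility with the relations
    rests on two facts: the cofactor matrix is the inverse of (u_jk), and the relations say that U
    (x) U commutes with a scalar matrix, a property that passes to inverses. *)

Section Inversions.

Lemma inversionsE n (s : 'S_n) :
  inversions s = (\sum_(x < n) \sum_(y < n) ((x < y) && (s y < s x)))%N.
Proof.
rewrite /inversions pair_big -sum1dep_card big_mkcond /=.
by apply: eq_bigr => -[x y] _ /=; case: ifP.
Qed.

Lemma inversions1 n : inversions (1%g : 'S_n) = 0%N.
Proof.
rewrite inversionsE big1 // => x _; rewrite big1 // => y _; rewrite !perm1.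
by apply/eqP; rewrite eqb0; apply/negP => /andP[/ltnW h]; rewrite ltnNge h.
Qed.

(** Defined for arbitrary functions because selections of rows with repetitions are sorted by
    induction on this number. *)
Definition fun_inversions n (f : 'I_n -> nat) : nat :=
  (\sum_(x < n) \sum_(y < n) ((x < y) && (f y < f x)))%N.

(** After both sums are reindexed by the transposition, the summand at (x, y) changes only at (i',
    i), where it passes from 0 to 1. *)
Lemma fun_inversions_tperm n (i i' : 'I_n) (f : 'I_n -> nat) :
  i' = i.+1 :> nat -> (f i < f i')%N ->
  fun_inversions (f \o tperm i i') = (fun_inversions f).+1.
Proof.
move=> ii' si; rewrite /fun_inversions.
rewrite (reindex_inj (@perm_inj _ (tperm i i'))) /=.
under eq_bigr => x _ do rewrite (reindex_inj (@perm_inj _ (tperm i i'))) /=.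
have -> : (\sum_(x < n) \sum_(y < n) ((x < y) && (f y < f x))).+1 =
  (\sum_(x < n) \sum_(y < n) (((x < y) && (f y < f x)) + ((x == i') && (y == i))))%N.
  under [RHS]eq_bigr => x _ do rewrite big_split.
  rewrite big_split /= -addn1; congr (_ + _)%N.
  rewrite (bigD1 i') //= (bigD1 i) //= !eqxx /= big1 => [|y /negbTE -> //].
  by rewrite big1 // => x /negbTE ->; rewrite big1.
apply: eq_bigr => x _; apply: eq_bigr => y _; rewrite /= !tpermK.
have ne : (i == i') = false by apply/eqP => e; move: ii'; rewrite -e => /eqP; rewrite eqn_leq ltnn andbF.
have ne' : (i' == i) = false by rewrite eq_sym.
have sf : (f i' < f i)%N = false by rewrite ltnNge (ltnW si).
have [-> | xi] := eqVneq x i.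
  rewrite tpermL ne addn0; have [-> | yi] := eqVneq y i; first by rewrite tpermL !ltnn.
  have [-> | yi'] := eqVneq y i'; first by rewrite tpermR sf !andbF.
  rewrite tpermD 1?eq_sym // ii'; congr (nat_of_bool (_ && _)).
  by rewrite [RHS]leq_eqVlt -ii' [_ == _ :> nat]eq_sym -[_ == _ :> nat]/(y == i') (negbTE yi').
have [-> | xi'] := eqVneq x i'.
  rewrite tpermR /=; have [-> | yi] := eqVneq y i.
    by rewrite tpermL ii' ltnSn si ltnNge leqnSn.
  have [-> | yi'] := eqVneq y i'; first by rewrite tpermR !ltnn.
  rewrite tpermD 1?eq_sym // addn0 ii'; congr (nat_of_bool (_ && _)).
  by rewrite [LHS]leq_eqVlt -ii' [_ == _ :> nat]eq_sym -[_ == _ :> nat]/(y == i') (negbTE yi').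
rewrite /= addn0 (@tpermD _ _ _ x) 1?eq_sym //.
have [-> | yi] := eqVneq y i.
  rewrite tpermL ii'; congr (nat_of_bool (_ && _)).
  by rewrite ltnS leq_eqVlt -[_ == _ :> nat]/(x == i) (negbTE xi).
have [-> | yi'] := eqVneq y i'.
  rewrite tpermR ii' [in RHS]ltnS; congr (nat_of_bool (_ && _)).
  by rewrite [RHS]leq_eqVlt -[_ == _ :> nat]/(x == i) (negbTE xi).
by rewrite tpermD 1?eq_sym.
Qed.

Lemma inversions_tpermS n (i i' : 'I_n) (s : 'S_n) :
  i' = i.+1 :> nat -> (s i < s i')%N ->
  inversions (tperm i i' * s)%g = (inversions s).+1.
Proof.
move=> ii' si; rewrite !inversionsE -(fun_inversions_tperm (f := val \o s) ii') //.
by apply: eq_bigr => x _; apply: eq_bigr => y _; rewrite !permM.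
Qed.

Lemma homo_ord_adjacent n (f : 'I_n -> nat) :
  (forall i i' : 'I_n, i' = i.+1 :> nat -> (f i < f i')%N) ->
  {homo f : x y / (x < y)%N}.
Proof.
move=> h x [y yn] /=; elim: y yn => // y IH yn; rewrite ltnS leq_eqVlt.
case/predU1P => [e|xy]; first by apply: h; rewrite /= e.
by apply: ltn_trans (IH (ltnW yn) xy) _; exact: h.
Qed.

Lemma perm_descent n (s : 'S_n) :
  s != 1%g -> exists i i' : 'I_n, i' = i.+1 :> nat /\ (s i' < s i)%N.
Proof.
case: n s => [|n] s s1; first by case/eqP: s1; apply/permP => -[].
apply: contrapT => h; case/eqP: s1.
have inc (i : 'I_n.+1) : (i < n)%N -> (s (inord i) < s (inord i.+1))%N.
  move=> lin; rewrite ltnNge leq_eqVlt; apply/negP => /orP[/eqP e|l].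
    have /(congr1 val) := perm_inj (val_inj e).
    by rewrite /= !inordK ?(ltnW lin) // => /eqP; rewrite eqn_leq ltnn.
  apply: h; exists (inord i), (inord i.+1); split => //.
  by rewrite !inordK // ltnW.
(* Without a descent, [s] grows by at least 1 at each step. From i to n this gives s i <= i, from 0
   to i it gives i <= s i. *)
have mono k l : (k + l <= n)%N -> (s (inord k) + l <= s (inord (k + l)))%N.
  elim: l => [|l IH]; first by rewrite !addn0.
  rewrite addnS => kl; rewrite addnS; apply: leq_ltn_trans (IH (ltnW kl)) _.
  by have := inc (Ordinal (ltnW kl : (k + l < n.+1)%N)) kl.
apply/permP => i; rewrite perm1; apply/val_inj/eqP; rewrite /= eqn_leq; apply/andP; split.
  have iln : (i <= n)%N by rewrite -ltnS.
  have := mono i (n - i)%N; rewrite subnKC // inord_val => /(_ (leqnn n)) h1.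
  rewrite -(leq_add2r (n - i)) subnKC //; apply: leq_trans h1 _.
  by rewrite -ltnS.
have := mono 0%N i; rewrite add0n inord_val -ltnS ltn_ord => /(_ isT).
by apply: leq_trans; rewrite leq_addl.
Qed.

(** The first two sums count the inversions in which the position i comes first, respectively
    second. *)
Lemma inversions_lift_perm n (i k : 'I_n.+1) (s : 'S_n) :
  inversions (lift_perm i k s) =
  (\sum_(y < n) ((i < lift i y) && (lift k (s y) < k)) +
   \sum_(y < n) ((lift i y < i) && (k < lift k (s y))) + inversions s)%N.
Proof.
rewrite !inversionsE (bigD1_ord i) //= (bigD1_ord i) //= ltnn /= add0n.
rewrite -addnA; congr (_ + _)%N.
  by apply: eq_bigr => y _; rewrite lift_perm_lift lift_perm_id.
rewrite -big_split /=; apply: eq_bigr => x _; rewrite (bigD1_ord i) //=.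
rewrite lift_perm_lift lift_perm_id; congr (_ + _)%N.
apply: eq_bigr => y _; rewrite !lift_perm_lift.
by rewrite /= !ltnNge !leq_bump2.
Qed.

Lemma inversions_lift_perm0 n (k : 'I_n.+1) (s : 'S_n) :
  inversions (lift_perm ord0 k s) = (k + inversions s)%N.
Proof.
rewrite inversions_lift_perm [X in (_ + X + _)%N]big1 ?addn0; last first.
  by move=> y _.
congr (_ + _)%N; under eq_bigr => y _ do rewrite lift0 /=.
rewrite (reindex_inj (@perm_inj _ s^-1)) /=.
under eq_bigr => y _ do rewrite permKV.
rewrite -[RHS](@card_ord k) -sum1_card.
rewrite (big_ord_widen n (fun=> 1%N)) -?[(k <= n)%N]ltnS // [RHS]big_mkcond /=.
apply: eq_bigr => y _; rewrite /bump; case: (leqP k y) => h /=.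
  by rewrite ltnNge (leq_trans h) // leq_addl.
by rewrite add0n h.
Qed.

Lemma inversions_lift_perm_max n (k : 'I_n.+1) (s : 'S_n) :
  inversions (lift_perm ord_max k s) = (n - k + inversions s)%N.
Proof.
rewrite inversions_lift_perm [X in (X + _ + _)%N]big1 ?add0n; last first.
  by move=> y _; rewrite lift_max /= ltnNge ltnW.
congr (_ + _)%N; under eq_bigr => y _ do rewrite lift_max ltn_ord /=.
rewrite (reindex_inj (@perm_inj _ s^-1)) /=.
under eq_bigr => y _ do rewrite permKV.
transitivity ((\sum_(i < n) 1) - k)%N; last by rewrite sum1_card card_ord.
have -> : (\sum_(i < n) 1 = \sum_(i < n) (k <= i) + \sum_(i < n) (i < k))%N.
  by rewrite -big_split /=; apply: eq_bigr => i _; case: leqP.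
have -> : (\sum_(i < n) (i < k) = k)%N.
  rewrite -[RHS](@card_ord k) -sum1_card.
  rewrite (big_ord_widen n (fun=> 1%N)) -1?ltnS // [RHS]big_mkcond /=.
  by apply: eq_bigr => y _; case: ifP.
rewrite addnK; apply: eq_bigr => y _; rewrite /bump; case: (leqP k y) => h /=.
  by rewrite ltnS h.
by rewrite add0n ltnNge ltnW.
Qed.

(** The operation is not commutative, so two neighbouring factors can only be isolated in place. The
    lists do not depend on [F], so that one splitting serves for a permutation and for its product
    with a transposition. *)
Lemma big_ord_adjacent (T : Type) (idx : T) (op : Monoid.law idx) n
    (i i' : 'I_n) :
  i' = i.+1 :> nat -> exists r1 r2 : seq 'I_n,
  [/\ {in r1, forall x, x != i /\ x != i'}, {in r2, forall x, x != i /\ x != i'}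
    & forall F : 'I_n -> T, \big[op/idx]_(x < n) F x =
       op (\big[op/idx]_(x <- r1) F x) (op (op (F i) (F i'))
          (\big[op/idx]_(x <- r2) F x))].
Proof.
move=> ii'; exists (take i (enum 'I_n)), (drop i.+2 (enum 'I_n)).
have val_enum : map val (enum 'I_n) = iota 0 n by rewrite val_enum_ord.
have isz : (i.+1 < size (enum 'I_n))%N by rewrite size_enum_ord -ii'.
split=> [x xr|x xr|F].
- have : val x \in map val (take i (enum 'I_n)) by apply: map_f.
  rewrite map_take val_enum take_iota mem_iota add0n => /andP[_].
  rewrite leq_min => /andP[xi _]; split; apply/eqP => e; move: xi; rewrite /= e ?ltnn //.
  by rewrite ii' ltnNge leqnSn.
- have : val x \in map val (drop i.+2 (enum 'I_n)) by apply: map_f.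
  rewrite map_drop val_enum drop_iota mem_iota => /andP[xi _].
  split; apply/eqP => e; move: xi; rewrite /= e ?add0n ?ii' ?ltnn //.
  by rewrite ltnNge leqnSn.
rewrite -[index_enum _]enumT -{1}(cat_take_drop i (enum 'I_n)) big_cat /=.
congr (op _ _); rewrite (drop_nth i) ?(ltnW isz) // (drop_nth i) //.
rewrite !big_cons Monoid.mulmA; congr (op (op _ _) _).
  by rewrite nth_ord_enum.
by congr F; apply: val_inj; rewrite -[RHS]/(nat_of_ord i') ii' -[LHS](nth_map i 0%N) // val_enum nth_iota // -?ii'.
Qed.

End Inversions.

(** * Quantum matrices: row operations, Laplace expansions, the cofactor matrix and the FRT
    relations *)

Section QuantumMatrix.
Variables (R : realType) (q : R) (A : algType R[i]).
Local Notation C := R[i].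
Hypothesis q_gt0 : 0 < q.

Record quantum_matrix m n (U : 'M[A]_(m, n)) : Prop := QuantumMatrix {
  qm_column : forall (i k : 'I_m) j, (i < k)%N -> U i j * U k j = q%:C *: (U k j * U i j);
  qm_row : forall i (j l : 'I_n), (j < l)%N -> U i j * U i l = q%:C *: (U i l * U i j);
  qm_antidiagonal : forall (i k : 'I_m) (j l : 'I_n), (i < k)%N -> (l < j)%N ->
    U i j * U k l = U k l * U i j;
  qm_diagonal : forall (i k : 'I_m) (j l : 'I_n), (i < k)%N -> (j < l)%N ->
    U i j * U k l = U k l * U i j - (q%:C^-1 - q%:C) *: (U i l * U k j) }.

Lemma quantum_matrix_tr m n (U : 'M[A]_(m, n)) :
  quantum_matrix U -> quantum_matrix U^T.
Proof.
case=> hc hr ha hd; split=> [i k j ik|i j l jl|i k j l ik lj|i k j l ik jl];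
  rewrite !mxE; [exact: hr|exact: hc|by rewrite [RHS]ha|].
by rewrite hd // [U j k * _]ha.
Qed.

Lemma quantum_matrix_sub m n m' n' (f : 'I_m' -> 'I_m) (g : 'I_n' -> 'I_n)
    (U : 'M[A]_(m, n)) :
  {homo f : x y / (x < y)%N} -> {homo g : x y / (x < y)%N} ->
  quantum_matrix U -> quantum_matrix (mxsub f g U).
Proof.
move=> hf hg [hc hr ha hd]; split=> [i k j ik|i j l jl|i k j l ik lj|i k j l ik jl];
  rewrite !mxE.
- exact/hc/hf.
- exact/hr/hg.
- by apply: ha; [exact: hf|exact: hg].
- by apply: hd; [exact: hf|exact: hg].
Qed.

Lemma lift_homo n (h : 'I_n) : {homo lift h : x y / (x < y)%N}.
Proof. by move=> x y xy; rewrite /= ltnNge leq_bump2 -ltnNge. Qed.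

Lemma quantum_matrix_minor m n (U : 'M[A]_(m, n)) i j :
  quantum_matrix U -> quantum_matrix (row' i (col' j U)).
Proof.
move=> hU; have -> : row' i (col' j U) = mxsub (lift i) (lift j) U.
  by apply/matrixP => x y; rewrite !mxE.
by apply: quantum_matrix_sub hU; exact: lift_homo.
Qed.

(* Pairing the permutations [s] and [tperm i i' * s] splits the quantum
   determinant into multiples of 2 x 2 quantum minors of the rows i, i'. *)
Lemma qdet_adjacent n (M : 'M[A]_n) (i i' : 'I_n) : i' = i.+1 :> nat ->
  exists (P1 P2 : 'S_n -> A), forall N : 'M[A]_n,
    (forall x, x != i -> x != i' -> row x N = row x M) ->
    qdet q N = \sum_(s : 'S_n | (s i < s i')%N)
      P1 s * (N i (s i) * N i' (s i') - q%:C *: (N i (s i') * N i' (s i))) * P2 s.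
Proof.
move=> ii'; have [r1 [r2 [hr1 hr2 hprod]]] := @big_ord_adjacent A 1 *%R n i i' ii'.
exists (fun s => (- q%:C) ^+ inversions s *: \prod_(x <- r1) M x (s x)).
exists (fun s => \prod_(x <- r2) M x (s x)) => N hN.
have ne : i != i' by rewrite -val_eqE /= ii' neq_ltn ltnSn.
rewrite /qdet (bigID (fun s : 'S_n => (s i < s i')%N)) /=.
rewrite [X in _ + X](reindex_inj (mulgI (tperm i i'))) /=.
rewrite [X in _ + X](eq_bigl (fun s : 'S_n => (s i < s i')%N)); last first.
  move=> s; rewrite !permM tpermL tpermR -leqNgt leq_eqVlt.
  by rewrite -[_ == _ :> nat]/(s i == s i') (inj_eq perm_inj) (negbTE ne).
rewrite -big_split /=; apply: eq_bigr => s si; rewrite (inversions_tpermS ii' si) !hprod /=.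
have hr (r : seq 'I_n) (t : 'S_n) : {in r, forall x, x != i /\ x != i'} -> {in r, t =1 s} ->
    \prod_(x <- r) N x (t x) = \prod_(x <- r) M x (s x).
  move=> h e; apply: eq_big_seq => x xr; have [xi xi'] := h x xr.
  by rewrite e //; have /rowP/(_ (s x)) := hN x xi xi'; rewrite !mxE.
have ht (r : seq 'I_n) : {in r, forall x, x != i /\ x != i'} -> {in r, (tperm i i' * s)%g =1 s}.
  by move=> h x /h[xi xi']; rewrite permM tpermD // eq_sym.
rewrite !(hr r1, hr r2) //; try exact: ht.
rewrite !permM tpermL tpermR exprS mulNr scaleNr -!scalerAl mulrBr mulrBl scalerBr.
by rewrite -scalerAr -scalerAl scalerA [q%:C * _]mulrC !mulrA.
Qed.

Lemma qdet_row_eq m n (U : 'M[A]_(m, n)) (f : 'I_n -> 'I_m) (i i' : 'I_n) :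
  quantum_matrix U -> i' = i.+1 :> nat -> f i = f i' ->
  qdet q (rowsub f U) = 0.
Proof.
move=> hU ii' fi; have [P1 [P2 ->]] := qdet_adjacent (rowsub f U) ii'; last by [].
rewrite big1 // => s si; rewrite !mxE fi (qm_row hU _ si).
by rewrite subrr mulr0 mul0r.
Qed.

(** For rows (a, b) and (c, d), the relations ad = da - (q^-1 - q) bc and bc = cb give cb - q da =
    -q (ad - q bc). *)
Lemma qdet_row_swap m n (U : 'M[A]_(m, n)) (f : 'I_n -> 'I_m) (i i' : 'I_n) :
  quantum_matrix U -> i' = i.+1 :> nat -> (f i < f i')%N ->
  qdet q (rowsub (f \o tperm i i') U) = - q%:C *: qdet q (rowsub f U).
Proof.
move=> hU ii' fi; have [P1 [P2 hP]] := qdet_adjacent (rowsub f U) ii'.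
rewrite !hP //; last first.
  by move=> x xi xi'; apply/rowP => y; rewrite !mxE /= tpermD // eq_sym.
rewrite scaler_sumr; apply: eq_bigr => s si.
rewrite [RHS]scalerAl; congr (_ * _); rewrite [RHS]scalerAr; congr (_ * _).
rewrite !mxE /= tpermL tpermR.
rewrite (qm_diagonal hU fi si) (qm_antidiagonal hU fi si).
rewrite -[_ - _ - _]addrA -opprD -scalerDl subrK scalerBr scalerA mulNr divff.
  by rewrite scaleN1r opprK addrC scaleNr.
by rewrite eq_complex /= negb_and (gt_eqF q_gt0).
Qed.

(** Induction on the inversions of f: an adjacent descent is removed by a swap, equal adjacent rows
    give 0, and without either f is strictly increasing, hence injective. *)
Lemma qdet_row_noninj m n (U : 'M[A]_(m, n)) (f : 'I_n -> 'I_m) (i j : 'I_n) :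
  quantum_matrix U -> i != j -> f i = f j -> qdet q (rowsub f U) = 0.
Proof.
move=> hU; have [k] := ubnP (fun_inversions f); elim: k f i j => // k IH f i j fk ij fij.
have [[x [x' [xx' fx]]]|h] :=
    pselect (exists x x' : 'I_n, x' = x.+1 :> nat /\ (f x' <= f x)%N); last first.
  have hf : {homo f : x y / (x < y)%N}.
    apply: homo_ord_adjacent => x x' xx'; rewrite ltnNge; apply/negP => fx.
    by apply: h; exists x, x'.
  move: ij; rewrite -val_eqE neq_ltn => /orP[] /hf; rewrite fij ltnn //.
move: fx; rewrite leq_eqVlt => /orP[/eqP fx|fx].
  by apply: qdet_row_eq xx' _ => //; apply: val_inj.
pose g := f \o tperm x x'.
have -> : rowsub f U = rowsub (g \o tperm x x') U.
  by apply/matrixP => y z; rewrite /g !mxE /= tpermK.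
have gx : (g x < g x')%N by rewrite /g /= tpermL tpermR.
rewrite qdet_row_swap // (IH _ (tperm x x' i) (tperm x x' j)) ?scaler0 //.
- have := fun_inversions_tperm (f := val \o g) xx' gx.
  have -> : fun_inversions ((val \o g) \o tperm x x') = fun_inversions f.
    by apply: eq_bigr => y _; apply: eq_bigr => z _; rewrite /g /= !tpermK.
  by move=> e; move: fk; rewrite e.
- by rewrite (inj_eq perm_inj).
- by rewrite /g /= !tpermK.
Qed.

Lemma qdet_row_perm n (U : 'M[A]_n) (s : 'S_n) : quantum_matrix U ->
  qdet q (rowsub s U) = (- q%:C) ^+ inversions s *: qdet q U.
Proof.
move=> hU; have [k] := ubnP (inversions s); elim: k s => // k IH s sk.
have [->|/perm_descent[i [i' [ii' si]]]] := eqVneq s 1%g.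
  rewrite inversions1 scale1r; congr qdet; apply/matrixP => x y.
  by rewrite !mxE perm1.
pose t := (tperm i i' * s)%g.
have st : s = (tperm i i' * t)%g by rewrite mulgA tperm2 mul1g.
have ti : (t i < t i')%N by rewrite !permM tpermL tpermR.
have inv_s : inversions s = (inversions t).+1 by rewrite {1}st inversions_tpermS.
have -> : rowsub s U = rowsub (t \o tperm i i') U.
  by apply/matrixP => x y; rewrite !mxE /= {1}st permM.
rewrite qdet_row_swap // IH; first by rewrite scalerA -exprS inv_s.
by move: sk; rewrite inv_s ltnS.
Qed.

(* Summing [qdet_row_perm] over all rows permutations with the weights
   (-q)^{i(s)}, once for U and once for its transpose. *)
Lemma qdet_tr n (U : 'M[A]_n) : quantum_matrix U -> qdet q U^T = qdet q U.
Proof.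
move=> hU; pose e (s : 'S_n) : C := (- q%:C) ^+ inversions s.
pose S := \sum_s e s * e s.
(* Every summand is the square of a real number, and s = 1 contributes 1. *)
have S0 : S != 0.
  rewrite gt_eqF // /S (bigD1 1%g) //= ltr_pwDl //.
    by rewrite /e inversions1 mulr1 ltr01.
  apply: sumr_ge0 => s _; rewrite -expr2 -exprM mulnC exprM sqrrN -exprM.
  by apply: exprn_ge0; rewrite lecR ltW.
apply: (scalerI S0); rewrite /S !scaler_suml.
transitivity (\sum_s \sum_t (e s * e t) *: \prod_(x < n) U (s x) (t x)); last first.
  apply: eq_bigr => s _; rewrite -scalerA -qdet_row_perm // scaler_sumr.
  by apply: eq_bigr => t _; rewrite scalerA; congr (_ *: _); apply: eq_bigr => x _; rewrite mxE.
rewrite exchange_big; apply: eq_bigr => t _.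
rewrite -scalerA -qdet_row_perm; last exact: quantum_matrix_tr.
rewrite scaler_sumr; apply: eq_bigr => s _; rewrite scalerA mulrC.
by congr (_ *: _); apply: eq_bigr => x _; rewrite !mxE.
Qed.

Lemma big_lift_perm (V : nmodType) n (i : 'I_n.+1) (F : 'S_n.+1 -> V) :
  \sum_s F s = \sum_k \sum_(s : 'S_n) F (lift_perm i k s).
Proof.
rewrite pair_big /= (reindex (fun p : 'I_n.+1 * 'S_n => lift_perm i p.1 p.2)) //=.
apply/onW_bij/inj_card_bij; last by rewrite card_prod !card_Sn card_ord.
move=> [k s] [k' s'] /= e.
have kk' : k = k' by have := congr1 (fun t : 'S_n.+1 => t i) e; rewrite !lift_perm_id.
rewrite -kk' in e *; congr (_, _); apply/permP => x; apply: (@lift_inj _ k).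
by rewrite -!(lift_perm_lift i) e.
Qed.

(** The factors of each product are ordered by rows, so an entry can be pulled out to the left from
    the first row and to the right from the last one; this accounts for the two expansions. *)
Lemma qdet_row0 n (M : 'M[A]_n.+1) :
  qdet q M = \sum_(k < n.+1) (- q%:C) ^+ k *: (M ord0 k * qdet q (row' ord0 (col' k M))).
Proof.
rewrite /qdet (big_lift_perm ord0); apply: eq_bigr => k _.
rewrite mulr_sumr scaler_sumr; apply: eq_bigr => s _.
rewrite inversions_lift_perm0 exprD big_ord_recl lift_perm_id -scalerAr scalerA.
congr (_ *: (_ * _)); apply: eq_bigr => x _.
by rewrite lift_perm_lift !mxE.
Qed.

Lemma qdet_row_max n (M : 'M[A]_n.+1) :
  qdet q M = \sum_(k < n.+1) (- q%:C) ^+ (n - k) *: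
    (qdet q (row' ord_max (col' k M)) * M ord_max k).
Proof.
rewrite /qdet (big_lift_perm ord_max); apply: eq_bigr => k _.
rewrite mulr_suml scaler_sumr; apply: eq_bigr => s _.
rewrite inversions_lift_perm_max exprD big_ord_recr lift_perm_id -scalerAl scalerA /=.
congr (_ *: (_ * _)); apply: eq_bigr => x _.
have -> : widen_ord (leqnSn n) x = lift ord_max x.
  by apply: val_inj; rewrite [RHS]lift_max.
by rewrite lift_perm_lift !mxE.
Qed.

(** The (s, k) entry is the formula for u_ks^*: the transpose of the matrix of adjoints, which will
    be the inverse of U. *)
Definition qcofactor n (U : 'M[A]_n) : 'M[A]_n :=
  \matrix_(s, k) ((- q%:C) ^ ((s : nat)%:Z - (k : nat)%:Z) *:
    qdet q (row' k (col' s U))).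

Let nq_neq0 : - q%:C != 0.
Proof. by rewrite oppr_eq0 eq_complex /= negb_and (gt_eqF q_gt0). Qed.

(** Row k is deleted and row j put in front: for j = k this is a cyclic permutation with k
    inversions, otherwise row j occurs twice. *)
Lemma qdet_front n (U : 'M[A]_n.+1) (j k : 'I_n.+1) : quantum_matrix U ->
  qdet q (rowsub (fun x => if unlift ord0 x is Some y then lift k y else j) U) =
  if j == k then (- q%:C) ^+ k *: qdet q U else 0.
Proof.
move=> hU; case: eqVneq => [->|jk].
  rewrite -[k in _ ^+ k]addn0 -(inversions1 n) -inversions_lift_perm0.
  rewrite -qdet_row_perm //; congr qdet; apply/matrixP => x y; rewrite !mxE.
  by case: unliftP => [z|] ->; rewrite ?lift_perm_lift ?perm1 ?lift_perm_id.
have [j' jE _] : {j' | j = lift k j' & unlift k j = Some j'} by apply: unlift_some; rewrite eq_sym.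
apply: (@qdet_row_noninj _ _ _ _ ord0 (lift ord0 j')) => //.
by rewrite liftK unlift_none.
Qed.

Lemma qdet_back n (U : 'M[A]_n.+1) (j k : 'I_n.+1) : quantum_matrix U ->
  qdet q (rowsub (fun x => if unlift ord_max x is Some y then lift k y else j) U) =
  if j == k then (- q%:C) ^+ (n - k) *: qdet q U else 0.
Proof.
move=> hU; case: eqVneq => [->|jk].
  rewrite -[(n - k)%N]addn0 -(inversions1 n) -inversions_lift_perm_max.
  rewrite -qdet_row_perm //; congr qdet; apply/matrixP => x y; rewrite !mxE.
  by case: unliftP => [z|] ->; rewrite ?lift_perm_lift ?perm1 ?lift_perm_id.
have [j' jE _] : {j' | j = lift k j' & unlift k j = Some j'} by apply: unlift_some; rewrite eq_sym.
apply: (@qdet_row_noninj _ _ _ _ ord_max (lift ord_max j')) => //.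
  exact: neq_lift.
by rewrite liftK unlift_none.
Qed.

Lemma mul_qcofactor n (U : 'M[A]_n) : quantum_matrix U ->
  U *m qcofactor U = (qdet q U)%:M.
Proof.
case: n U => [|n] U hU; apply/matrixP; first by case.
move=> j k; rewrite !mxE.
have := qdet_front j k hU; rewrite qdet_row0.
move=> /(congr1 (fun a => (- q%:C) ^ (- (k : nat)%:Z) *: a)).
rewrite scaler_sumr => e; transitivity (if j == k then qdet q U else 0); last by case: eqP.
transitivity ((- q%:C) ^- k *: (if j == k then (- q%:C) ^+ k *: qdet q U else 0)); last first.
  by case: ifP => _; rewrite ?scaler0 // scalerA mulVf ?scale1r // expf_neq0.
rewrite exprnN -e; apply: eq_bigr => s _; rewrite !mxE unlift_none -scalerAr scalerA.
rewrite addrC expfzDr // exprnP; congr (_ *: (_ * qdet _ _)).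
by apply/matrixP => x y; rewrite !mxE liftK.
Qed.

(** The cofactor has to stand on the left, which the expansion along the last row provides; since
    the sum runs over the rows of U, it is applied to the transpose. *)
Lemma qcofactor_mul n (U : 'M[A]_n) : quantum_matrix U ->
  qcofactor U *m U = (qdet q U)%:M.
Proof.
case: n U => [|n] U hU; apply/matrixP; first by case.
move=> j k; rewrite !mxE.
have := qdet_back k j (quantum_matrix_tr hU); rewrite qdet_row_max qdet_tr //.
move=> /(congr1 (fun a => (- q%:C) ^ (- (n - j)%N%:Z) *: a)).
rewrite scaler_sumr => e; transitivity (if k == j then qdet q U else 0); last first.
  by rewrite eq_sym; case: eqP.
transitivity ((- q%:C) ^- (n - j)%N *: (if k == j then (- q%:C) ^+ (n - j) *: qdet q U else 0)); last first.
  by case: ifP => _; rewrite ?scaler0 // scalerA mulVf ?scale1r // expf_neq0.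
rewrite exprnN -e; apply: eq_bigr => s _; rewrite !mxE unlift_none -scalerAl scalerA.
have [jn sn] : (j <= n)%N /\ (s <= n)%N by rewrite !leq_ord.
rewrite exprnP -expfzDr // -!subzn // opprB [_ - n%:Z + _]addrA subrK.
congr (_ *: (_ * _)); rewrite -qdet_tr; last exact: quantum_matrix_minor.
by congr qdet; apply/matrixP => x y; rewrite !mxE liftK.
Qed.

Definition frt_diag (i j : nat) : C := if (i < j)%N then q%:C - q%:C^-1 else 0.
Definition frt_swap (i j : nat) : C := if i == j then q%:C else 1.

Let q_neq0 : q%:C != 0.
Proof. by rewrite eq_complex /= negb_and (gt_eqF q_gt0). Qed.

(* The defining relations say that U (x) U commutes with the Hecke-type matrix
   B e_i (x) e_j = frt_diag i j e_i (x) e_j + frt_swap i j e_j (x) e_i. *)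
Lemma quantum_matrix_frt m n (U : 'M[A]_(m, n)) : quantum_matrix U ->
  forall (i j : 'I_m) (k l : 'I_n),
  frt_diag i j *: (U i k * U j l) + frt_swap i j *: (U j k * U i l) =
  frt_diag k l *: (U i k * U j l) + frt_swap k l *: (U i l * U j k).
Proof.
case=> hc hr ha hd i j k l; rewrite /frt_diag /frt_swap.
case: (ltngtP i j) => [ij|ji|/val_inj ->].
- case: (ltngtP k l) => [kl|lk|/val_inj ->].
  + by rewrite (ha i j l k).
  + by rewrite scale0r add0r !scale1r (hd i j l k) // -[q%:C^-1 - _]opprB scaleNr opprK addrC.
  + rewrite scale0r add0r scale1r (hc i j l) // scalerA mulrBl mulVf // scalerBl scale1r subrK.
    by rewrite scalerA.
- case: (ltngtP k l) => [kl|lk|/val_inj ->].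
  + rewrite scale0r add0r !scale1r (hd j i k l) // (ha j i l k) //.
    by rewrite -[q%:C^-1 - _]opprB scaleNr opprK addrC.
  + by rewrite !scale0r !add0r !scale1r (ha j i k l).
  + by rewrite !scale0r !add0r scale1r (hc j i l).
rewrite scale0r add0r; case: (ltngtP k l) => [kl|lk|/val_inj ->].
- rewrite scale1r (hr j k l) // [in RHS]scalerA mulrBl mulVf // scalerBl scale1r subrK.
  by rewrite scalerA.
- by rewrite scale0r add0r scale1r (hr j l k).
by rewrite scale0r add0r.
Qed.

(** X = U (x) U has an inverse W in which the two factors come in the opposite order, and BX = XB
    gives WB = W (XB) W... in the form WB = W B X W = W X B W = BW. *)
Lemma frt_inverse n (U V : 'M[A]_n) : quantum_matrix U ->
  U *m V = 1%:M -> V *m U = 1%:M -> forall i j k l : 'I_n,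
  frt_diag i j *: (V l j * V k i) + frt_swap i j *: (V l i * V k j) =
  frt_diag k l *: (V l j * V k i) + frt_swap k l *: (V k j * V l i).
Proof.
move=> hU /matrixP UV /matrixP VU i j k l.
pose sw (p : 'I_n * 'I_n) := (p.2, p.1).
pose Bl (f : 'I_n * 'I_n -> 'I_n * 'I_n -> A) (p r : 'I_n * 'I_n) :=
  frt_diag p.1 p.2 *: f p r + frt_swap p.1 p.2 *: f (sw p) r.
pose Br (f : 'I_n * 'I_n -> 'I_n * 'I_n -> A) (p r : 'I_n * 'I_n) :=
  frt_diag r.1 r.2 *: f p r + frt_swap r.1 r.2 *: f p (sw r).
have adj f g p r : \sum_s f p s * Bl g s r = \sum_s Br f p s * g s r.
  rewrite /Bl /Br; under eq_bigr do rewrite mulrDr -!scalerAr.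
  under [RHS]eq_bigr do rewrite mulrDl -!scalerAl.
  rewrite !big_split; congr (_ + _); rewrite (reindex_inj (inv_inj (_ : involutive sw))) /=.
    by apply: eq_bigr => -[a b] _; rewrite /frt_swap /= eq_sym.
  by case.
pose X (p r : 'I_n * 'I_n) := U p.1 r.1 * U p.2 r.2.
pose W (p r : 'I_n * 'I_n) := V p.2 r.2 * V p.1 r.1.
have assoc (f g h : 'I_n * 'I_n -> 'I_n * 'I_n -> A) p r :
    \sum_s f p s * (\sum_t g s t * h t r) = \sum_t (\sum_s f p s * g s t) * h t r.
  under eq_bigr do rewrite mulr_sumr; rewrite exchange_big.
  by apply: eq_bigr => t _; rewrite mulr_suml; apply: eq_bigr => s _; rewrite mulrA.
have sandwich (F G : 'I_n -> A) (b b' : bool) : \sum_a F a * G a = b%:R ->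
    \sum_a F a * b'%:R * G a = (b && b')%:R.
  move=> e; case: b'; rewrite ?andbT ?andbF.
    by rewrite -e; apply: eq_bigr => a _; rewrite mulr1.
  by rewrite big1 // => a _; rewrite mulr0 mul0r.
have XW p r : \sum_s X p s * W s r = (p == r)%:R.
  transitivity (\sum_a U p.1 a * (\sum_b U p.2 b * V b r.2) * V a r.1).
    rewrite -(pair_bigA _ (fun a b => U p.1 a * U p.2 b * (V b r.2 * V a r.1))) /=.
    apply: eq_bigr => a _; rewrite mulr_sumr mulr_suml.
    by apply: eq_bigr => b _; rewrite !mulrA.
  have := UV p.2 r.2; rewrite !mxE => ->.
  by rewrite -pair_eqE; apply: sandwich; have := UV p.1 r.1; rewrite !mxE.
have WX p r : \sum_s W p s * X s r = (p == r)%:R.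
  transitivity (\sum_b V p.2 b * (\sum_a V p.1 a * U a r.1) * U b r.2).
    rewrite -(pair_bigA _ (fun a b => V p.2 b * V p.1 a * (U a r.1 * U b r.2))) /=.
    rewrite exchange_big; apply: eq_bigr => b _; rewrite mulr_sumr mulr_suml.
    by apply: eq_bigr => a _; rewrite !mulrA.
  have := VU p.1 r.1; rewrite !mxE => ->.
  by rewrite -pair_eqE /= andbC; apply: sandwich; have := VU p.2 r.2; rewrite !mxE.
have BX p r : Bl X p r = Br X p r.
  by rewrite /Bl /Br /X /=; exact: quantum_matrix_frt.
have WB p r : Br W p r = Bl W p r.
  transitivity (\sum_s Br W p s * (\sum_t X s t * W t r)).
    rewrite (bigD1 r) //= XW eqxx mulr1 big1 ?addr0 // => s sr.
    by rewrite XW (negbTE sr) mulr0.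
  transitivity (\sum_t (\sum_s W p s * X s t) * Bl W t r); last first.
    rewrite (bigD1 p) //= WX eqxx mul1r big1 ?addr0 // => s sr.
    by rewrite WX eq_sym (negbTE sr) mul0r.
  rewrite assoc; under eq_bigr => t _ do
    rewrite -adj (eq_bigr _ (fun s _ => congr1 _ (BX s t))).
  rewrite -(assoc W (Br X) W p r); under eq_bigr => s _ do rewrite -adj.
  exact: assoc.
by have := WB (k, l) (i, j); rewrite /Br /Bl /W /=.
Qed.

(* [P i k j l] stands for the product of the (i, k) and the (j, l) entries, in
   either order. *)
Lemma frt_relations (W : lmodType C) m n (P : 'I_m -> 'I_n -> 'I_m -> 'I_n -> W) :
  (forall (i j : 'I_m) (k l : 'I_n), frt_diag i j *: P i k j l + frt_swap i j *: P j k i l =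
                   frt_diag k l *: P i k j l + frt_swap k l *: P i l j k) ->
  [/\ forall (i k : 'I_m) j, (i < k)%N -> P i j k j = q%:C *: P k j i j,
      forall i (j l : 'I_n), (j < l)%N -> P i j i l = q%:C *: P i l i j,
      forall (i k : 'I_m) (j l : 'I_n), (i < k)%N -> (l < j)%N ->
        P i j k l = P k l i j
    & forall (i k : 'I_m) (j l : 'I_n), (i < k)%N -> (j < l)%N ->
        P i j k l = P k l i j - (q%:C^-1 - q%:C) *: P i l k j].
Proof.
rewrite /frt_diag /frt_swap => hP; split=> [i k j ik|i j l jl|i k j l ik lj|i k j l ik jl].
- have := hP i k j j; rewrite ik (ltn_eqF ik) eqxx ltnn scale0r add0r scale1r scalerBl.
  move/eqP; rewrite -addrA -subr_eq0 addrAC subrr add0r addrC subr_eq0 => /eqP ->.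
  by rewrite scalerA divff // scale1r.
- have := hP i i j l; rewrite jl (ltn_eqF jl) eqxx ltnn scale0r add0r scale1r scalerBl.
  move/esym/eqP; rewrite -addrA -subr_eq0 addrAC subrr add0r addrC subr_eq0 => /eqP ->.
  by rewrite scalerA divff // scale1r.
- have := hP i k l j; rewrite ik lj (ltn_eqF ik) (ltn_eqF lj) !scale1r.
  by move=> /addrI.
have := hP i k l j; rewrite ik (ltn_eqF ik) (gtn_eqF jl) ltnNge (ltnW jl) /= scale0r add0r !scale1r.
by move=> <-; rewrite -[q%:C^-1 - _]opprB scaleNr opprK addrC.
Qed.

End QuantumMatrix.

(** * Morphisms out of SU_q(N) *)

(* Rewriting in [free_alg] compares products by unfolding them; these lemmas keep
   the source of the morphism abstract. *)
Section Relators.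
Variables (C : pzRingType) (A B : lalgType C) (e : B -> A).
Hypothesis eB : forall x y, e (x - y) = e x - e y.
Hypothesis eZ : forall c x, e (c *: x) = c *: e x.
Hypothesis eM : forall x y, e (x * y) = e x * e y.

Lemma morph_qcomm c x y : e (x * y - c *: (y * x)) = e x * e y - c *: (e y * e x).
Proof. by rewrite eB eZ !eM. Qed.

Lemma morph_comm x y : e (x * y - y * x) = e x * e y - e y * e x.
Proof. by rewrite eB !eM. Qed.

Lemma morph_diagonal c x y z t : e (x * y - (y * x - c *: (z * t))) =
  e x * e y - (e y * e x - c *: (e z * e t)).
Proof. by rewrite !eB eZ !eM. Qed.

End Relators.

Section Free.
Variables (R : realType) (N : nat).
Local Notation C := R[i].
Local Notation F := (free_alg R N).

Lemma free_ind (P : F -> Prop) :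
  P 0 -> (forall c x y, P x -> P y -> P (c *: x + y)) -> P 1 ->
  (forall j k x, P x -> P (free_gen R j k * x)) -> forall x, P x.
Proof.
move=> P0 PD P1 PM x; rewrite [x]monalgE; elim/big_rec: _ => // w y _ Py.
have -> : << x@_w *g w >> = x@_w *: (<< w >> : F).
  by rewrite -mul_malgC malgM_def fgmulUU mulr1 mul1m.
apply: PD => //; case: w => w; elim: w => [|[j k] w IH].
  by have -> : << FMonom [::] >> = 1 :> F by rewrite -fmoneE.
have -> : << FMonom ((j, k) :: w) >> = free_gen R j k * << FMonom w >> :> F.
  rewrite /free_gen malgM_def fgmulUU mulr1.
  by congr (mkmalgU _ _); apply/eqP; rewrite fmP fmM fmU.
exact: PM.
Qed.

Lemma free_anti_morphism (A : algType C) (f : {additive C -> A})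
    (h : {fmonom gen N} -> A) :
  (forall c d, f (c * d) = f c * f d) -> (forall c a, f c * a = a * f c) ->
  (forall v w, h (mmul v w) = h w * h v) ->
  forall x y : F, mmap f h (x * y) = mmap f h y * mmap f h x.
Proof.
move=> fM fC hM x y; rewrite malgME raddf_sum /= [in RHS](mmapE f h x) mulr_sumr.
apply: eq_bigr => v _; rewrite raddf_sum /= mmapE mulr_suml; apply: eq_bigr => w _.
rewrite mmapU hM fM [f x@_v * f _]fC -!mulrA; congr (_ * _).
by rewrite !mulrA fC.
Qed.

End Free.

Section Universal.
Variables (R : realType) (q : R) (N : nat) (A : algType R[i]).
Hypothesis q_gt0 : 0 < q.
Local Notation C := R[i].
Local Notation F := (free_alg R N).
Local Notation u := (@free_gen R N).
Variable g : gen N -> A.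

Definition algebra_eval : F -> A := free_eval (in_alg A) g.

Lemma algebra_evalM x y : algebra_eval (x * y) = algebra_eval x * algebra_eval y.
Proof.
apply: (commr_mmap_is_multiplicative _).1 => c w v /=.
by rewrite /GRing.comm mulr_algl mulr_algr.
Qed.

Lemma algebra_eval1 : algebra_eval 1 = 1.
Proof. exact: mmap1. Qed.

Lemma algebra_evalP c x y :
  algebra_eval (c *: x + y) = c *: algebra_eval x + algebra_eval y.
Proof. by rewrite /algebra_eval /free_eval mmapD mmapZ /= mulr_algl. Qed.

Lemma algebra_eval_gen j k : algebra_eval (u j k) = g (j, k).
Proof.
by rewrite /algebra_eval /free_eval /free_gen mmapU /= scale1r mul1r /word_eval
           fmU big_seq1.
Qed.


Lemma algebra_eval0 : algebra_eval 0 = 0.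
Proof. exact: mmap0. Qed.

Lemma algebra_evalB x y : algebra_eval (x - y) = algebra_eval x - algebra_eval y.
Proof. exact: mmapB. Qed.

Lemma algebra_evalZ c x : algebra_eval (c *: x) = c *: algebra_eval x.
Proof. by rewrite -[_ *: x]addr0 algebra_evalP algebra_eval0 addr0. Qed.

Lemma algebra_eval_prod I (r : seq I) (x : I -> F) :
  algebra_eval (\prod_(i <- r) x i) = \prod_(i <- r) algebra_eval (x i).
Proof. exact: (big_morph _ algebra_evalM algebra_eval1). Qed.

Lemma algebra_eval_sum I (r : seq I) P (x : I -> F) :
  algebra_eval (\sum_(i <- r | P i) x i) = \sum_(i <- r | P i) algebra_eval (x i).
Proof.
apply: (big_morph _ _ algebra_eval0) => a b.
by rewrite -[a]scale1r algebra_evalP !scale1r.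
Qed.

Definition algebra_eval_qcomm := morph_qcomm algebra_evalB algebra_evalZ algebra_evalM.
Definition algebra_eval_comm := morph_comm algebra_evalB algebra_evalM.
Definition algebra_eval_diagonal := morph_diagonal algebra_evalB algebra_evalZ algebra_evalM.

Definition gen_matrix : 'M[A]_N := \matrix_(j, k) g (j, k).

Lemma algebra_eval_qdet : algebra_eval (qdet q (\matrix_(j, k) u j k)) = qdet q gen_matrix.
Proof.
rewrite algebra_eval_sum; apply: eq_bigr => s _.
rewrite algebra_evalZ algebra_eval_prod; congr (_ *: _).
by apply: eq_bigr => i _; rewrite !mxE algebra_eval_gen.
Qed.

Hypothesis g_quantum : quantum_matrix q gen_matrix.

(** The determinant relator is kept apart: for the kernel of s_{n,N}, the family [g] will satisfy
    the quadratic relations, but its determinant will be 1 only modulo an ideal. *)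
Lemma algebra_eval_relator r : SUq_relator q r ->
  algebra_eval r = 0 \/ r = qdet q (\matrix_(j, k) u j k) - 1.
Proof.
case=> [i k j ik|i j l jl|i k j l ik lj|i k j l ik jl|]; last by right.
- left; rewrite algebra_eval_qcomm (algebra_eval_gen i j) (algebra_eval_gen k j).
  by have := qm_column g_quantum j ik; rewrite !mxE => ->; rewrite subrr.
- left; rewrite algebra_eval_qcomm (algebra_eval_gen i j) (algebra_eval_gen i l).
  by have := qm_row g_quantum i jl; rewrite !mxE => ->; rewrite subrr.
- left; rewrite algebra_eval_comm (algebra_eval_gen i j) (algebra_eval_gen k l).
  by have := qm_antidiagonal g_quantum ik lj; rewrite !mxE => ->; rewrite subrr.
- left; rewrite algebra_eval_diagonal (algebra_eval_gen i j) (algebra_eval_gen k l).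
  rewrite (algebra_eval_gen i l) (algebra_eval_gen k j).
  by have := qm_diagonal g_quantum ik jl; rewrite !mxE => ->; rewrite subrr.
Qed.

Lemma algebra_eval_ideal x : qdet q gen_matrix = 1 -> SUq_ideal q x -> algebra_eval x = 0.
Proof.
move=> det1; elim: x / => [|x a r b _ IH Hr]; first exact: algebra_eval0.
rewrite -[x]scale1r algebra_evalP IH scaler0 add0r !algebra_evalM.
case: (algebra_eval_relator Hr) => ->; rewrite ?mulr0 ?mul0r //.
by rewrite algebra_evalB algebra_eval_qdet algebra_eval1 det1 subrr mulr0 mul0r.
Qed.

End Universal.

Section SUqBasics.
Variables (R : realType) (q : R) (N : nat).
Hypothesis q_gt0 : 0 < q.
Local Notation C := R[i].
Local Notation F := (free_alg R N).
Local Notation S := (SUq q N).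
Local Notation pi := (@SUq_pi R q N).

Lemma SUq_piP_lin c x y : pi (c *: x + y) = c *: pi x + pi y.
Proof. by rewrite SUq_piD SUq_piZ. Qed.

Lemma SUq_piMr x y : pi (x * y) = pi x * pi y.
Proof. exact: SUq_piM. Qed.

Lemma SUq_pi1 : pi 1 = 1.
Proof. by []. Qed.

Lemma SUq_pi0 : pi 0 = 0.
Proof. by rewrite -[0 in LHS](scale0r (0 : F)) SUq_piZ -[SUq_scale _ _]/(0 *: pi 0) scale0r. Qed.

Lemma SUq_ind (P : S -> Prop) :
  (forall c a b, P a -> P b -> P (c *: a + b)) -> P 1 ->
  (forall j k a, P a -> P (SUq_gen q j k * a)) -> forall a, P a.
Proof.
move=> PD P1 PM a; rewrite -[a]SUq_piK; elim/free_ind: (repr _) => [|c x y Px Py||j k x Px].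
- by rewrite SUq_pi0 -(addNr 1) -scaleN1r; exact: PD.
- by rewrite SUq_piP_lin; exact: PD.
- exact: P1.
- by rewrite SUq_piMr; exact: PM.
Qed.

Definition SUq_matrix : 'M[S]_N := \matrix_(j, k) SUq_gen q j k.

(** Presents the quotient map as an evaluation, so that the computation rules of [algebra_eval] on
    relators apply to it. *)
Lemma SUq_pi_eval x : pi x = algebra_eval (fun p => SUq_gen q p.1 p.2) x.
Proof.
elim/free_ind: x => [|c x y Px Py||j k x Px].
- by rewrite SUq_pi0 algebra_eval0.
- by rewrite SUq_piP_lin algebra_evalP Px Py.
- by rewrite algebra_eval1.
- by rewrite SUq_piMr algebra_evalM algebra_eval_gen Px.
Qed.

Lemma SUq_pi_relator r : SUq_relator q r -> pi r = 0.
Proof.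
move=> Hr; rewrite -SUq_pi0; apply/SUq_piP; rewrite subr0 -[r]add0r.
by rewrite -[r]mul1r -[_ * r]mulr1; apply: SUq_idealD Hr; exact: SUq_ideal0.
Qed.

Lemma SUq_matrix_quantum : quantum_matrix q SUq_matrix.
Proof.
have e (r : F) : SUq_relator q r -> algebra_eval (fun p => SUq_gen q p.1 p.2) r = 0.
  by move=> Hr; rewrite -[RHS](SUq_pi_relator Hr); exact/esym/SUq_pi_eval.
split=> [i k j ik|i j l jl|i k j l ik lj|i k j l ik jl]; rewrite !mxE;
  apply/eqP; rewrite -subr_eq0.
- by have := e _ (SUq_rel_column q j ik); rewrite algebra_eval_qcomm
    (algebra_eval_gen _ i j) (algebra_eval_gen _ k j) => ->.
- by have := e _ (SUq_rel_row q i jl); rewrite algebra_eval_qcomm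
    (algebra_eval_gen _ i j) (algebra_eval_gen _ i l) => ->.
- by have := e _ (SUq_rel_antidiagonal q ik lj); rewrite algebra_eval_comm
    (algebra_eval_gen _ i j) (algebra_eval_gen _ k l) => ->.
- by have := e _ (SUq_rel_diagonal q ik jl); rewrite algebra_eval_diagonal
    (algebra_eval_gen _ i j) (algebra_eval_gen _ k l) (algebra_eval_gen _ i l)
    (algebra_eval_gen _ k j) => ->.
Qed.

Lemma SUq_matrix_det : qdet q SUq_matrix = 1.
Proof.
have := SUq_pi_relator (SUq_rel_det q N).
rewrite SUq_pi_eval algebra_evalB algebra_eval_qdet algebra_eval1 => /eqP.
by rewrite subr_eq0 => /eqP <-; congr qdet; apply/matrixP => i j; rewrite !mxE.
Qed.

Lemma SUq_matrix_starE : qcofactor q SUq_matrix = \matrix_(k, j) SUq_gen_star q j k.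
Proof. by apply/matrixP => k j; rewrite !mxE. Qed.

Lemma SUq_matrix_mul_cofactor : SUq_matrix *m qcofactor q SUq_matrix = 1%:M.
Proof. exact: etrans (mul_qcofactor q_gt0 SUq_matrix_quantum) (congr1 (fun a => a%:M : 'M_N) SUq_matrix_det). Qed.

Lemma SUq_cofactor_mul_matrix : qcofactor q SUq_matrix *m SUq_matrix = 1%:M.
Proof. exact: etrans (qcofactor_mul q_gt0 SUq_matrix_quantum) (congr1 (fun a => a%:M : 'M_N) SUq_matrix_det). Qed.

Lemma SUq_unitary (j k : 'I_N) :
  \sum_s SUq_gen q j s * SUq_gen_star q k s = (j == k)%:R.
Proof.
have /matrixP/(_ j k) := SUq_matrix_mul_cofactor; rewrite !mxE => <-.
by apply: eq_bigr => s _; rewrite !mxE.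
Qed.

Lemma SUq_unitary_star (j k : 'I_N) :
  \sum_s SUq_gen_star q s j * SUq_gen q s k = (j == k)%:R.
Proof.
have /matrixP/(_ j k) := SUq_cofactor_mul_matrix; rewrite !mxE => <-.
by apply: eq_bigr => s _; rewrite !mxE.
Qed.

Lemma counitP c (a b : S) : counit (c *: a + b) = c * counit a + counit b.
Proof.
rewrite -[a]SUq_piK -[b]SUq_piK -SUq_piP_lin !counit_pi raddfD /=.
by congr (_ + _); exact: linearZ.
Qed.

Lemma counitM (a b : S) : counit (a * b) = counit a * counit b.
Proof. by rewrite -[a]SUq_piK -[b]SUq_piK -SUq_piMr !counit_pi; exact: rmorphM. Qed.

Lemma counit1 : counit (1 : S) = 1.
Proof. by rewrite -SUq_pi1 counit_pi; exact: rmorph1. Qed.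

Lemma counit_gen (j k : 'I_N) : counit (SUq_gen q j k : S) = (j == k)%:R.
Proof. by rewrite /SUq_gen counit_pi free_counit_gen. Qed.

Lemma counit0 : counit (0 : S) = 0.
Proof. by rewrite -SUq_pi0 counit_pi; exact: raddf0. Qed.

End SUqBasics.

(** * The involution *)

Section AntiRelators.
Variables (C : pzRingType) (A B : lalgType C) (e : B -> A) (conj : C -> C).
Hypothesis eB : forall x y, e (x - y) = e x - e y.
Hypothesis eZ : forall c x, e (c *: x) = conj c *: e x.
Hypothesis eM : forall x y, e (x * y) = e y * e x.

Lemma anti_qcomm c x y : e (x * y - c *: (y * x)) = e y * e x - conj c *: (e x * e y).
Proof. by rewrite eB eZ !eM. Qed.

Lemma anti_comm x y : e (x * y - y * x) = e y * e x - e x * e y.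
Proof. by rewrite eB !eM. Qed.

Lemma anti_diagonal c x y z t : e (x * y - (y * x - c *: (z * t))) =
  e y * e x - (e x * e y - conj c *: (e t * e z)).
Proof. by rewrite !eB eZ !eM. Qed.

Lemma anti_prod (e1 : e 1 = 1) I (r : seq I) (F : I -> B) :
  e (\prod_(i <- r) F i) = \prod_(i <- rev r) e (F i).
Proof.
elim: r => [|i r IH]; first by rewrite !big_nil.
by rewrite big_cons eM IH rev_cons -cats1 big_cat /= big_seq1.
Qed.

End AntiRelators.

Section SumOverWords.
Variables (A : pzRingType).

Lemma sum_ffunS n m (F : {ffun 'I_n.+1 -> 'I_m} -> A) :
  \sum_f F f = \sum_y \sum_(f : {ffun 'I_n -> 'I_m})
    F [ffun x => if unlift ord0 x is Some z then f z else y].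
Proof.
rewrite pair_big /=.
rewrite (reindex (fun p : 'I_m * {ffun 'I_n -> 'I_m} =>
  [ffun x : 'I_n.+1 => if unlift ord0 x is Some z then p.2 z else p.1])) //=.
apply/onW_bij/inj_card_bij; last by rewrite card_prod !card_ffun !card_ord expnS.
move=> [y f] [y' f'] /= /ffunP e; congr (_, _).
  by have := e ord0; rewrite !ffunE unlift_none.
by apply/ffunP => z; have := e (lift ord0 z); rewrite !ffunE liftK.
Qed.

(** Because the second product is reversed, the sum is nested: the innermost pair of factors sums to
    0 or 1, which commutes with the pair around it. *)
Lemma sum_words n m (F G : 'I_n -> 'I_m -> A) (b : 'I_n -> bool) :
  (forall x, \sum_y F x y * G x y = (b x)%:R) ->
  \sum_(f : {ffun 'I_n -> 'I_m})
    (\prod_(x < n) F x (f x)) * (\prod_(x <- rev (enum 'I_n)) G x (f x)) =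
  [forall x, b x]%:R.
Proof.
elim: n F G b => [|n IH] F G b hb.
  rewrite (eq_bigr (fun=> 1)) => [|f _].
    have -> : [forall x, b x] by apply/forallP => -[].
    by rewrite sumr_const card_ffun !card_ord expn0.
  by rewrite big_ord0 enum_ord0 big_nil mulr1.
rewrite sum_ffunS.
have -> : [forall x, b x] = b ord0 && [forall x, b (lift ord0 x)].
  apply/forallP/andP => [h|[b0 /forallP bl] x]; first by split => //; apply/forallP.
  by case: (unliftP ord0 x) => [z|] ->.
transitivity (\sum_y F ord0 y * [forall x, b (lift ord0 x)]%:R * G ord0 y).
  apply: eq_bigr => y _.
  rewrite -(IH (fun x => F (lift ord0 x)) (fun x => G (lift ord0 x))) //.
  rewrite mulr_sumr mulr_suml; apply: eq_bigr => f _.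
  rewrite big_ord_recl enum_ordSl rev_cons -cats1 big_cat /= big_seq1 -map_rev big_map.
  rewrite !ffunE unlift_none !mulrA; congr (_ * _ * _ * _).
    by apply: eq_bigr => x _; rewrite ffunE liftK.
  by apply: eq_bigr => x _; rewrite ffunE liftK.
case: [forall x, b _]; rewrite ?andbT ?andbF -?hb.
  by apply: eq_bigr => y _; rewrite mulr1.
by rewrite big1 // => y _; rewrite mulr0 mul0r.
Qed.

End SumOverWords.

Section InverseDet.
Variables (R : realType) (q : R) (A : algType R[i]).
Hypothesis q_gt0 : 0 < q.
Local Notation C := R[i].

(* Insert the inverse of U after the columns of the column determinant of U. *)
Lemma qdet_inverse n (U V : 'M[A]_n) : quantum_matrix q U -> qdet q U = 1 ->
  U *m V = 1%:M ->
  \sum_(s : 'S_n) (- q%:C) ^+ inversions s *: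
     \prod_(x <- rev (enum 'I_n)) V (s x) x = 1.
Proof.
move=> hU det1 /matrixP UV; have hUt := quantum_matrix_tr hU.
pose T (f : {ffun 'I_n -> 'I_n}) := qdet q (rowsub f U^T).
(* This double sum is evaluated twice. Repeated columns make [T f] vanish, and for a permutation it
   is (-q)^i(f) as D = 1; on the other hand, expanding [T f] and summing over f first leaves only s
   = 1. *)
transitivity (\sum_(f : {ffun 'I_n -> 'I_n}) T f * \prod_(x <- rev (enum 'I_n)) V (f x) x).
  rewrite [RHS](bigID (fun f : {ffun 'I_n -> 'I_n} => injectiveb f)) /=.
  rewrite [X in _ = _ + X]big1 ?addr0; last first.
    move=> f /injectivePn [x [y xy fxy]].
    by rewrite /T (qdet_row_noninj q_gt0 hUt xy fxy) mul0r.
  rewrite (reindex (@pval _)) /=; last first.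
    pose in_Sn := insubd (1%g : 'S_n).
    by exists in_Sn => /= f Uf; first apply: val_inj; apply: insubdK.
  apply: eq_big => [s|s _]; first by rewrite (valP s).
  have -> : T (pval s) = (- q%:C) ^+ inversions s *: 1.
    rewrite -det1 -(qdet_tr q_gt0 hU) -qdet_row_perm //; congr qdet.
    by apply/matrixP => x y; rewrite !mxE pvalE.
  rewrite -scalerAl mul1r; congr (_ *: _).
  by apply: eq_bigr => x _; rewrite pvalE.
under eq_bigr => f _ do rewrite /T /qdet mulr_suml.
rewrite exchange_big /=.
transitivity (\sum_(s : 'S_n) (- q%:C) ^+ inversions s *: ((s == 1%g)%:R : A)).
  apply: eq_bigr => s _; under eq_bigr => f _ do rewrite -scalerAl.
  rewrite -scaler_sumr; congr (_ *: _).
  have -> : (s == 1%g) = [forall x, s x == x].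
    by apply/eqP/forallP => [-> x|h]; [rewrite perm1|apply/permP => x; rewrite perm1; apply/eqP].
  rewrite -(sum_words (F := fun x y => U (s x) y) (G := fun x y => V y x)).
    by apply: eq_bigr => f _; congr (_ * _); apply: eq_bigr => x _; rewrite !mxE.
  by move=> x; have := UV (s x) x; rewrite !mxE.
rewrite (bigD1 1%g) //= eqxx inversions1 scale1r big1 ?addr0 // => s /negbTE ->.
by rewrite scaler0.
Qed.

End InverseDet.

Section FreeStar.
Variables (R : realType) (q : R) (N : nat).
Hypothesis q_gt0 : 0 < q.
Local Notation C := R[i].
Local Notation F := (free_alg R N).
Local Notation S := (SUq q N).
Local Notation u := (@free_gen R N).

Definition free_star : F -> S :=
  mmap (in_alg S \o Num.conj) (fun w : {fmonom (gen N)} =>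
    \prod_(p <- rev (w : seq (gen N))) SUq_gen_star q p.1 p.2).

Lemma SUq_starE a : SUq_star a = free_star (repr a).
Proof. by []. Qed.

Lemma free_starM x y : free_star (x * y) = free_star y * free_star x.
Proof.
apply: free_anti_morphism => [c d|c a|v w].
- by rewrite /= rmorphM /= -scalerAl mul1r scalerA.
- by rewrite /= mulr_algl mulr_algr.
- by rewrite fmM rev_cat big_cat.
Qed.

Lemma free_star0 : free_star 0 = 0.
Proof. exact: mmap0. Qed.

Lemma free_starB x y : free_star (x - y) = free_star x - free_star y.
Proof. exact: mmapB. Qed.

Lemma free_starD x y : free_star (x + y) = free_star x + free_star y.
Proof. exact: mmapD. Qed.

Lemma free_star1 : free_star 1 = 1.
Proof.
rewrite /free_star [X in mmap _ _ X](_ : 1 = << 1 *g (@mone {fmonom (gen N)}) >>) // mmapU /= fm1 big_nil mulr1.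
by rewrite conjC1 scale1r.
Qed.

Lemma free_starZ c x : free_star (c *: x) = Num.conj c *: free_star x.
Proof.
rewrite -mul_malgC free_starM -[RHS]mulr_algr; congr (_ * _).
by rewrite /free_star mmapU /= fm1 big_nil mulr1.
Qed.

Lemma free_star_gen j k : free_star (u j k) = SUq_gen_star q j k.
Proof.
by rewrite /free_star /free_gen mmapU /= fmU big_seq1 conjC1 scale1r mul1r.
Qed.

Lemma SUq_star_frt (i j k l : 'I_N) :
  frt_diag q i j *: (SUq_gen_star q j l * SUq_gen_star q i k) +
  frt_swap q i j *: (SUq_gen_star q i l * SUq_gen_star q j k) =
  frt_diag q k l *: (SUq_gen_star q j l * SUq_gen_star q i k) +
  frt_swap q k l *: (SUq_gen_star q j k * SUq_gen_star q i l).
Proof.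
have := frt_inverse q_gt0 (SUq_matrix_quantum q N) (SUq_matrix_mul_cofactor N q_gt0)
  (SUq_cofactor_mul_matrix N q_gt0) i j k l.
by rewrite !SUq_matrix_starE !mxE.
Qed.

Lemma conjCq : Num.conj (q%:C) = q%:C.
Proof. exact: conjc_real. Qed.

(** The involution reverses the products of D, which turns D into the sum computed in
    [qdet_inverse]. *)
Lemma free_star_qdet : free_star (qdet q (\matrix_(j, k) u j k)) = 1.
Proof.
rewrite (big_morph _ free_starD free_star0).
rewrite -(qdet_inverse q_gt0 (SUq_matrix_quantum q N) (SUq_matrix_det q N)
  (SUq_matrix_mul_cofactor N q_gt0)).
apply: eq_bigr => s _; rewrite free_starZ rmorphXn rmorphN /= conjCq; congr (_ *: _).
rewrite (anti_prod free_starM free_star1) -[index_enum _]enumT; apply: eq_bigr => x _.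
by rewrite SUq_matrix_starE !mxE free_star_gen.
Qed.

Lemma free_star_relator r : SUq_relator q r -> free_star r = 0.
Proof.
have [hc hr ha hd] := frt_relations q_gt0
  (P := fun i k j l => SUq_gen_star q j l * SUq_gen_star q i k) SUq_star_frt.
have conj_c : Num.conj (q%:C^-1 - q%:C) = q%:C^-1 - q%:C.
  by rewrite rmorphB fmorphV /= conjCq.
case=> [i k j ik|i j l jl|i k j l ik lj|i k j l ik jl|].
- rewrite (anti_qcomm free_starB free_starZ free_starM) (free_star_gen i j) (free_star_gen k j).
  by rewrite conjCq; apply/eqP; rewrite subr_eq0; apply/eqP; exact: hc.
- rewrite (anti_qcomm free_starB free_starZ free_starM) (free_star_gen i j) (free_star_gen i l).
  by rewrite conjCq; apply/eqP; rewrite subr_eq0; apply/eqP; exact: hr.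
- rewrite (anti_comm free_starB free_starM) (free_star_gen i j) (free_star_gen k l).
  by apply/eqP; rewrite subr_eq0; apply/eqP; exact: ha.
- rewrite (anti_diagonal free_starB free_starZ free_starM) (free_star_gen i j) (free_star_gen k l).
  rewrite (free_star_gen i l) (free_star_gen k j) conj_c.
  by apply/eqP; rewrite subr_eq0; apply/eqP; exact: hd.
by rewrite free_starB free_star_qdet free_star1 subrr.
Qed.

Lemma free_star_ideal x : SUq_ideal q x -> free_star x = 0.
Proof.
elim: x / => [|x a r b _ IH Hr]; first exact: free_star0.
by rewrite free_starD IH add0r !free_starM (free_star_relator Hr) mul0r mulr0.
Qed.

Lemma SUq_star_pi x : SUq_star (SUq_pi q x) = free_star x.
Proof.
apply/eqP; rewrite SUq_starE -subr_eq0 -free_starB; apply/eqP.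
exact/free_star_ideal/SUq_pi_repr.
Qed.

Lemma starM (a b : S) : SUq_star (a * b) = SUq_star b * SUq_star a.
Proof.
rewrite -[a]SUq_piK -[b]SUq_piK; move: (repr a) (repr b) => x y.
transitivity (free_star (x * y)); last by rewrite free_starM -(SUq_star_pi x) -(SUq_star_pi y).
by rewrite -(SUq_star_pi (x * y)) SUq_piMr. Qed.

Lemma starP c (a b : S) : SUq_star (c *: a + b) = Num.conj c *: SUq_star a + SUq_star b.
Proof.
rewrite -[a]SUq_piK -[b]SUq_piK; move: (repr a) (repr b) => x y.
transitivity (free_star (c *: x + y)); last first.
  rewrite free_starD free_starZ -(SUq_star_pi x) -(SUq_star_pi y) //.
by rewrite -(SUq_star_pi (c *: x + y)) SUq_piP_lin.
Qed.

Lemma star1 : SUq_star (1 : S) = 1.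
Proof. by rewrite -{1}SUq_pi1 SUq_star_pi free_star1. Qed.

Lemma star_gen (j k : 'I_N) : SUq_star (SUq_gen q j k) = SUq_gen_star q j k.
Proof. exact: etrans (SUq_star_pi _) (free_star_gen _ _). Qed.


End FreeStar.

(** * Derivations at the counit *)

Section SUqLift.
Variables (R : realType) (q : R) (N : nat) (A : algType R[i]) (g : gen N -> A).
Local Notation C := R[i].
Local Notation S := (SUq q N).
Hypothesis g_quantum : quantum_matrix q (gen_matrix g).
Hypothesis g_det : qdet q (gen_matrix g) = 1.

Definition SUq_lift (a : S) : A := algebra_eval g (repr a).

Lemma SUq_lift_pi x : SUq_lift (SUq_pi q x) = algebra_eval g x.
Proof.
apply/eqP; rewrite /SUq_lift -subr_eq0 -algebra_evalB; apply/eqP.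
by apply: (algebra_eval_ideal g_quantum g_det); exact: SUq_pi_repr.
Qed.

Lemma SUq_liftP c (a b : S) : SUq_lift (c *: a + b) = c *: SUq_lift a + SUq_lift b.
Proof.
rewrite -[a]SUq_piK -[b]SUq_piK; move: (repr a) (repr b) => x y.
transitivity (algebra_eval g (c *: x + y)); last first.
  by rewrite algebra_evalP -(SUq_lift_pi x) -(SUq_lift_pi y).
by rewrite -(SUq_lift_pi (c *: x + y)) SUq_piP_lin.
Qed.

Lemma SUq_liftM (a b : S) : SUq_lift (a * b) = SUq_lift a * SUq_lift b.
Proof.
rewrite -[a]SUq_piK -[b]SUq_piK; move: (repr a) (repr b) => x y.
transitivity (algebra_eval g (x * y)); last first.
  by rewrite algebra_evalM -(SUq_lift_pi x) -(SUq_lift_pi y).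
by rewrite -(SUq_lift_pi (x * y)) SUq_piMr.
Qed.

Lemma SUq_lift1 : SUq_lift 1 = 1.
Proof. by rewrite -{1}SUq_pi1 SUq_lift_pi algebra_eval1. Qed.

Lemma SUq_lift_gen (j k : 'I_N) : SUq_lift (SUq_gen q j k) = g (j, k).
Proof. exact: etrans (SUq_lift_pi _) (algebra_eval_gen _ _ _). Qed.

End SUqLift.

Section DiagonalQuantumMatrix.
Variables (R : realType) (q : R) (A : algType R[i]) (n : nat) (c : 'I_n -> A).
Hypothesis c_comm : forall i j, c i * c j = c j * c i.

Let D : 'M[A]_n := \matrix_(i, j) (if i == j then c i else 0).

Lemma quantum_matrix_diag : quantum_matrix q D.
Proof.
have D0 i j : i != j -> D i j = 0 by rewrite mxE => /negbTE ->.
have neq_lt (i j : 'I_n) : (i < j)%N -> i != j by rewrite -val_eqE neq_ltn => ->.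
split=> [i k j ik|i j l jl|i k j l ik lj|i k j l ik jl].
- have [ij|ij] := eqVneq i j; last by rewrite (D0 i j) // mul0r mulr0 scaler0.
  by rewrite (D0 k j) ?mul0r ?mulr0 ?scaler0 // -ij eq_sym neq_lt.
- have [ij|ij] := eqVneq i j; last by rewrite (D0 i j) // mul0r mulr0 scaler0.
  by rewrite (D0 i l) ?mul0r ?mulr0 ?scaler0 // ij neq_lt.
- by rewrite !mxE; case: eqP; case: eqP; rewrite ?mul0r ?mulr0.
- have [il|il] := eqVneq i l.
    rewrite (D0 i j) ?(D0 k j) ?mul0r ?mulr0 ?scaler0 ?subr0 //.
      by rewrite eq_sym neq_lt // (ltn_trans jl) // -il.
    by rewrite il eq_sym neq_lt.
  by rewrite (D0 i l) // mul0r scaler0 subr0 !mxE; case: eqP; case: eqP; rewrite ?mul0r ?mulr0.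
Qed.

Lemma qdet_diag : qdet q D = \prod_(i < n) c i.
Proof.
rewrite /qdet (bigD1 1%g) //= inversions1 scale1r [X in _ + X]big1 ?addr0 => [|s s1].
  by apply: eq_bigr => i _; rewrite mxE perm1 eqxx.
have [i si]: exists i, s i != i.
  apply/existsP; rewrite -negb_forall; apply: contra s1 => /forallP h.
  by apply/eqP/permP => i; rewrite perm1; exact/eqP/h.
suff -> : \prod_(i < n) D i (s i) = 0 by rewrite scaler0.
have: i \in index_enum 'I_n by rewrite mem_index_enum.
elim: (index_enum _) => // x r IH; rewrite inE big_cons => /predU1P[<-|/IH ->].
  by rewrite mxE eq_sym (negbTE si) mul0r.
by rewrite mulr0.
Qed.

End DiagonalQuantumMatrix.

Section Derivation.
Variables (R : realType) (q : R) (N : nat).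
Local Notation C := R[i].
Local Notation S := (SUq q N).

(* The morphism u_jj |-> 1 + t_j E into the upper triangular 2 x 2 matrices, E
   being the nilpotent matrix unit. *)
Lemma SUq_derivation (t : 'I_N -> C) : \sum_i t i = 0 -> exists d : S -> C,
  [/\ forall c a b, d (c *: a + b) = c * d a + d b,
      forall a b, d (a * b) = d a * counit b + counit a * d b
    & forall j k : 'I_N, d (SUq_gen q j k) = (j == k)%:R * t j].
Proof.
move=> t0; pose E : 'M[C]_2 := delta_mx 0 1.
have EE : E * E = 0 by rewrite /E -[_ * _]/(_ *m _) mul_delta_mx_0.
pose c i : 'M[C]_2 := 1 + t i *: E.
have cM i j : c i * c j = 1 + (t i + t j) *: E.
  rewrite /c mulrDl mul1r mulrDr mulr1 -scalerAl -scalerAr EE !scaler0 addr0.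
  by rewrite scalerDl addrA addrAC.
have comm i j : c i * c j = c j * c i by rewrite !cM [t i + _]addrC.
pose g (p : gen N) := if p.1 == p.2 then c p.1 else 0.
have gE : gen_matrix g = \matrix_(i, j) (if i == j then c i else 0).
  by apply/matrixP => i j; rewrite !mxE.
have hg : quantum_matrix q (gen_matrix g) by rewrite gE; exact: quantum_matrix_diag.
have det1 : qdet q (gen_matrix g) = 1.
  rewrite gE qdet_diag -[RHS]addr0 -[0 in RHS](scale0r E) -t0.
  elim: (index_enum 'I_N) => [|i r IH]; first by rewrite !big_nil scale0r addr0.
  rewrite !big_cons IH /c mulrDl mul1r mulrDr mulr1 -scalerAl -scalerAr EE !scaler0.
  by rewrite addr0 scalerDl addrA addrAC.
have ent (x y : C) : (x%:A + y *: E) 0 1 = y.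
  by rewrite !mxE /= mulr0 add0r mulr1.
have prodE (x y z w : C) :
    (x%:A + y *: E) * (z%:A + w *: E) = (x * z)%:A + (y * z + x * w) *: E.
  rewrite mulrDl mulr_algl mulrDr mulr_algr -scalerAl -scalerAr EE !scaler0 addr0.
  by rewrite scalerDr !scalerA scalerDl [z * y]mulrC -addrA [_ + (y * z) *: E]addrC.
pose L : S -> 'M[C]_2 := SUq_lift g.
have LE (a : S) : L a = (counit a)%:A + (L a 0 1) *: E.
  elim/SUq_ind: a => [x a b IHa IHb||j k a IH].
  - rewrite /L (SUq_liftP hg det1) -/L {1}IHa {1}IHb counitP !mxE /=.
    by rewrite scalerDr !scalerA !scalerDl -!addrA; congr (_ + _); rewrite addrCA.
  - by rewrite /L (SUq_lift1 hg det1) counit1 mxE scale1r scale0r addr0.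
  - have -> : L (SUq_gen q j k * a) = g (j, k) * L a.
      by rewrite /L (SUq_liftM hg det1) (SUq_lift_gen hg det1).
    rewrite counitM counit_gen IH /g /=; case: eqP => _; last first.
      by rewrite !mul0r mxE !scale0r addr0.
    have -> : c j * ((counit a)%:A + L a 0 1 *: E) =
        (counit a)%:A + (L a 0 1 + t j * counit a) *: E.
      rewrite /c mulrDl mul1r mulrDr -!scalerAl -!scalerAr EE mulr1 !scaler0 addr0.
      by rewrite scalerA scalerDl addrA.
    by rewrite ent mul1r.
exists (fun a => L a 0 1); split=> [x a b|a b|j k].
- by rewrite /L (SUq_liftP hg det1) !mxE.
- have e := etrans (SUq_liftM hg det1 a b) (etrans (congr2 *%R (LE a) (LE b))
    (prodE (counit a) (L a 0 1) (counit b) (L b 0 1))).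
  exact: etrans (congr1 (fun M : 'M[C]_2 => M 0 1) e) (ent _ _).
- rewrite /L (SUq_lift_gen hg det1) /g /=; case: eqP => _; rewrite !mxE ?mul0r //=.
  by rewrite mulr1 add0r mul1r.
Qed.

End Derivation.

(** * The homomorphisms s_{n,N} *)

Section BlockMatrix.
Variables (R : realType) (q : R) (A : algType R[i]).

Definition block_one n N (M : 'M[A]_n) : 'M[A]_N :=
  \matrix_(i, j) match insub (i : nat), insub (j : nat) with
                 | Some i', Some j' => M i' j'
                 | _, _ => (i == j)%:R
                 end.

Lemma block_oneE n N (M : 'M[A]_n) (i j : 'I_N) (hi : (i < n)%N) (hj : (j < n)%N) :
  block_one N M i j = M (Ordinal hi) (Ordinal hj).
Proof. by rewrite mxE !insubT. Qed.

Lemma block_one_delta n N (M : 'M[A]_n) (i j : 'I_N) :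
  (n <= i)%N || (n <= j)%N -> block_one N M i j = (i == j)%:R.
Proof.
rewrite mxE => /orP[] h; first by rewrite insubF // ltnNge h.
by case: insubP => // ? _ _; rewrite insubF // ltnNge h.
Qed.

(** Entries outside the block are 0 or 1, hence central. When they occur, both sides of the
    relations with factor q vanish, and in the diagonal relation one of u_il and u_kj is 0. *)
Lemma quantum_matrix_block n N (M : 'M[A]_n) :
  quantum_matrix q M -> quantum_matrix q (block_one N M).
Proof.
move=> [hc hr ha hd].
have neq_lt (i j : 'I_N) : (i < j)%N -> (i == j) = false.
  by move=> ij; apply/negbTE; rewrite -val_eqE neq_ltn ij.
have neq_gt (i j : 'I_N) : (i < j)%N -> (j == i) = false.
  by move=> /neq_lt; rewrite eq_sym.
have natC (b : bool) (a : A) : b%:R * a = a * b%:R.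
  by case: b; rewrite ?mulr1 ?mul1r ?mulr0 ?mul0r.
have bl (i j : 'I_N) : (n <= i)%N -> block_one N M i j = (i == j)%:R.
  by move=> ni; rewrite block_one_delta ?ni.
have br (i j : 'I_N) : (n <= j)%N -> block_one N M i j = (i == j)%:R.
  by move=> nj; rewrite block_one_delta ?nj ?orbT.
split=> [i k j ik|i j l jl|i k j l ik lj|i k j l ik jl].
- case: (ltnP j n) => [jn|nj].
    case: (ltnP k n) => [kn|nk].
      by rewrite (block_oneE _ (ltn_trans ik kn) jn) (block_oneE _ kn jn) hc.
    by rewrite (bl k) // neq_gt ?mulr0 ?mul0r ?scaler0 // (leq_trans jn nk).
  rewrite !br //; case: (eqVneq i j) => [<-|_].
    by rewrite neq_gt // mulr0 mul0r scaler0.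
  by rewrite mulr0 mul0r scaler0.
- case: (ltnP i n) => [in_|ni].
    case: (ltnP l n) => [ln|nl].
      by rewrite (block_oneE _ in_ (ltn_trans jl ln)) (block_oneE _ in_ ln) hr.
    by rewrite (br i l) // neq_lt ?mulr0 ?mul0r ?scaler0 // (leq_trans in_ nl).
  rewrite !bl //; case: (eqVneq i j) => [->|_].
    by rewrite neq_lt // mulr0 mul0r scaler0.
  by rewrite mulr0 mul0r scaler0.
- case: (ltnP k n) => [kn|nk]; last by rewrite (bl k) // natC.
  case: (ltnP j n) => [jn|nj]; last by rewrite (br i j) // natC.
  by rewrite (block_oneE _ (ltn_trans ik kn) jn) (block_oneE _ kn (ltn_trans lj jn)) ha.
case: (ltnP k n) => [kn|nk]; last first.
  rewrite !(bl k) // natC.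
  case: (eqVneq k j) => [kj|_]; last by rewrite mulr0 scaler0 subr0.
  have kl : (k < l)%N by rewrite kj.
  by rewrite (br i l) ?(neq_lt i l) ?mul0r ?scaler0 ?subr0 ?(ltn_trans ik kl) // (leq_trans nk) // ltnW.
case: (ltnP l n) => [ln|nl].
  rewrite (block_oneE _ (ltn_trans ik kn) (ltn_trans jl ln)) (block_oneE _ kn ln) hd //.
  by rewrite (block_oneE _ (ltn_trans ik kn) ln) (block_oneE _ kn (ltn_trans jl ln)).
have kl : (k < l)%N := leq_trans kn nl.
rewrite !(br _ l) // (neq_lt k l) // (neq_lt i l) ?(ltn_trans ik kl) //.
by rewrite mulr0 !mul0r scaler0 subr0.
Qed.

Lemma qdet_block n N (M : 'M[A]_n) : (n <= N)%N -> qdet q (block_one N M) = qdet q M.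
Proof.
elim: N => [|N IH]; first by rewrite leqn0 => /eqP n0; subst n; congr qdet; apply/matrixP => -[].
rewrite leq_eqVlt => /predU1P[nN|nN].
  subst n; congr qdet; apply/matrixP => i j.
  by rewrite (block_oneE _ (ltn_ord i) (ltn_ord j)); congr (M _ _); apply: val_inj.
have nN' : (n <= ord_max (n' := N))%N by rewrite -ltnS.
rewrite qdet_row_max (bigD1 ord_max) //= subnn scale1r big1 ?addr0; last first.
  move=> k kmax; rewrite (block_one_delta _ (i := ord_max)) ?nN' //.
  by rewrite eq_sym (negbTE kmax) mulr0 scaler0.
rewrite (block_one_delta _ (i := ord_max)) ?nN' // eqxx mulr1 -(IH nN'); congr qdet.
apply/matrixP => i j; rewrite !mxE !lift_max.
by rewrite (inj_eq (@lift_inj _ _)).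
Qed.

Lemma mul_block_one n N (M M' : 'M[A]_n) : (n <= N)%N -> M *m M' = 1%:M ->
  block_one N M *m block_one N M' = 1%:M.
Proof.
move=> nN /matrixP MM; apply/matrixP => i j; rewrite !mxE.
case: (ltnP i n) => [in_|ni]; last first.
  rewrite (bigD1 i) //= block_one_delta ?ni // eqxx mul1r block_one_delta ?ni //.
  by rewrite big1 ?addr0 // => s si; rewrite block_one_delta ?ni // eq_sym (negbTE si) mul0r.
case: (ltnP j n) => [jn|nj]; last first.
  rewrite (bigD1 j) //= [X in _ * X + _]block_one_delta ?nj ?orbT // eqxx mulr1.
  rewrite block_one_delta ?nj ?orbT // big1 ?addr0 // => s sj.
  by rewrite [X in _ * X]block_one_delta ?nj ?orbT // (negbTE sj) mulr0.
have := MM (Ordinal in_) (Ordinal jn); rewrite !mxE -val_eqE /= => <-.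
pose G (s : nat) := if insub s is Some s' then
   M (Ordinal in_) s' * M' s' (Ordinal jn) else 0.
transitivity (\sum_(s < n) G s); last by apply: eq_bigr => s _; rewrite /G valK.
rewrite (big_ord_widen N G) // /G.
rewrite [RHS]big_mkcond /=; apply: eq_bigr => s _; case: ifP => sn.
  by rewrite insubT (block_oneE _ in_ sn) (block_oneE _ sn jn).
rewrite block_one_delta ?[(n <= s)%N]leqNgt ?sn ?orbT //.
by case: eqP => [e|_]; rewrite ?mul0r //; rewrite -e in_ in sn.
Qed.

End BlockMatrix.

Section Congruence.
Variables (R : realType) (q : R) (A : algType R[i]) (I : A -> Prop).
Local Notation C := R[i].

(** Ideals are predicates, so that one can compute modulo an annihilator or a kernel without forming
    another quotient. *)
Record two_sided_ideal : Prop := TwoSidedIdeal {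
  ideal0 : I 0;
  idealP : forall (c : C) a b, I a -> I b -> I (c *: a + b);
  idealMl : forall a b, I b -> I (a * b);
  idealMr : forall a b, I a -> I (a * b) }.

Hypothesis hI : two_sided_ideal.

Lemma ideal_cong_refl a : I (a - a).
Proof. by rewrite subrr; exact: ideal0. Qed.

Lemma ideal_cong_lin c a b x y : I (a - x) -> I (b - y) -> I (c *: a + b - (c *: x + y)).
Proof.
by move=> Ia Ib; rewrite opprD addrACA -scalerBr; exact: idealP.
Qed.

Lemma ideal_cong_sym a x : I (a - x) -> I (x - a).
Proof.
move=> Ia; rewrite -opprB -scaleN1r -[_ *: _]addr0.
by apply: idealP => //; exact: ideal0.
Qed.

Lemma ideal_cong_mul a b x y : I (a - x) -> I (b - y) -> I (a * b - x * y).
Proof.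
move=> Ia Ib; have -> : a * b - x * y = 1 *: (a * (b - y)) + (a - x) * y.
  by rewrite scale1r mulrBr mulrBl addrA subrK.
by apply: idealP => //; [exact: idealMl|exact: idealMr].
Qed.

Lemma ideal_cong_qdet n (U V : 'M[A]_n) :
  (forall i j, I (U i j - V i j)) -> I (qdet q U - qdet q V).
Proof.
move=> UV; apply: (big_ind2 (fun a b => I (a - b))).
- exact: ideal_cong_refl.
- by move=> a x b y ax yb; have := ideal_cong_lin 1 ax yb; rewrite !scale1r.
move=> s _; rewrite -[X in X - _]addr0 -[X in _ - X]addr0.
apply: ideal_cong_lin; last exact: ideal_cong_refl.
apply: (big_ind2 (fun a b => I (a - b))) => [|a x b y|i _] //.
- exact: ideal_cong_refl.
- exact: ideal_cong_mul.
- exact: UV.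
Qed.

End Congruence.

Section SUqRes.
Variables (R : realType) (q : R) (n N : nat).
Hypotheses (q_gt0 : 0 < q) (nN : (n <= N)%N).
Local Notation C := R[i].
Local Notation S := (SUq q N).
Local Notation T := (SUq q n).
Local Notation res := (@SUq_res R q n N).

Definition SUq_res_gen (p : gen N) : T := block_one N (SUq_matrix q n) p.1 p.2.

Lemma SUq_resE (a : S) : res a = SUq_lift SUq_res_gen a.
Proof.
have e : (fun p : gen N => match insub (p.1 : nat), insub (p.2 : nat) with
      | Some j, Some k => SUq_gen q (j : 'I_n) (k : 'I_n)
      | _, _ => (p.1 == p.2)%:R end) = SUq_res_gen.
  apply/funext => p; rewrite /SUq_res_gen [RHS]mxE.
  by case: insub => // x; case: insub => // y; rewrite mxE.
exact: (congr1 (fun g => free_eval (fun c : C => c%:A) g (repr a)) e).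
Qed.

Let gen_res : gen_matrix SUq_res_gen = block_one N (SUq_matrix q n).
Proof. by apply/matrixP => i j; rewrite [LHS]mxE. Qed.

Let res_quantum : quantum_matrix q (gen_matrix SUq_res_gen).
Proof. by rewrite gen_res; apply: quantum_matrix_block; exact: SUq_matrix_quantum. Qed.

Let res_det : qdet q (gen_matrix SUq_res_gen) = 1.
Proof. by rewrite gen_res qdet_block //; exact: SUq_matrix_det. Qed.

Lemma SUq_resEfun : res = SUq_lift SUq_res_gen.
Proof. exact: funext SUq_resE. Qed.

Lemma SUq_resP c (a b : S) : res (c *: a + b) = c *: res a + res b.
Proof. by rewrite SUq_resEfun; exact: SUq_liftP. Qed.

Lemma SUq_resM (a b : S) : res (a * b) = res a * res b.
Proof. by rewrite SUq_resEfun; exact: SUq_liftM. Qed.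

Lemma SUq_res1 : res 1 = 1.
Proof. by rewrite SUq_resEfun; exact: SUq_lift1. Qed.

Lemma SUq_res_genE (j k : 'I_N) : res (SUq_gen q j k) = block_one N (SUq_matrix q n) j k.
Proof. by rewrite SUq_resEfun; exact: SUq_lift_gen. Qed.


Let g (p : gen n) : S := SUq_gen q (widen_ord nN p.1) (widen_ord nN p.2).

Let gen_g : gen_matrix g = mxsub (widen_ord nN) (widen_ord nN) (SUq_matrix q N).
Proof. by apply/matrixP => i j; rewrite !mxE. Qed.

Let g_quantum : quantum_matrix q (gen_matrix g).
Proof.
rewrite gen_g; apply: quantum_matrix_sub; last exact: SUq_matrix_quantum.
  by move=> i j.
by move=> i j.
Qed.

Section Kernel.
Variable I : S -> Prop.
Hypothesis hI : two_sided_ideal I.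
Hypothesis I_gen : forall j k : 'I_N, (n <= j)%N || (n <= k)%N ->
  I (SUq_gen q j k - (j == k)%:R).

Lemma SUq_res_lift_cong (a : S) : exists x, res a = SUq_pi q x /\ I (a - algebra_eval g x).
Proof.
elim/SUq_ind: a => [c a b [x [ax Ix]] [y [by_ Iy]]||j k a [x [ax Ix]]].
- exists (c *: x + y); split; first by rewrite SUq_resP SUq_piP_lin ax by_.
  by rewrite (algebra_evalP g c x y); exact: (ideal_cong_lin hI c Ix Iy).
- exists 1; split; first by rewrite SUq_res1 SUq_pi1.
  by rewrite (algebra_eval1 g); exact: (ideal_cong_refl hI).
case: (boolP ((n <= j)%N || (n <= k)%N)) => [jk|].
  exists (((j == k)%:R : C) *: x); split.
    rewrite SUq_resM SUq_res_genE block_one_delta // ax.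
    by rewrite SUq_piZ -[SUq_scale _ _]/(_ *: SUq_pi q x); case: (j == k); rewrite ?mul1r ?scale1r ?mul0r ?scale0r.
  rewrite (algebra_evalZ g _ x).
  have -> : ((j == k)%:R : C) *: algebra_eval g x = (j == k)%:R * algebra_eval g x.
    by case: (j == k); rewrite ?mul1r ?scale1r ?mul0r ?scale0r.
  exact: (ideal_cong_mul hI (I_gen jk) Ix).
rewrite negb_or -!ltnNge => /andP[jn kn].
exists (free_gen R (Ordinal jn) (Ordinal kn) * x); split.
  rewrite SUq_resM SUq_res_genE (block_oneE _ jn kn) mxE ax.
  by rewrite SUq_piMr.
rewrite (algebra_evalM g _ x) (algebra_eval_gen g).
apply: (ideal_cong_mul hI _ Ix).
have -> : g (Ordinal jn, Ordinal kn) = SUq_gen q j k.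
  by rewrite /g /=; congr SUq_gen; exact: val_inj.
exact: (ideal_cong_refl hI).
Qed.

(** The corner of the generator matrix satisfies the quadratic relations exactly. Its determinant is
    that of the corner completed by an identity block, which modulo I is the full generator
    matrix. *)
Lemma SUq_ideal_eval x : SUq_ideal q x -> I (algebra_eval g x).
Proof.
elim: x / => [|x a r b _ Ix Hr]; first by rewrite (algebra_eval0 g); exact: (ideal0 hI).
rewrite -[x]scale1r (algebra_evalP g 1 x); apply: (idealP hI _ Ix).
rewrite (algebra_evalM g _ b); apply: (idealMr hI); rewrite (algebra_evalM g a r); apply: (idealMl hI).
case: (algebra_eval_relator g_quantum Hr) => ->; first exact: (ideal0 hI).
rewrite algebra_evalB algebra_eval_qdet algebra_eval1.
rewrite -(qdet_block q (gen_matrix g) nN) -(SUq_matrix_det q N).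
apply: (ideal_cong_qdet q hI) => i j; apply: (ideal_cong_sym hI).
case: (boolP ((n <= i)%N || (n <= j)%N)) => [ij|].
  by rewrite block_one_delta // mxE; exact: I_gen.
rewrite negb_or -!ltnNge => /andP[in_ jn]; rewrite (block_oneE _ in_ jn) !mxE /g /=.
have -> : widen_ord nN (Ordinal in_) = i by exact: val_inj.
have -> : widen_ord nN (Ordinal jn) = j by exact: val_inj.
exact: (ideal_cong_refl hI).
Qed.

(** In other words, the kernel of s_{n,N} is generated as an ideal by the u_jk - delta_jk with j or
    k outside the corner. This is what makes representations and cocycles factor through s_{n,N}. *)
Lemma SUq_res_ker a : res a = 0 -> I a.
Proof.
have [x [ax Ix]] := SUq_res_lift_cong a; rewrite ax -(SUq_pi0 q n) => /SUq_piP.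
rewrite subr0 => /SUq_ideal_eval Ie.
have -> : a = 1 *: (a - algebra_eval g x) + algebra_eval g x by rewrite scale1r subrK.
exact: (idealP hI).
Qed.

End Kernel.

Lemma SUq_res_surj b : exists a, res a = b.
Proof.
elim/SUq_ind: b => [c a b [x <-] [y <-]||j k a [x <-]].
- by exists (c *: x + y); exact: SUq_resP.
- by exists 1; exact: SUq_res1.
exists (g (j, k) * x); rewrite SUq_resM SUq_res_genE; congr (_ * _).
rewrite (@block_oneE _ _ _ _ _ (widen_ord nN j) (widen_ord nN k) (ltn_ord j) (ltn_ord k)).
by rewrite mxE; congr SUq_gen; exact: val_inj.
Qed.

(** The images of the adjoints and the block of the small cofactors are both inverse to the block of
    the small generators, so they agree and no minor has to be computed. *)
Lemma SUq_res_gen_star (j k : 'I_N) :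
  res (SUq_gen_star q j k) = block_one N (qcofactor q (SUq_matrix q n)) k j.
Proof.
pose U := block_one N (SUq_matrix q n).
pose V : 'M[T]_N := \matrix_(k, j) res (SUq_gen_star q j k).
have res0 : res 0 = 0.
  by have := SUq_resP (-1) 1 1; rewrite !scaleN1r !addNr.
have resD a b : res (a + b) = res a + res b.
  by have := SUq_resP 1 a b; rewrite !scale1r.
have UV : U *m V = 1%:M.
  apply/matrixP => i l; rewrite !mxE.
  have := congr1 res (SUq_unitary q_gt0 i l); rewrite (big_morph res resD res0) => e.
  transitivity (res ((i == l)%:R)); last by case: (i == l); rewrite ?SUq_res1 ?res0.
  by rewrite -e; apply: eq_bigr => s _; rewrite SUq_resM SUq_res_genE [V _ _]mxE.
have : V = block_one N (qcofactor q (SUq_matrix q n)).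
  rewrite -[LHS]mul1mx -(mul_block_one nN (SUq_cofactor_mul_matrix n q_gt0)) -mulmxA.
  by rewrite -/U UV mulmx1.
by move=> /matrixP/(_ k j); rewrite [LHS]mxE.
Qed.

Lemma SUq_res_star (a : S) : res (SUq_star a) = SUq_star (res a).
Proof.
elim/SUq_ind: a => [c a b IHa IHb||j k a IH].
- exact: (etrans (congr1 res (starP q_gt0 c a b))
    (etrans (SUq_resP (Num.conj c) (SUq_star a) (SUq_star b))
    (etrans (congr2 (fun x y => Num.conj c *: x + y) IHa IHb)
    (esym (etrans (congr1 (@SUq_star R q n) (SUq_resP c a b))
          (starP q_gt0 c (res a) (res b))))))).
- by rewrite (star1 N q_gt0) SUq_res1 (star1 n q_gt0).
suff e : res (SUq_gen_star q j k) = SUq_star (res (SUq_gen q j k)).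
  exact: (etrans (congr1 res (starM q_gt0 (SUq_gen q j k) a))
    (etrans (SUq_resM (SUq_star a) (SUq_star (SUq_gen q j k)))
    (etrans (congr2 *%R IH (etrans (congr1 res (star_gen q_gt0 j k)) e))
    (esym (etrans (congr1 (@SUq_star R q n) (SUq_resM (SUq_gen q j k) a))
          (starM q_gt0 (res (SUq_gen q j k)) (res a))))))).
rewrite SUq_res_gen_star SUq_res_genE.
case: (boolP ((n <= j)%N || (n <= k)%N)) => [jk|].
  have kj : (n <= k)%N || (n <= j)%N by rewrite orbC.
  rewrite (block_one_delta (SUq_matrix q n) jk).
  rewrite (block_one_delta (qcofactor q (SUq_matrix q n)) kj).
  rewrite [k == j]eq_sym; case: (j == k); first exact/esym/(star1 n q_gt0).
  by have := starP q_gt0 (-1) (1 : T) 1; rewrite rmorphN1 !scaleN1r !addNr => ->.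
rewrite negb_or -!ltnNge => /andP[jn kn].
rewrite (block_oneE (SUq_matrix q n) jn kn) (block_oneE (qcofactor q (SUq_matrix q n)) kn jn).
rewrite SUq_matrix_starE [LHS]mxE mxE.
exact/esym/(star_gen q_gt0).
Qed.

Lemma SUq_res_counit (a : S) : counit (res a) = counit a.
Proof.
elim/SUq_ind: a => [c a b IHa IHb||j k a IH].
- exact: (etrans (congr1 (@counit R q n) (SUq_resP c a b))
    (etrans (counitP c (res a) (res b))
    (etrans (congr2 (fun x y => c * x + y) IHa IHb) (esym (counitP c a b))))).
- by rewrite SUq_res1 (counit1 q n) (counit1 q N).
suff e : counit (res (SUq_gen q j k)) = counit (SUq_gen q j k).
  exact: (etrans (congr1 (@counit R q n) (SUq_resM (SUq_gen q j k) a))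
    (etrans (counitM (res (SUq_gen q j k)) (res a))
    (etrans (congr2 *%R e IH) (esym (counitM (SUq_gen q j k) a))))).
rewrite SUq_res_genE counit_gen.
case: (boolP ((n <= j)%N || (n <= k)%N)) => [jk|].
  by rewrite block_one_delta //; case: (j == k); rewrite ?counit1 ?counit0.
rewrite negb_or -!ltnNge => /andP[jn kn].
by rewrite (block_oneE _ jn kn) mxE counit_gen.
Qed.

End SUqRes.

(** * Semi-inner products and Hilbert spaces *)

Section Scalars.
Variable R : realType.
Local Notation C := R[i].

Definition cvg_to (z : nat -> C) (l : C) :=
  forall e : C, 0 < e -> exists m, forall k, (m <= k)%N -> `|z k - l| < e.

Lemma ge0_eps (x : C) : 0 <= x -> (forall e, 0 < e -> x < e) -> x = 0.
Proof.
move=> x0 h; apply/eqP; rewrite eq_le x0 andbT real_leNgt ?ger0_real //.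
by apply/negP => /h; rewrite ltxx.
Qed.

Lemma cvg_uniq z l l' : cvg_to z l -> cvg_to z l' -> l = l'.
Proof.
move=> zl zl'; apply/eqP; rewrite -subr_eq0 -normr_eq0; apply/eqP.
apply: ge0_eps => // e e0; have e2 : 0 < e / 2 by rewrite divr_gt0.
have [m hm] := zl _ e2; have [m' hm'] := zl' _ e2.
have := ltrD (hm _ (leq_maxl m m')) (hm' _ (leq_maxr m m')); rewrite -splitr.
apply: le_lt_trans; rewrite (distrC _ l); apply: le_trans (ler_normD _ _).
by rewrite addrA subrK.
Qed.

Lemma cvg_ext z z' l : (forall k, z k = z' k) -> cvg_to z l -> cvg_to z' l.
Proof. by move=> e h x x0; have [m hm] := h x x0; exists m => k /hm; rewrite e. Qed.

Lemma cvg_cst l : cvg_to (fun=> l) l.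
Proof. by move=> e e0; exists 0%N => k _; rewrite subrr normr0. Qed.

Lemma cvg_lin c z z' l l' : cvg_to z l -> cvg_to z' l' ->
  cvg_to (fun k => c * z k + z' k) (c * l + l').
Proof.
move=> zl zl' e e0.
have M0 : 0 < `|c| + 1 by rewrite ltr_wpDl.
have [m hm] := zl _ (divr_gt0 (divr_gt0 e0 (ltr0Sn _ 1)) M0).
have [m' hm'] := zl' _ (divr_gt0 e0 (ltr0Sn _ 1)).
exists (maxn m m') => k; rewrite geq_max => /andP[/hm {}hm /hm' {}hm'].
rewrite opprD addrACA -mulrBr; apply: le_lt_trans (ler_normD _ _) _.
rewrite [ltRHS]splitr; apply: ler_ltD => //; rewrite normrM.
move: hm; rewrite ltr_pdivlMr // => /ltW; apply: le_trans.
by rewrite mulrC ler_wpM2l // lerDl.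
Qed.

Lemma cvg_conj z l : cvg_to z l -> cvg_to (fun k => Num.conj (z k)) (Num.conj l).
Proof.
by move=> h e /h[m hm]; exists m => k /hm; rewrite -rmorphB norm_conjC.
Qed.

Lemma cvg_ge0 z l : (forall k, 0 <= z k) -> cvg_to z l -> 0 <= l.
Proof.
move=> z0 zl.
(* The order of the complex numbers is partial: the limit must be known to be real before it can be
   compared with 0. *)
have lr : l = Num.conj l.
  apply: (cvg_uniq zl); apply: (cvg_ext _ (cvg_conj zl)) => k.
  by rewrite geC0_conj.
have lR : l \is Num.real by rewrite CrealE -lr.
rewrite real_leNgt ?real0 //; apply/negP => l0.
have [m /(_ m (leqnn m))] := zl (- l) ltac:(by rewrite oppr_gt0).
have zl0 : 0 < z m - l by rewrite subr_gt0; exact: lt_le_trans l0 (z0 m).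
by rewrite gtr0_norm // gtrDr => /(le_lt_trans (z0 m)); rewrite ltxx.
Qed.

End Scalars.

Section Forms.
Variables (R : realType) (V : lmodType R[i]).
Local Notation C := R[i].

Record psd_form (B : V -> V -> C) : Prop := PsdForm {
  psdP : forall c x y z, B (c *: x + y) z = c * B x z + B y z;
  psdC : forall x y, B y x = Num.conj (B x y);
  psd_ge0 : forall x, 0 <= B x x }.

Variable B : V -> V -> C.
Hypothesis hB : psd_form B.

Lemma psd0l z : B 0 z = 0.
Proof. by have := psdP hB 1 0 0 z; rewrite scale1r addr0 mul1r => /eqP; rewrite -subr_eq0 opprD addrA subrr sub0r oppr_eq0 => /eqP. Qed.

Lemma psdDl x y z : B (x + y) z = B x z + B y z.
Proof. by rewrite -[x in LHS]scale1r (psdP hB) mul1r. Qed.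

Lemma psdZl c x z : B (c *: x) z = c * B x z.
Proof. by rewrite -[c *: x]addr0 (psdP hB) psd0l addr0. Qed.

Lemma psdNl x z : B (- x) z = - B x z.
Proof. by rewrite -scaleN1r psdZl mulN1r. Qed.

Lemma psd0r z : B z 0 = 0.
Proof. by rewrite [LHS](psdC hB) psd0l conjC0. Qed.

Lemma psdDr x y z : B z (x + y) = B z x + B z y.
Proof. by rewrite [LHS](psdC hB) psdDl rmorphD /= -!(psdC hB). Qed.

Lemma psdZr c x z : B z (c *: x) = Num.conj c * B z x.
Proof. by rewrite [LHS](psdC hB) psdZl rmorphM /= -(psdC hB). Qed.

Lemma psdNr x z : B z (- x) = - B z x.
Proof. by rewrite [LHS](psdC hB) psdNl rmorphN /= -(psdC hB). Qed.

Lemma psd_suml I (r : seq I) P (F : I -> V) z :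
  B (\sum_(i <- r | P i) F i) z = \sum_(i <- r | P i) B (F i) z.
Proof. exact: (big_morph (B^~ z) (fun x y => psdDl x y z) (psd0l z)). Qed.

Lemma psd_sumr I (r : seq I) P (F : I -> V) z :
  B z (\sum_(i <- r | P i) F i) = \sum_(i <- r | P i) B z (F i).
Proof. exact: (big_morph (B z) (fun x y => psdDr x y z) (psd0r z)). Qed.

Definition psdE := (psdDl, psdDr, psdNl, psdNr, psdZl, psdZr).

Lemma psd_parallelogram x y :
  B (x + y) (x + y) + B (x - y) (x - y) = 2 * (B x x + B y y).
Proof. by rewrite !psdE; ring. Qed.

Lemma psdD_le x y : B (x + y) (x + y) <= 2 * (B x x + B y y).
Proof. by rewrite -psd_parallelogram lerDl psd_ge0. Qed.

Lemma psdB_sym x y : B (x - y) (x - y) = B (y - x) (y - x).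
Proof. by rewrite -[x - y]opprB psdNl psdNr opprK. Qed.

Lemma psdZZ c x : B (c *: x) (c *: x) = `|c| ^+ 2 * B x x.
Proof. by rewrite psdZl psdZr mulrA -normCK. Qed.

Lemma psd_re_le x y : B x y + B y x <= B x x + B y y.
Proof.
rewrite -subr_ge0; have := psd_ge0 hB (x - y); rewrite !psdE; congr (0 <= _).
ring.
Qed.

Lemma psd_CS x y : `|B x y| ^+ 2 <= B x x * B y y.
Proof.
have [y0|y0] := eqVneq (B y y) 0.
  (* Positivity at x - t B(x, y) y. If B(x, y) were not 0, then t = B(x, x) / |B(x, y)|^2 would
     force B(x, x) = 0, and t = 1 a contradiction. *)
  have h t : 0 <= t -> 2 * t * `|B x y| ^+ 2 <= B x x.
    move=> t0; have := psd_ge0 hB (x - (t * B x y) *: y).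
    rewrite !psdE (psdC hB x y) y0 rmorphM /= (geC0_conj t0) => h.
    rewrite -subr_ge0; move: h; congr (0 <= _); rewrite normCK; ring.
  rewrite y0 mulr0 real_leNgt ?realX ?real0 ?normr_real //; apply/negP => b0.
  have := h (B x x / `|B x y| ^+ 2) (divr_ge0 (psd_ge0 hB x) (ltW b0)).
  have x0 := psd_ge0 hB x; rewrite -mulrA divfK ?gt_eqF // mulr_natl mulr2n gerDl => x0'.
  have e0 : B x x = 0 by apply: le_anti; rewrite x0 x0'.
  have := h 1 ler01; rewrite e0 mulr1 pmulr_rle0 // => /(lt_le_trans b0).
  by rewrite ltxx.
have yp : 0 < B y y by rewrite lt_def y0 psd_ge0.
rewrite -subr_ge0 -(pmulr_lge0 _ yp).
have := psd_ge0 hB (B y y *: x - B x y *: y).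
rewrite !psdE (psdC hB x y) (geC0_conj (psd_ge0 hB y)); congr (0 <= _).
rewrite normCK; ring.
Qed.

Lemma psd_sum_le n (F : 'I_n -> V) :
  B (\sum_i F i) (\sum_i F i) <= n%:R * \sum_i B (F i) (F i).
Proof.
rewrite psd_suml; under eq_bigr do rewrite psd_sumr.
rewrite -(ler_pM2l (ltr0Sn C 1)) mulr_natl mulr2n {2}exchange_big -big_split /=.
under eq_bigr do rewrite -big_split /=.
apply: (@le_trans _ _ (\sum_(i < n) \sum_(j < n) (B (F i) (F i) + B (F j) (F j)))).
  by apply: ler_sum => i _; apply: ler_sum => j _; exact: psd_re_le.
rewrite (eq_bigr (fun i => B (F i) (F i) *+ n + \sum_(j < n) B (F j) (F j))) => [|i _]; last first.
  by rewrite big_split /= sumr_const card_ord.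
by rewrite big_split /= sumr_const card_ord sumrMnl !mulr_natl mulr2n.
Qed.

Definition null (x : nat -> V) :=
  forall e : C, 0 < e -> exists m, forall k, (m <= k)%N -> B (x k) (x k) < e.

Lemma null_ext x y : (forall k, x k = y k) -> null x -> null y.
Proof. by move=> e h t t0; have [m hm] := h t t0; exists m => k /hm; rewrite e. Qed.

Lemma nullD x y : null x -> null y -> null (fun k => x k + y k).
Proof.
move=> hx hy e e0; have e4 : 0 < e / 2 / 2 by rewrite !divr_gt0.
have [m hm] := hx _ e4; have [m' hm'] := hy _ e4.
exists (maxn m m') => k; rewrite geq_max => /andP[/hm {}hm /hm' {}hm'].
apply: le_lt_trans (psdD_le _ _) _; rewrite -ltr_pdivlMl // mulrC [ltRHS]splitr.
exact: ltrD.
Qed.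

Lemma null_uniq x y z : null (fun k => x k - y) -> null (fun k => x k - z) ->
  B (y - z) (y - z) = 0.
Proof.
move=> xy xz; apply: ge0_eps => [|e e0]; first exact: psd_ge0.
have zx : null (fun k => z - x k).
  by move=> t t0; have [m hm] := xz t t0; exists m => k /hm; rewrite psdB_sym.
have [m /(_ m (leqnn m))] := nullD xy zx e0.
by rewrite [x m - y + _]addrC addrA subrK psdB_sym.
Qed.

End Forms.

Section NullDomination.
Variables (R : realType) (V W : lmodType R[i]).
Local Notation C := R[i].

Lemma null_dom (B : V -> V -> C) (B' : W -> W -> C) (M : C) x y :
  psd_form B -> 0 <= M ->
  (forall k, B' (y k) (y k) <= M * B (x k) (x k)) -> null B x -> null B' y.
Proof.
move=> hB M0 hd hx e e0; have M1 : 0 < M + 1 by rewrite ltr_wpDl.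
have [m hm] := hx _ (divr_gt0 e0 M1); exists m => k /hm h.
apply: le_lt_trans (hd k) _; apply: (@le_lt_trans _ _ ((M + 1) * B (x k) (x k))).
  by apply: ler_wpM2r; [exact: psd_ge0|rewrite lerDl].
by rewrite mulrC -ltr_pdivlMr.
Qed.

End NullDomination.

Section Scalars.
Variable R : realType.
Local Notation C := R[i].

Lemma posC_real (e : C) : 0 < e -> exists2 r : R, 0 < r & e = r%:C.
Proof.
by case: e => a b; rewrite ltcE /= => /andP[/eqP -> a0]; exists a.
Qed.

Lemma inv_small (e : C) : 0 < e -> exists m, forall k, (m <= k)%N -> (k.+1%:R)^-1 < e.
Proof.
move=> /posC_real[r r0 ->]; exists (Num.bound r^-1) => k hk.
have h : r^-1 < k.+1%:R.
  apply: lt_le_trans (archi_boundP (ltW _)) _; first by rewrite invr_gt0.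
  by rewrite ler_nat (leq_trans hk).
have -> : (k.+1%:R : C) = (k.+1%:R : R)%:C by rewrite rmorph_nat.
by rewrite -fmorphV ltcR -[ltRHS]invrK ltf_pV2 // posrE ?invr_gt0 // ltr0Sn.
Qed.

Lemma cvg_sq (z : nat -> C) l :
  (forall e, 0 < e -> exists m, forall k, (m <= k)%N -> `|z k - l| ^+ 2 < e) ->
  cvg_to z l.
Proof.
move=> h e e0; have [m hm] := h _ (exprn_gt0 2 e0).
by exists m => k /hm; rewrite ltr_pXn2r ?nnegrE // ltW.
Qed.

Lemma null_cvg (V : lmodType C) (B : V -> V -> C) x z l M : psd_form B -> 0 <= M ->
  null B x -> (forall k, `|z k - l| ^+ 2 <= M * B (x k) (x k)) -> cvg_to z l.
Proof.
move=> hB M0 hx hz; apply: cvg_sq => e e0; have M1 : 0 < M + 1 by rewrite ltr_wpDl.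
have [m hm] := hx _ (divr_gt0 e0 M1); exists m => k /hm h.
apply: le_lt_trans (hz k) _; apply: (@le_lt_trans _ _ ((M + 1) * B (x k) (x k))).
  by apply: ler_wpM2r; [exact: psd_ge0|rewrite lerDl].
by rewrite mulrC -ltr_pdivlMr.
Qed.

Lemma null_pairing (V : lmodType C) (B : V -> V -> C) x y : psd_form B ->
  null B x -> cvg_to (fun k => B (x k) y) 0.
Proof.
move=> hB hx; apply: (null_cvg hB (psd_ge0 hB y) hx) => k.
by rewrite subr0 mulrC; exact: psd_CS.
Qed.

(* Both arguments may move: B(x_k, y_k) - B(x, y) = B(x_k - x, y_k) + B(x, y_k - y). *)
Lemma cvg_form (V : lmodType C) (B : V -> V -> C) x y x0 y0 : psd_form B ->
  null B (fun k => x k - x0) -> null B (fun k => y k - y0) ->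
  cvg_to (fun k => B (x k) (y k)) (B x0 y0).
Proof.
move=> hB hx hy.
have e1 := null_pairing y0 hB hx.
have e2 := cvg_conj (null_pairing x0 hB hy).
have e3 : cvg_to (fun k => B (x k - x0) (y k - y0)) 0.
  apply: cvg_sq => e e0.
  have [m hm] := hx e e0; have [m' hm'] := hy 1 ltr01.
  exists (maxn m m') => k; rewrite geq_max => /andP[/hm {}hm /hm' {}hm'].
  rewrite subr0; apply: le_lt_trans (psd_CS hB _ _) _; rewrite -[ltRHS]mulr1.
  apply: le_lt_trans (ler_wpM2l (psd_ge0 hB _) (ltW hm')) _.
  by rewrite !mulr1.
have := cvg_lin 1 e3 (cvg_lin 1 e1 (cvg_lin 1 e2 (cvg_cst (B x0 y0)))).
rewrite conjC0 !mul1r !add0r; apply: cvg_ext => k.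
rewrite !mul1r -(psdC hB) !(psdDl hB) !(psdDr hB) !(psdNl hB) !(psdNr hB); ring.
Qed.

End Scalars.

Section Hilbert.
Variables (R : realType) (H : hilbertSpace R).
Local Notation C := R[i].
Local Notation D := (hdot H).

Lemma hdot_psd : psd_form D.
Proof.
split=> [c x y z|x y|x].
- by rewrite linearPl.
- by rewrite hermC /= expr0 mul1r.
- exact: dnorm_ge0.
Qed.

Lemma hdot_eq0 (x : H) : D x x = 0 -> x = 0.
Proof. by move/eqP; rewrite dnorm_eq0 => /eqP. Qed.

Definition subspace (M : H -> Prop) := M 0 /\ forall c x y, M x -> M y -> M (c *: x + y).

Let re_hdot (v : H) : D v v = (complex.Re (D v v))%:C.
Proof. by rewrite RRe_real // ger0_real // (psd_ge0 hdot_psd). Qed.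

(** The subspace need not be closed: the projection on its closure is x - y, delivered together with
    a sequence of M that tends to it. *)
Theorem orthogonal_projection (M : H -> Prop) (x : H) : subspace M ->
  exists y, (forall z, M z -> D y z = 0) /\
    exists2 m : nat -> H, forall k, M (m k) & null D (fun k => x - y - m k).
Proof.
move=> [M0 Mlin]; pose nr v := complex.Re (D v v).
pose E : set R := [set r | exists2 m, M m & r = nr (x - m)]%classic.
have nr0 v : 0 <= nr v by rewrite -lecR -re_hdot (psd_ge0 hdot_psd).
have infE : has_inf E.
  split; first by exists (nr (x - 0)), 0.
  by exists 0 => r [m _ ->]; exact: nr0.
pose d : C := (inf E)%:C.
have low m : M m -> d <= D (x - m) (x - m).
  by move=> Mm; rewrite re_hdot lecR; apply: ge_inf; [exact: infE.2|exists m].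
have /choice[m hm] (k : nat) :
    exists m, M m /\ D (x - m) (x - m) < d + (k.+1%:R)^-1.
  have k0 : 0 < (k.+1%:R : R)^-1 by rewrite invr_gt0 ltr0Sn.
  have [_ [m Mm ->] lt] := inf_adherent k0 infE; exists m; split=> //.
  rewrite re_hdot; have -> : (k.+1%:R : C) = (k.+1%:R : R)%:C by rewrite rmorph_nat.
  by rewrite -fmorphV -rmorphD ltcR.
(* Parallelogram identity: the midpoint of m_k and m_l lies in M, so its squared distance to x is at
   least d. *)
have cauchy k l : D (m k - m l) (m k - m l) <= 2 * ((k.+1%:R)^-1 + (l.+1%:R)^-1).
  have [Mk hk] := hm k; have [Ml hl] := hm l.
  have := psd_parallelogram hdot_psd (x - m l) (x - m k).
  have -> : x - m l - (x - m k) = m k - m l by rewrite opprB addrC addrA subrK.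
  have -> : x - m l + (x - m k) = 2 *: (x - 2^-1 *: (1 *: m k + m l)).
    rewrite scalerBr scalerA divff ?pnatr_eq0 // !scale1r scaler_nat mulr2n opprD.
    by rewrite addrACA [- m l - m k]addrC.
  rewrite (psdZZ hdot_psd) => /(canRL (addKr _)) ->; rewrite addrC lerBlDr.
  rewrite ger0_norm //.
  have Mkl : M (2^-1 *: (1 *: m k + m l)).
    by rewrite -[_ *: (_ + _)]addr0; apply: (Mlin _ _ _ _ M0); exact: Mlin.
  apply: le_trans (ler_wpM2l (ler0n _ 2) (lerD (ltW hl) (ltW hk))) _.
  rewrite -subr_ge0; have := low _ Mkl; rewrite -subr_ge0 -(pmulr_rge0 _ (ltr0Sn C 3)).
  congr (0 <= _); ring.
have [z hz] : exists z, forall e : C, 0 < e -> exists N, forall k, (N <= k)%N ->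
     D (m k - z) (m k - z) < e.
  apply: hcomplete => e e0; have [N hN] := inv_small (divr_gt0 e0 (ltr0Sn C 3)).
  exists N => k l Nk Nl; apply: le_lt_trans (cauchy k l) _.
  rewrite -ltr_pdivlMl // mulrC; apply: lt_le_trans (ltrD (hN k Nk) (hN l Nl)) _.
  by have -> : e / 4 + e / 4 = e / 2 by field.
exists (x - z); split; last first.
  exists m => [k|]; first by have [] := hm k.
  move=> e /hz[N hN]; exists N => k /hN; congr (_ < e).
  have -> : x - (x - z) = z by rewrite opprB addrC subrK.
  exact: psdB_sym hdot_psd _ _.
move=> w Mw.
have vw : cvg_to (fun k => D (x - m k) w) (D (x - z) w).
  apply: cvg_form hdot_psd _ _.
    by move=> e /hz[N hN]; exists N => k /hN; rewrite opprB [x - m k + _]addrC addrA subrK (psdB_sym hdot_psd).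
  by move=> e e0; exists 0%N => k _; rewrite subrr (psd0l hdot_psd).
apply: (cvg_uniq vw); apply: cvg_sq => e e0.
have [w0|w0] := eqVneq (D w w) 0.
  exists 0%N => k _; rewrite subr0; apply: le_lt_trans (psd_CS hdot_psd _ _) _.
  by rewrite w0 mulr0.
have wp : 0 < D w w by rewrite lt_def w0 (psd_ge0 hdot_psd).
have [N hN] := inv_small (divr_gt0 e0 wp); exists N => k /hN; rewrite ltr_pdivlMr // subr0.
apply: le_lt_trans; have [Mk hk] := hm k; set v := x - m k in hk *.
(* The point nearest to x on the line through m_k in the direction w. Its squared distance to x is
   still at least d, which bounds |D v w|^2 / D w w by D v v - d < 1 / (k + 1). *)
have Mc : M ((D v w / D w w) *: w + m k) by exact: Mlin.
have := low _ Mc; rewrite opprD addrCA -/v => h1.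
clearbody v.
have h2 : D (- (D v w / D w w *: w) + v) (- (D v w / D w w *: w) + v) =
    D v v - `|D v w| ^+ 2 / D w w.
  rewrite !(psdDl hdot_psd) !(psdDr hdot_psd) !(psdNl hdot_psd) !(psdNr hdot_psd).
  rewrite !(psdZl hdot_psd) !(psdZr hdot_psd) (psdC hdot_psd v w) rmorphM fmorphV /=.
  by rewrite (geC0_conj (ltW wp)) normCK; field.
move: h1; rewrite h2 => h1; rewrite -ler_pdivrMr //.
apply: (@le_trans _ _ (D v v - d)); first by rewrite lerBrDr addrC -lerBrDr.
by rewrite lerBlDl ltW.
Qed.

End Hilbert.

(** * The mean ergodic theorem *)

Section NullExtra.
Variables (R : realType) (V : lmodType R[i]) (B : V -> V -> R[i]).
Hypothesis hB : psd_form B.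

Lemma nullZ c x : null B x -> null B (fun k => c *: x k).
Proof.
apply: (null_dom hB (exprn_ge0 2 (normr_ge0 c))) => k.
by rewrite (psdZZ hB).
Qed.

Lemma null_lin c x y : null B x -> null B y -> null B (fun k => c *: x k + y k).
Proof. by move=> hx hy; apply: nullD => //; exact: nullZ. Qed.

Lemma null_cst0 : null B (fun=> 0).
Proof. by move=> e e0; exists 0%N => k _; rewrite (psd0l hB). Qed.

Lemma null_closure (x : nat -> V) (y : nat -> nat -> V) (d : nat -> R[i]) :
  (forall j, null B (y j)) -> (forall e, 0 < e -> exists j, d j < e) ->
  (forall j k, B (x k - y j k) (x k - y j k) <= d j) -> null B x.
Proof.
move=> hy hd hx e e0; have e4 : 0 < e / 4 by rewrite divr_gt0.
have [j hj] := hd _ e4; have [m hm] := hy j _ e4; exists m => k /hm h.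
have -> : x k = x k - y j k + y j k by rewrite subrK.
apply: le_lt_trans (psdD_le hB _ _) _.
rewrite -ltr_pdivlMl // mulrC; have -> : e / 2 = e / 4 + e / 4 by field.
by apply: ltrD => //; apply: le_lt_trans (hx j k) hj.
Qed.

End NullExtra.

Section MeanErgodic.
Variables (R : realType) (H : hilbertSpace R) (T T' : H -> H).
Local Notation C := R[i].
Local Notation D := (hdot H).
Hypothesis Tlin : forall c x y, T (c *: x + y) = c *: T x + T y.
Hypothesis Tadj : forall x y, D (T' x) y = D x (T y).
Hypothesis Tcontr : forall x, D (T x) (T x) <= D x x.
Let hD := hdot_psd H.

Definition cesaro k x : H := (k.+1%:R : C)^-1 *: \sum_(n < k.+1) iter n T x.

Lemma iter_lin n c x y : iter n T (c *: x + y) = c *: iter n T x + iter n T y.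
Proof. by elim: n => //= n ->. Qed.

Lemma iter_contr n x : D (iter n T x) (iter n T x) <= D x x.
Proof. by elim: n => //= n IH; apply: le_trans IH. Qed.

Lemma cesaro_lin k c x y : cesaro k (c *: x + y) = c *: cesaro k x + cesaro k y.
Proof.
rewrite /cesaro scalerA mulrC -scalerA -scalerDr; congr (_ *: _).
rewrite scaler_sumr -big_split; apply: eq_bigr => n _; exact: iter_lin.
Qed.

Lemma cesaroB k x y : cesaro k (x - y) = cesaro k x - cesaro k y.
Proof. by rewrite addrC -scaleN1r cesaro_lin scaleN1r addrC. Qed.

Lemma cesaro_contr k x : D (cesaro k x) (cesaro k x) <= D x x.
Proof.
have k0 : 0 < (k.+1%:R : C) by rewrite ltr0Sn.
rewrite /cesaro (psdZZ hD) normrV ?unitfE ?gt_eqF // ger0_norm ?ler0n // exprVn.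
rewrite ler_pdivrMl ?exprn_gt0 //; apply: le_trans (psd_sum_le hD _) _.
rewrite expr2 -mulrA ler_pM2l //; apply: (@le_trans _ _ (\sum_(i < k.+1) D x x)).
  by apply: ler_sum => i _; exact: iter_contr.
by rewrite sumr_const card_ord mulr_natl.
Qed.

Lemma cesaro_fix k x : T x = x -> cesaro k x = x.
Proof.
move=> Tx; rewrite /cesaro (eq_bigr (fun=> x)) => [|n _].
  by rewrite sumr_const card_ord -(scaler_nat k.+1 x) scalerA mulVf ?scale1r // pnatr_eq0.
by elim: (n : nat) => //= m ->.
Qed.

Lemma cesaro_range k x : cesaro k (x - T x) = (k.+1%:R)^-1 *: (x - iter k.+1 T x).
Proof.
rewrite /cesaro; congr (_ *: _).
have e n : iter n T (x - T x) = iter n T x - iter n.+1 T x.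
  by rewrite addrC -scaleN1r iter_lin scaleN1r addrC iterSr.
elim: (k.+1) => [|m IH]; first by rewrite big_ord0 subrr.
by rewrite big_ord_recr IH e /= addrA subrK.
Qed.

Lemma null_inv (x : nat -> H) M : 0 <= M -> (forall k, D (x k) (x k) <= M) ->
  null D (fun k => (k.+1%:R)^-1 *: x k).
Proof.
move=> M0 hx e e0; have M1 : 0 < M + 1 by rewrite ltr_wpDl.
have [m hm] := inv_small (divr_gt0 e0 M1); exists m => k /hm; rewrite ltr_pdivlMr // => h.
have k0 : 0 < (k.+1%:R : C) by rewrite ltr0Sn.
rewrite (psdZZ hD) normrV ?unitfE ?gt_eqF // ger0_norm ?ler0n //.
apply: le_lt_trans h; apply: ler_pM; rewrite ?exprn_ge0 ?invr_ge0 ?(ltW k0) ?(psd_ge0 hD) //.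
  by rewrite expr2 ler_piMl ?invr_ge0 ?(ltW k0) // invf_le1 // ler1n.
by apply: le_trans (hx k) _; rewrite lerDl.
Qed.

Lemma null_cesaro_range x : null D (fun k => cesaro k (x - T x)).
Proof.
apply: (null_ext (fun k => esym (cesaro_range k x))).
apply: (@null_inv _ (2 * (D x x + D x x))).
  by rewrite mulr_ge0 // addr_ge0 // (psd_ge0 hD).
move=> k; apply: le_trans (psdD_le hD _ _) _; rewrite ler_pM2l //.
rewrite lerD2l (psdNl hD) (psdNr hD) opprK; exact: iter_contr.
Qed.

Lemma null_cesaro x : (exists2 m : nat -> H, forall k, exists z, m k = z - T z &
    null D (fun k => x - m k)) -> null D (fun k => cesaro k x).
Proof.
move=> [m hm xm]; apply: (null_closure hD (y := fun j k => cesaro k (m j))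
  (d := fun j => D (x - m j) (x - m j))).
- by move=> j; have [z ->] := hm j; exact: null_cesaro_range.
- by move=> e /xm[j hj]; exists j; exact: hj.
move=> j k; have -> : cesaro k x - cesaro k (m j) = cesaro k (x - m j).
  by rewrite cesaroB.
exact: cesaro_contr.
Qed.

(** Orthogonality to the range of 1 - T says T' y = y, and then |T y - y|^2 = |T y|^2 - |y|^2 <= 0
    because T is a contraction. *)
Lemma fix_adjoint y : (forall z, D y (z - T z) = 0) -> T y = y.
Proof.
move=> hy; have T'y : T' y = y.
  apply/eqP; rewrite -subr_eq0; apply/eqP/hdot_eq0; set w := T' y - y.
  rewrite {1}/w (psdDl hD) (psdNl hD) Tadj; apply/eqP; rewrite subr_eq0; apply/eqP.
  by have := hy w; rewrite (psdDr hD) (psdNr hD) => /eqP; rewrite subr_eq0 => /eqP.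
apply/eqP; rewrite -subr_eq0; apply/eqP/hdot_eq0.
have yT : D y (T y) = D y y by rewrite -Tadj T'y.
apply: le_anti; rewrite (psd_ge0 hD) andbT.
rewrite (psdDl hD) !(psdDr hD) !(psdNl hD) !(psdNr hD) yT (psdC hD y (T y)) yT -(psdC hD).
by rewrite opprK addNr addr0 subr_le0.
Qed.

(** Q x is the component of x orthogonal to the range of 1 - T. It is fixed by T, whereas the means
    of x - Q x tend to 0, by telescoping on the range and by contractivity on its closure. As a
    limit Q x is unique, hence linear in x. *)
Theorem mean_ergodic : exists Q : H -> H,
  [/\ forall x, T (Q x) = Q x, forall x, null D (fun k => cesaro k x - Q x),
      forall x y, D (Q x) y = D x (Q y),
      forall c x y, Q (c *: x + y) = c *: Q x + Q y
    & forall x, T x = x -> Q x = x].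
Proof.
pose M := fun v : H => exists z, v = z - T z.
have sM : subspace M.
  have T0 : T 0 = 0 by have := Tlin (-1) 0 0; rewrite scaler0 addr0 scaleN1r addNr.
  split; first by exists 0; rewrite T0 subr0.
  move=> c _ _ [z ->] [w ->]; exists (c *: z + w).
  by rewrite Tlin scalerBr opprD addrACA.
have /choice[Q hQ] x := orthogonal_projection x sM.
have TQ x : T (Q x) = Q x by apply: fix_adjoint => z; apply: (hQ x).1; exists z.
have cQ x : null D (fun k => cesaro k x - Q x).
  have h : null D (fun k => cesaro k (x - Q x)).
    by apply: null_cesaro; have [m hm nm] := (hQ x).2; exists m.
  by apply: null_ext h => k; rewrite cesaroB (cesaro_fix _ (TQ x)).
have lim y x : null D (fun k => cesaro k x - y) -> Q x = y.
  move=> h; apply/eqP; rewrite -subr_eq0; apply/eqP/hdot_eq0.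
  exact: (null_uniq hD (cQ x) h).
(* y - Q y is a limit of elements of the range of 1 - T, to which Q x is orthogonal. *)
have QD x y : D (Q x) y = D (Q x) (Q y).
  have [m hm nm] := (hQ y).2.
  have : cvg_to (fun k => D (Q x) (m k)) (D (Q x) (y - Q y)).
    apply: cvg_form hD _ _.
      by apply: null_ext (null_cst0 hD) => k; rewrite subrr.
    by move=> e /nm[j hj]; exists j => k /hj; rewrite (psdB_sym hD).
  have h0 : cvg_to (fun k => D (Q x) (m k)) 0.
    by apply: cvg_ext (cvg_cst 0) => k; rewrite (hQ x).1.
  move=> /(cvg_uniq h0)/esym; rewrite (psdDr hD) (psdNr hD) => /eqP.
  by rewrite subr_eq0 => /eqP.
exists Q; split=> // [x y|c x y|x Tx].
- by rewrite [RHS](psdC hD) (QD y x) -(psdC hD) (QD x y).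
- apply: lim; apply: null_ext (null_lin hD c (cQ x) (cQ y)) => k.
  by rewrite cesaro_lin scalerBr opprD addrACA.
- by apply: lim; apply: null_ext (null_cst0 hD) => k; rewrite cesaro_fix // subrr.
Qed.

(** The fixed space is stable under S and under its adjoint S', so it reduces S. *)
Lemma mean_ergodic_comm (Q S S' : H -> H) :
  (forall x, T (Q x) = Q x) -> (forall x y, D (Q x) y = D x (Q y)) ->
  (forall x, T x = x -> Q x = x) ->
  (forall x y, D (S' x) y = D x (S y)) ->
  (forall y, T y = y -> T (S y) = S y) -> (forall y, T y = y -> T (S' y) = S' y) ->
  forall x, Q (S x) = S (Q x).
Proof.
move=> TQ Qadj Qfix Sadj hS hS' x; apply/eqP; rewrite -subr_eq0; apply/eqP/hdot_eq0.
have Sadj' y z : D (S y) z = D y (S' z) by rewrite (psdC hD) -Sadj -(psdC hD).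
have h z : D (Q (S x)) z = D (S (Q x)) z.
  rewrite Qadj Sadj' -[S' (Q z)]Qfix; last by apply: hS'; exact: TQ.
  by rewrite -Qadj -Sadj' -Qadj Qfix //; apply: hS; exact: TQ.
by rewrite (psdDl hD) (psdNl hD) h subrr.
Qed.

End MeanErgodic.

(** * Representations and cocycles *)

Section StarAlgebra.
Variables (R : realType) (A : algType R[i]) (star : A -> A) (eps : A -> R[i]).
Local Notation C := R[i].

(** The analytic part is written for an abstract algebra with these properties, so that the quotient
    of the free algebra is never unfolded there. *)
Record star_algebra : Prop := StarAlgebra {
  saP : forall c a b, star (c *: a + b) = Num.conj c *: star a + star b;
  saM : forall a b, star (a * b) = star b * star a;
  sa1 : star 1 = 1;
  saK : forall a, star (star a) = a;
  epsP : forall c a b, eps (c *: a + b) = c * eps a + eps b;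
  epsM : forall a b, eps (a * b) = eps a * eps b;
  eps1 : eps 1 = 1;
  eps_star : forall a, eps (star a) = Num.conj (eps a) }.

Hypothesis hA : star_algebra.

Lemma sa0 : star 0 = 0.
Proof. by have := saP hA (-1) 1 1; rewrite rmorphN1 !scaleN1r !addNr. Qed.

Lemma saD a b : star (a + b) = star a + star b.
Proof. by rewrite -[a in LHS]scale1r (saP hA) conjC1 scale1r. Qed.

Lemma saZ c a : star (c *: a) = Num.conj c *: star a.
Proof. by rewrite -[c *: a]addr0 (saP hA) sa0 addr0. Qed.

Lemma saB a b : star (a - b) = star a - star b.
Proof. by rewrite saD -(scaleN1r b) saZ rmorphN1 scaleN1r. Qed.

Lemma eps0 : eps 0 = 0.
Proof. by have := epsP hA (-1) 1 1; rewrite scaleN1r mulN1r !addNr. Qed.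

Lemma epsD a b : eps (a + b) = eps a + eps b.
Proof. by rewrite -[a in LHS]scale1r (epsP hA) mul1r. Qed.

Lemma epsZ c a : eps (c *: a) = c * eps a.
Proof. by rewrite -[c *: a]addr0 (epsP hA) eps0 addr0. Qed.

Lemma epsB a b : eps (a - b) = eps a - eps b.
Proof. by rewrite epsD -(scaleN1r b) epsZ mulN1r. Qed.

Lemma eps_sum I (r : seq I) P (F : I -> A) :
  eps (\sum_(i <- r | P i) F i) = \sum_(i <- r | P i) eps (F i).
Proof. exact: (big_morph _ epsD eps0). Qed.

Lemma epsX a n : eps (a ^+ n) = eps a ^+ n.
Proof. by elim: n => [|n IH]; rewrite ?(eps1 hA) // !exprS (epsM hA) IH. Qed.

Lemma eps_alg c : eps c%:A = c.
Proof. by rewrite epsZ (eps1 hA) mulr1. Qed.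

Lemma eps_center a : eps (a - (eps a)%:A) = 0.
Proof. by rewrite epsB eps_alg subrr. Qed.

Section Representation.
Variables (H : hilbertSpace R) (rho : A -> H -> H) (eta : A -> H).
Local Notation D := (hdot H).
Let hD := hdot_psd H.

Record star_rep : Prop := StarRep {
  rep_lin : forall a c x y, rho a (c *: x + y) = c *: rho a x + rho a y;
  repP : forall c a b x, rho (c *: a + b) x = c *: rho a x + rho b x;
  rep1 : forall x, rho 1 x = x;
  repM : forall a b x, rho (a * b) x = rho a (rho b x);
  rep_adj : forall a x y, D (rho (star a) x) y = D x (rho a y) }.

Record rep_cocycle : Prop := RepCocycle {
  cocP : forall c a b, eta (c *: a + b) = c *: eta a + eta b;
  cocM : forall a b, eta (a * b) = rho a (eta b) + eps b *: eta a }.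

Hypothesis hrho : star_rep.

Lemma rep_0r a : rho a 0 = 0.
Proof. by have := rep_lin hrho a (-1) 0 0; rewrite scaler0 addr0 scaleN1r addNr. Qed.

Lemma rep_Dr a x y : rho a (x + y) = rho a x + rho a y.
Proof. by rewrite -[x in LHS]scale1r (rep_lin hrho) scale1r. Qed.

Lemma rep_Zr a c x : rho a (c *: x) = c *: rho a x.
Proof. by rewrite -[c *: x]addr0 (rep_lin hrho) rep_0r addr0. Qed.

Lemma rep_Br a x y : rho a (x - y) = rho a x - rho a y.
Proof. by rewrite rep_Dr -(scaleN1r y) rep_Zr scaleN1r. Qed.

Lemma rep_0l x : rho 0 x = 0.
Proof. by have := repP hrho (-1) 1 1 x; rewrite !scaleN1r !addNr. Qed.

Lemma rep_Dl a b x : rho (a + b) x = rho a x + rho b x.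
Proof. by rewrite -[a in LHS]scale1r (repP hrho) scale1r. Qed.

Lemma rep_Zl c a x : rho (c *: a) x = c *: rho a x.
Proof. by rewrite -[c *: a]addr0 (repP hrho) rep_0l addr0. Qed.

Lemma rep_Bl a b x : rho (a - b) x = rho a x - rho b x.
Proof. by rewrite rep_Dl -(scaleN1r b) rep_Zl scaleN1r. Qed.

Lemma rep_suml I (r : seq I) P (F : I -> A) x :
  rho (\sum_(i <- r | P i) F i) x = \sum_(i <- r | P i) rho (F i) x.
Proof. exact: (big_morph (rho^~ x) (fun a b => rep_Dl a b x) (rep_0l x)). Qed.

Lemma rep_adjr a x y : D (rho a x) y = D x (rho (star a) y).
Proof. by rewrite -(rep_adj hrho) (saK hA). Qed.

Lemma rep_X a n x : rho (a ^+ n) x = iter n (rho a) x.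
Proof. by elim: n => [|n IH]; rewrite ?expr0 ?(rep1 hrho) // exprS (repM hrho) IH. Qed.

Hypothesis heta : rep_cocycle.

Lemma coc0 : eta 0 = 0.
Proof. by have := cocP heta (-1) 1 1; rewrite !scaleN1r !addNr. Qed.

Lemma cocD a b : eta (a + b) = eta a + eta b.
Proof. by rewrite -[a in LHS]scale1r (cocP heta) scale1r. Qed.

Lemma cocZ c a : eta (c *: a) = c *: eta a.
Proof. by rewrite -[c *: a]addr0 (cocP heta) coc0 addr0. Qed.

Lemma cocB a b : eta (a - b) = eta a - eta b.
Proof. by rewrite cocD -(scaleN1r b) cocZ scaleN1r. Qed.

Lemma coc1 : eta 1 = 0.
Proof.
have := cocM heta 1 1; rewrite mulr1 (rep1 hrho) (eps1 hA) scale1r => /eqP.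
by rewrite -subr_eq0 opprD addrA subrr sub0r oppr_eq0 => /eqP.
Qed.

Lemma coc_alg c : eta c%:A = 0.
Proof. by rewrite cocZ coc1 scaler0. Qed.

Lemma cocMK a b : eps b = 0 -> eta (a * b) = rho a (eta b).
Proof. by move=> b0; rewrite (cocM heta) b0 scale0r addr0. Qed.

End Representation.

(* Cutting a representation down to the range of a projection in its commutant,
   completed by the counit so that it stays unital on the same space. *)
Section Cut.
Variables (H : hilbertSpace R) (rho : A -> H -> H) (eta : A -> H) (P : H -> H).
Local Notation D := (hdot H).
Let hD := hdot_psd H.
Hypotheses (hrho : star_rep rho) (heta : rep_cocycle rho eta).
Hypothesis Plin : forall c x y, P (c *: x + y) = c *: P x + P y.
Hypothesis Padj : forall x y, D (P x) y = D x (P y).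
Hypothesis PP : forall x, P (P x) = P x.
Hypothesis Pcomm : forall a x, P (rho a x) = rho a (P x).

Definition cut_rep (a : A) (x : H) : H := rho a (P x) + eps a *: (x - P x).

Let P0 : P 0 = 0.
Proof. by have := Plin (-1) 0 0; rewrite scaler0 addr0 scaleN1r addNr. Qed.

Let PD x y : P (x + y) = P x + P y.
Proof. by rewrite -[x in LHS]scale1r Plin scale1r. Qed.

Let PZ c x : P (c *: x) = c *: P x.
Proof. by rewrite -[c *: x]addr0 Plin P0 addr0. Qed.

Let PB x y : P (x - y) = P x - P y.
Proof. by rewrite PD -(scaleN1r y) PZ scaleN1r. Qed.

Lemma cut_rep_range a x : cut_rep a (P x) = rho a (P x).
Proof. by rewrite /cut_rep PP subrr scaler0 addr0. Qed.

Lemma cut_star_rep : star_rep cut_rep.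
Proof.
rewrite /cut_rep; split=> [a c x y|c a b x|x|a b x|a x y].
- rewrite Plin (rep_lin hrho) opprD addrACA -scalerBr scalerDr scalerA.
  by rewrite [eps a * c]mulrC -scalerA addrACA -scalerDr.
- rewrite (repP hrho) (epsP hA); move: (x - P x) => w.
  by rewrite scalerDl scalerDr scalerA addrACA.
- by rewrite (rep1 hrho) (eps1 hA) scale1r addrC subrK.
- rewrite PD PZ PB PP subrr scaler0 addr0 Pcomm PP (repM hrho) (epsM hA).
  by rewrite addrAC subrr add0r scalerA.
rewrite (eps_star hA) !(psdDl hD) !(psdDr hD) (rep_adj hrho) (psdZl hD) (psdZr hD).
congr (_ + _ * _); first by rewrite Padj Pcomm.
by rewrite (psdDl hD) (psdDr hD) (psdNl hD) (psdNr hD) Padj.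
Qed.

Lemma cut_cocycle : rep_cocycle cut_rep (P \o eta).
Proof.
split=> [c a b|a b] /=; first by rewrite (cocP heta) Plin.
by rewrite (cocM heta) PD PZ Pcomm cut_rep_range.
Qed.

End Cut.

(** The Cesaro mean inside the algebra: these are the h_k, at which functionals and cocycles can be
    evaluated. *)
Definition ces (u : A) (k : nat) : A := (k.+1%:R : C)^-1 *: \sum_(n < k.+1) u ^+ n.

Lemma rep_ces (H : hilbertSpace R) (rho : A -> H -> H) u k x :
  star_rep rho -> rho (ces u k) x = cesaro (rho u) k x.
Proof.
move=> hrho; rewrite /ces rep_Zl // rep_suml //; congr (_ *: _).
by apply: eq_bigr => n _; rewrite rep_X.
Qed.

Lemma ces_comm u b k : b * u = u * b -> b * ces u k = ces u k * b.
Proof.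
move=> bu; rewrite /ces -scalerAl -scalerAr; congr (_ *: _).
rewrite mulr_sumr mulr_suml; apply: eq_bigr => n _.
exact: commrX.
Qed.

Lemma eps_ces u k : eps u = 1 -> eps (ces u k) = 1.
Proof.
move=> u1; rewrite /ces epsZ eps_sum (eq_bigr (fun=> 1)) => [|n _].
  by rewrite sumr_const card_ord mulVf // pnatr_eq0.
by rewrite epsX u1 expr1n.
Qed.

End StarAlgebra.

(** * Generators in a representation and the vectors fixed by a diagonal generator *)

Section Generators.
Variables (R : realType) (q : R) (A : algType R[i]) (star : A -> A) (eps : A -> R[i]).
Variables (N : nat) (u : 'I_N -> 'I_N -> A).
Local Notation C := R[i].
Hypothesis q01 : 0 < q < 1.

Record su_generators : Prop := SuGenerators {
  su_ind : forall P : A -> Prop,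
    (forall c a b, P a -> P b -> P (c *: a + b)) -> P 1 ->
    (forall j k a, P a -> P (u j k * a)) -> forall a, P a;
  su_unitary : forall j k, \sum_s u j s * star (u k s) = (j == k)%:R;
  su_unitary_star : forall j k, \sum_s star (u s j) * u s k = (j == k)%:R;
  su_eps : forall j k, eps (u j k) = (j == k)%:R;
  su_quantum : quantum_matrix q (\matrix_(j, k) u j k);
  su_det : qdet q (\matrix_(j, k) u j k) = 1 }.

Hypotheses (hA : star_algebra star eps) (hu : su_generators).

Lemma u_column (i k j : 'I_N) : (i < k)%N -> u i j * u k j = q%:C *: (u k j * u i j).
Proof. by move=> ik; have := qm_column (su_quantum hu) j ik; rewrite !mxE. Qed.

Lemma u_row (i j l : 'I_N) : (j < l)%N -> u i j * u i l = q%:C *: (u i l * u i j).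
Proof. by move=> jl; have := qm_row (su_quantum hu) i jl; rewrite !mxE. Qed.

Lemma u_diagonal (i k j l : 'I_N) : (i < k)%N -> (j < l)%N ->
  u i j * u k l = u k l * u i j - (q%:C^-1 - q%:C) *: (u i l * u k j).
Proof. by move=> ik jl; have := qm_diagonal (su_quantum hu) ik jl; rewrite !mxE. Qed.

Lemma q_lt1C : 0 <= q%:C /\ q%:C < (1 : C).
Proof. by case/andP: q01 => q0 q1; rewrite lecR ltcR ltW. Qed.

Lemma q_neq0C : q%:C != 0 :> C.
Proof. by case/andP: q01 => q0 _; rewrite eq_complex /= negb_and (gt_eqF q0). Qed.

Section Rep.
Variables (H : hilbertSpace R) (rho : A -> H -> H).
Local Notation D := (hdot H).
Let hD := hdot_psd H.
Hypothesis hrho : star_rep star rho.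

Lemma rep_contraction s m x : D (rho (u s m) x) (rho (u s m) x) <= D x x.
Proof.
have -> : D x x = \sum_t D (rho (u t m) x) (rho (u t m) x).
  rewrite -{1}(rep1 hrho x); have := su_unitary_star hu m m; rewrite eqxx -[true%:R]/(1 : A) => <-.
  rewrite (rep_suml hrho) (psd_suml hD); apply: eq_bigr => t _.
  by rewrite (repM hrho) (rep_adj hrho).
by rewrite (bigD1 s) //= lerDl; apply: sumr_ge0 => t _; exact: psd_ge0.
Qed.

(** Unitarity of the generator matrix makes every generator a contraction; this is why [star_rep]
    does not list boundedness. *)
Lemma rep_bounded a : exists2 M : C, 0 <= M & forall x, D (rho a x) (rho a x) <= M * D x x.
Proof.
elim/(su_ind hu): a => [c a b [M M0 hM] [M' M'0 hM']||j k a [M M0 hM]].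
- exists (2 * (`|c| ^+ 2 * M + M')).
    by rewrite mulr_ge0 // addr_ge0 // mulr_ge0 // exprn_ge0.
  move=> x; rewrite (repP hrho); apply: le_trans (psdD_le hD _ _) _.
  rewrite -mulrA ler_pM2l // mulrDl; apply: lerD => //.
  by rewrite (psdZZ hD) -[leRHS]mulrA ler_wpM2l // exprn_ge0.
- by exists 1 => // x; rewrite (rep1 hrho) mul1r.
- exists M => // x; rewrite (repM hrho); apply: le_trans (hM x).
  exact: rep_contraction.
Qed.

Lemma null_rep a x : null D x -> null D (fun k => rho a (x k)).
Proof. by have [M M0 hM] := rep_bounded a; apply: (null_dom hD M0) => k; exact: hM. Qed.

(** |x| = q |y| <= q |x| with q < 1. *)
Lemma q_contraction0 (x y : H) : x = q%:C *: y -> D y y <= D x x -> x = 0.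
Proof.
move=> e yx; have [q0 q1] := q_lt1C.
apply: hdot_eq0; apply: le_anti; rewrite (psd_ge0 hD) andbT.
have h : D x x <= q%:C * D x x.
  rewrite {1 2}e (psdZZ hD) ger0_norm // expr2 -[leLHS]mulrA ler_wpM2l //.
  by apply: le_trans (ler_wpM2l q0 yx) _; rewrite ler_piMl ?(psd_ge0 hD) // ltW.
rewrite real_leNgt ?real0 ?ger0_real ?(psd_ge0 hD) //; apply/negP => xp.
by move: h; rewrite -[leLHS]mul1r ler_pM2r // => /(lt_le_trans q1); rewrite ltxx.
Qed.

Lemma rep_fix_offdiag (j k : 'I_N) y : (j < k)%N -> rho (u k k) y = y ->
  rho (u j k) y = 0 /\ rho (u k j) y = 0.
Proof.
move=> jk fy; split.
  apply: (@q_contraction0 _ (rho (u k k) (rho (u j k) y))); last exact: rep_contraction.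
  by rewrite -{1}fy -(repM hrho) (u_column k jk) (rep_Zl hrho) (repM hrho).
apply: (@q_contraction0 _ (rho (u k k) (rho (u k j) y))); last exact: rep_contraction.
by rewrite -{1}fy -(repM hrho) (u_row k jk) (rep_Zl hrho) (repM hrho).
Qed.

(** The situation in the middle of the descent: the diagonal generators beyond m already act as the
    identity, and m is the next index to be treated. *)
Variable m : 'I_N.
Hypothesis hm : forall (k : 'I_N) x, (m < k)%N -> rho (u k k) x = x.

Lemma rep_above (j k : 'I_N) x : (m < j)%N || (m < k)%N ->
  rho (u j k) x = (j == k)%:R *: x.
Proof.
have [->|jk] := eqVneq j k; first by rewrite orbb scale1r => /hm.
rewrite scale0r; move: jk; rewrite -val_eqE neq_ltn => /orP[jk|kj] h.
  have mk : (m < k)%N by case/orP: h => // mj; exact: ltn_trans mj jk.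
  by have [] := rep_fix_offdiag jk (hm x mk).
have mj : (m < j)%N by case/orP: h => // mk; exact: ltn_trans mk kj.
by have [] := rep_fix_offdiag kj (hm x mj).
Qed.

(** For j, k < m the failure of u_jk to commute with u_mm is a multiple of u_jm u_mk, and u_mk kills
    the vectors fixed by u_mm. *)
Lemma rep_fix_stable a y : rho (u m m) y = y -> rho (u m m) (rho a y) = rho a y.
Proof.
elim/(su_ind hu): a y => [c a b IHa IHb||j k a IH] y fy.
- by rewrite (repP hrho) (rep_lin hrho) IHa // IHb.
- by rewrite (rep1 hrho).
rewrite (repM hrho); move: (rho a y) (IH y fy) => {IH fy}z fz.
have [h|] := boolP ((m < j)%N || (m < k)%N).
  by rewrite (rep_above z h) (rep_Zr hrho) fz.
rewrite negb_or -!leqNgt => /andP[]; rewrite leq_eqVlt => /predU1P[jm|jm].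
  rewrite leq_eqVlt => /predU1P[km|km].
    by rewrite (val_inj jm) (val_inj km) fz.
  by rewrite (val_inj jm) (rep_fix_offdiag km fz).2 (rep_0r hrho).
rewrite leq_eqVlt => /predU1P[km|km].
  by rewrite (val_inj km) (rep_fix_offdiag jm fz).1 (rep_0r hrho).
have := u_diagonal jm km => /(congr1 (fun a => rho a z)).
rewrite (rep_Bl hrho) (rep_Zl hrho) !(repM hrho) fz (rep_fix_offdiag km fz).2.
by rewrite (rep_0r hrho) scaler0 subr0.
Qed.

Lemma rep_ergodic : exists Q : H -> H,
  [/\ forall x, null D (fun k => cesaro (rho (u m m)) k x - Q x),
      [/\ forall c x y, Q (c *: x + y) = c *: Q x + Q y,
          forall x y, D (Q x) y = D x (Q y),
          forall x, Q (Q x) = Q x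
        & forall a x, Q (rho a x) = rho a (Q x)]
    & (forall x, rho (u m m) (Q x) = Q x) /\
      (forall x, rho (u m m) x = x -> Q x = x)].
Proof.
have [Q [TQ cQ Qadj Qlin Qfix]] := mean_ergodic (rep_lin hrho (u m m))
  (rep_adj hrho (u m m)) (rep_contraction m m).
exists Q; split=> //; split=> // [x|a x]; first by apply: Qfix; exact: TQ.
apply: (mean_ergodic_comm TQ Qadj Qfix (rep_adj hrho a)) => y.
  exact: rep_fix_stable.
exact: rep_fix_stable.
Qed.

End Rep.
End Generators.

(** * Pure cocycles as limits of coboundaries *)

Section Approximation.
Variables (R : realType) (q : R) (A : algType R[i]) (star : A -> A) (eps : A -> R[i]).
Variables (n : nat) (u : 'I_n.+1 -> 'I_n.+1 -> A).
Local Notation C := R[i].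
Hypotheses (q01 : 0 < q < 1) (hA : star_algebra star eps) (hu : su_generators q star eps u).
Variables (H : hilbertSpace R) (rho : A -> H -> H) (eta : A -> H).
Local Notation D := (hdot H).
Let hD := hdot_psd H.
Hypotheses (hrho : star_rep star rho) (heta : rep_cocycle eps rho eta).
Local Notation t := (u ord_max ord_max).
Hypothesis pure : forall b, null D (fun k => cesaro (rho t) k (eta b)).

Let eps_t : eps t = 1. Proof. by rewrite (su_eps hu) eqxx. Qed.
Let h := ces t.
Let G b := null D (fun k => eta (b * h k)).

Let Glin c a b : G a -> G b -> G (c *: a + b).
Proof.
move=> Ga Gb; apply: null_ext (null_lin hD c Ga Gb) => k.
by rewrite mulrDl -scalerAl (cocP heta).
Qed.

Let eps_h b k : eps (b * h k) = eps b.
Proof. by rewrite (epsM hA) (eps_ces hA) ?mulr1. Qed.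

Let GM a b : eps b = 0 -> G b -> G (a * b).
Proof.
move=> b0 Gb; apply: null_ext (null_rep hu hrho a Gb) => k.
by rewrite -mulrA (cocMK heta a) // eps_h.
Qed.

(** Here b h_k = h_k b, and eta (h_k b) = h_k eta (b) tends to 0 by purity. The other cases are
    reduced to this one. *)
Let Gcomm b : eps b = 0 -> b * t = t * b -> G b.
Proof.
move=> b0 bt; apply: null_ext (pure b) => k.
by rewrite /h (ces_comm _ bt) (cocMK heta) // (rep_ces _ _ _ hrho).
Qed.

Let Gt : G (t - 1).
Proof. by apply: Gcomm; rewrite ?(epsB hA) ?eps_t ?(eps1 hA) ?subrr // mulrBl mulrBr mul1r mulr1. Qed.

(* (1 - t) h_k = (1 - t^(k+1)) / (k + 1) is small even without the pairing
   with an element of the kernel of the counit. *)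
Let Gx x : null D (fun k => eta (x * (1 - t) * h k)).
Proof.
apply: (@GM x (1 - t)); first by rewrite (epsB hA) eps_t (eps1 hA) subrr.
by apply: Gcomm; rewrite ?(epsB hA) ?eps_t ?(eps1 hA) ?subrr // mulrBl mulrBr mul1r mulr1.
Qed.

(** eta (w (1 - t) h_k) = (1 - q t) eta (w h_k) tends to 0 by [Gx], and 1 - q t is bounded below by
    1 - q since t is a contraction. *)
Let Gq w : eps w = 0 -> w * t = q%:C *: (t * w) -> G w.
Proof.
move=> w0 wt; have [q0 q1] := q_lt1C q01.
have p1 : 0 < 1 - q%:C :> C by rewrite subr_gt0.
have p2 : 0 <= ((1 - q%:C)^-1 ^+ 2 : C) by rewrite exprn_ge0 // invr_ge0 ltW.
apply: (null_dom hD p2 _ (Gx w)) => k; set z := eta (w * h k).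
have e : eta (w * (1 - t) * h k) = z - q%:C *: rho t z.
  rewrite mulrBr mulr1 mulrBl (cocB heta) wt -scalerAl (cocZ heta) -mulrA.
  by rewrite (cocMK heta t) // eps_h.
rewrite e exprVn mulrC ler_pdivlMr ?exprn_gt0 //; set y := z - _.
have zE : z = y + q%:C *: rho t z by rewrite subrK.
have tz : D (rho t z) (rho t z) <= D z z by exact: (rep_contraction hu hrho).
(* convexity: |(1-q) a + q b|^2 <= (1-q)|a|^2 + q|b|^2 with (1-q) a = y *)
pose a := (1 - q%:C)^-1 *: y.
have ya : y = (1 - q%:C) *: a by rewrite /a scalerA divff ?scale1r // gt_eqF.
have conv : D z z <= (1 - q%:C) * D a a + q%:C * D (rho t z) (rho t z).
  rewrite {1 2}zE ya -subr_ge0.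
  have := psd_ge0 hD (a - rho t z).
  have : 0 <= (1 - q%:C) * q%:C by rewrite mulr_ge0 // ltW.
  move=> c0 /(mulr_ge0 c0); congr (0 <= _).
  rewrite !(psdDl hD) !(psdDr hD) !(psdNl hD) !(psdNr hD) !(psdZl hD) !(psdZr hD).
  rewrite rmorphB /= conjC1 (geC0_conj q0); ring.
have : D z z <= (1 - q%:C) * D a a + q%:C * D z z.
  by apply: le_trans conv _; rewrite lerD2l ler_wpM2l.
rewrite -lerBlDr -[X in X - _]mul1r -mulrBl ler_pM2l // => za.
have -> : D y y = (1 - q%:C) ^+ 2 * D a a.
  by rewrite ya (psdZZ hD) ger0_norm // ltW.
by rewrite mulrC ler_pM2l // exprn_gt0.
Qed.

(** The generator z = u_jl does not commute with t, but the quantum minor z t - q y w does; [m] is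
    this minor, written with t on the left. It yields the claim for (z - d) t, and [Gx] for (z -
    d)(1 - t). *)
Let Gcorner (j l : 'I_n.+1) : (j < n)%N -> (l < n)%N -> G (u j l - (j == l)%:R%:A).
Proof.
move=> jn ln; pose z := u j l; pose d : C := (j == l)%:R; rewrite -/z -/d.
pose y := u j ord_max; pose w := u ord_max l.
have jm : (j < ord_max (n' := n))%N by [].
have lm : (l < ord_max (n' := n))%N by [].
have yt : y * t = q%:C *: (t * y) by exact: (u_column hu).
have wt : w * t = q%:C *: (t * w) by exact: (u_row hu).
have zt : z * t = t * z - (q%:C^-1 - q%:C) *: (y * w) by exact: (u_diagonal hu).
have w0 : eps w = 0 by rewrite (su_eps hu) eq_sym -val_eqE ltn_eqF.
have z0 : eps z = d by rewrite (su_eps hu).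
have Gyw : G (y * w) by apply: GM => //; exact: Gq.
pose m := t * z - q%:C^-1 *: (y * w).
have mt : m * t = t * m.
  rewrite /m mulrBl mulrBr -mulrA zt mulrBr -scalerAl -mulrA wt -!scalerAr.
  rewrite scalerA mulVf ?q_neq0C // scale1r [y * (t * w)]mulrA yt -scalerAl -[t * y * w]mulrA.
  by rewrite -addrA -opprD -scalerDl subrK.
have Gm : G (m - d%:A).
  apply: Gcomm.
    by rewrite (epsB hA) (eps_alg hA) (epsB hA) (epsZ hA) !(epsM hA) eps_t w0 z0 !mulr0 subr0 mul1r subrr.
  by rewrite mulrBl mulrBr mt mulr_algl mulr_algr.
have abel (a b c d' : A) : a + (b + (- c + (d' - a - b))) = d' - c.
  by rewrite (addrCA b) [b + _]addrC subrK addrCA [a + _]addrC subrK addrC.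
have Gtx : G (t * (z - d%:A)).
  have -> : t * (z - d%:A) = q%:C^-1 *: (y * w) + (- d *: (t - 1) + (m - d%:A)).
    rewrite /m mulrBr mulr_algr scaleNr scalerBr opprB -addrA.
    by rewrite [RHS]abel.
  by apply: Glin => //; apply: Glin.
have Gxt : G ((z - d%:A) * t).
  have -> : (z - d%:A) * t = - (q%:C^-1 - q%:C) *: (y * w) + t * (z - d%:A).
    by rewrite mulrBl zt mulr_algl mulrBr mulr_algr scaleNr [RHS]addrCA addrA.
  exact: Glin.
have := nullD hD (Gx (z - d%:A)) Gxt; apply: null_ext => k.
by rewrite -(cocD heta) -mulrDl mulrBr mulr1 subrK.
Qed.

Theorem cocycle_approximation b : eps b = 0 -> null D (fun k => eta (b * h k)).
Proof.
have G1 c : G (c%:A - c%:A).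
  by apply: null_ext (null_cst0 hD) => k; rewrite subrr mul0r (coc0 heta).
have Ggen j l : G (u j l - (eps (u j l))%:A).
  have jn : (j <= n)%N by rewrite -ltnS. have ln : (l <= n)%N by rewrite -ltnS.
  rewrite (su_eps hu); move: jn ln.
  rewrite (leq_eqVlt j) (leq_eqVlt l) => /predU1P[jm|jn] /predU1P[lm|ln]; last exact: Gcorner.
  - have -> : j = ord_max by exact: val_inj.
    have -> : l = ord_max by exact: val_inj.
    by rewrite eqxx scale1r; exact: Gt.
  - have -> : j = ord_max by exact: val_inj.
    have ml : (ord_max == l) = false by apply/negbTE; rewrite -val_eqE gtn_eqF.
    rewrite ml scale0r subr0; apply: Gq; first by rewrite (su_eps hu) ml.
    exact: (u_row hu).
  - have -> : l = ord_max by exact: val_inj.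
    have mj : (j == ord_max) = false by apply/negbTE; rewrite -val_eqE ltn_eqF.
    rewrite mj scale0r subr0; apply: Gq; first by rewrite (su_eps hu) mj.
    exact: (u_column hu).
have Gall a : G (a - (eps a)%:A).
  elim/(su_ind hu): a => [c a a' Ga Ga'||j l a Ga].
  - have -> : c *: a + a' - (eps (c *: a + a'))%:A =
        c *: (a - (eps a)%:A) + (a' - (eps a')%:A).
      by rewrite (epsP hA) scalerBr scalerDl opprD addrACA scalerA.
    exact: Glin.
  - by rewrite (eps1 hA) -[1 in X in X - _]scale1r; exact: G1.
  have -> : u j l * a - (eps (u j l * a))%:A =
      eps a *: (u j l - (eps (u j l))%:A) + u j l * (a - (eps a)%:A).
    by rewrite (epsM hA) mulrBr mulr_algr scalerBr scalerA [eps a * _]mulrC [RHS]addrC addrA subrK.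
  apply: Glin => //; apply: GM => //; exact: (eps_center hA).
by move=> b0; have := Gall b; rewrite b0 scale0r subr0.
Qed.

(** As eps (h_k) = 1, the cocycle identity makes the difference equal to -eta (b h_k). *)
Corollary coboundary_approximation b : eps b = 0 ->
  null D (fun k => rho b (- eta (h k)) - eta b).
Proof.
move=> b0; apply: null_ext (nullZ hD (-1) (cocycle_approximation b0)) => k.
rewrite (cocM heta) (eps_ces hA) // scale1r -[- eta _]scaleN1r (rep_Zr hrho).
by rewrite scalerDr !scaleN1r.
Qed.

End Approximation.

(** * The projection onto K_2 and pure cocycles *)

Section PowersOfKernel.
Variables (R : realType) (A : algType R[i]) (star : A -> A) (eps : A -> R[i]).
Local Notation C := R[i].
Hypothesis hA : star_algebra star eps.

Definition in_Kn n (a : A) : Prop :=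
  exists m (c : 'I_m -> C) (x : 'I_m -> 'I_n -> A),
    (forall i j, eps (x i j) = 0) /\ a = \sum_(i < m) c i *: \prod_(j < n) x i j.

Lemma in_Kn_lin n c a b : in_Kn n a -> in_Kn n b -> in_Kn n (c *: a + b).
Proof.
move=> [m [d [x [hx ->]]]] [m' [d' [x' [hx' ->]]]].
exists (m + m')%N, (fun i => match split i with inl i => c * d i | inr i => d' i end),
  (fun i => match split i with inl i => x i | inr i => x' i end); split.
  by move=> i j; case: (split i).
rewrite big_split_ord scaler_sumr; congr (_ + _); apply: eq_bigr => i _.
  by rewrite (unsplitK (inl i)) scalerA.
by rewrite (unsplitK (inr i)).
Qed.

Lemma in_Kn0 n : in_Kn n 0.
Proof. by exists 0%N, (fun=> 0), (fun _ _ => 0); split=> [[]//|]; rewrite big_ord0. Qed.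

Lemma in_KnD n a b : in_Kn n a -> in_Kn n b -> in_Kn n (a + b).
Proof. by rewrite -{2}[a]scale1r; exact: in_Kn_lin. Qed.

Lemma in_KnZ n c a : in_Kn n a -> in_Kn n (c *: a).
Proof. by move=> h; rewrite -[_ *: _]addr0; apply: in_Kn_lin => //; exact: in_Kn0. Qed.

Lemma in_KnN n a : in_Kn n a -> in_Kn n (- a).
Proof. by rewrite -scaleN1r; exact: in_KnZ. Qed.

Lemma in_KnB n a b : in_Kn n a -> in_Kn n b -> in_Kn n (a - b).
Proof. by move=> ha /in_KnN; exact: in_KnD. Qed.

Lemma in_Kn_sum n I (r : seq I) (P : pred I) (F : I -> A) :
  (forall i, P i -> in_Kn n (F i)) -> in_Kn n (\sum_(i <- r | P i) F i).
Proof. by move=> h; apply: big_ind => //; [exact: in_Kn0|exact: in_KnD]. Qed.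

Lemma in_Kn_prod n (x : 'I_n -> A) :
  (forall i, eps (x i) = 0) -> in_Kn n (\prod_(i < n) x i).
Proof.
move=> hx; exists 1%N, (fun=> 1), (fun=> x); split=> //.
by rewrite big_ord1 scale1r.
Qed.

Lemma in_K2M a b : eps a = 0 -> eps b = 0 -> in_Kn 2 (a * b).
Proof.
move=> a0 b0; have := @in_Kn_prod 2 (fun i => if i == ord0 then a else b).
by rewrite big_ord_recl big_ord1 /=; apply => i; case: ifP.
Qed.

Lemma in_K3M a b c : eps a = 0 -> eps b = 0 -> eps c = 0 -> in_Kn 3 (a * b * c).
Proof.
move=> a0 b0 c0.
have := @in_Kn_prod 3 (fun i => if i == ord0 then a else if i == ord_max then c else b).
by rewrite !big_ord_recl big_ord0 mulr1 mulrA /=; apply => i; do 2!case: ifP => //.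
Qed.

Lemma in_K2_ind (P : A -> Prop) : P 0 ->
  (forall c a b, P a -> P b -> P (c *: a + b)) ->
  (forall a b, eps a = 0 -> eps b = 0 -> P (a * b)) -> forall a, in_Kn 2 a -> P a.
Proof.
move=> P0 PD PM a [m [c [x [hx ->]]]]; elim/big_rec: _ => // i b _ Pb.
by apply: PD => //; rewrite big_ord_recl big_ord1; exact: PM.
Qed.

Lemma in_K3_ind (P : A -> Prop) : P 0 ->
  (forall c a b, P a -> P b -> P (c *: a + b)) ->
  (forall a b c, eps a = 0 -> eps b = 0 -> eps c = 0 -> P (a * b * c)) ->
  forall a, in_Kn 3 a -> P a.
Proof.
move=> P0 PD PM a [m [c [x [hx ->]]]]; elim/big_rec: _ => // i b _ Pb.
by apply: PD => //; rewrite !big_ord_recl big_ord0 mulr1 mulrA; exact: PM.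
Qed.

Lemma in_K2_eps a : in_Kn 2 a -> eps a = 0.
Proof.
move: a; apply: in_K2_ind => [|c a b a0 b0|a b a0 b0]; first exact: (eps0 hA).
  by rewrite (epsP hA) a0 b0 mulr0 addr0.
by rewrite (epsM hA) a0 mul0r.
Qed.

Lemma in_K2_star a : in_Kn 2 a -> in_Kn 2 (star a).
Proof.
move: a; apply: in_K2_ind => [|c a b a0 b0|a b a0 b0].
- by rewrite (sa0 hA); exact: in_Kn0.
- by rewrite (saP hA); exact: in_Kn_lin.
by rewrite (saM hA); apply: in_K2M; rewrite (eps_star hA) ?a0 ?b0 conjC0.
Qed.

Lemma in_K2Ml a b : in_Kn 2 b -> in_Kn 2 (a * b).
Proof.
move=> b2; have -> : a * b = (a - (eps a)%:A) * b + eps a *: b.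
  by rewrite mulrBl mulr_algl subrK.
apply: in_KnD; last exact: in_KnZ.
by apply: in_K2M; [exact: (eps_center hA)|exact: in_K2_eps].
Qed.

Lemma in_K2Mr a b : in_Kn 2 a -> in_Kn 2 (a * b).
Proof.
move=> a2; have -> : a * b = a * (b - (eps b)%:A) + eps b *: a.
  by rewrite mulrBr mulr_algr subrK.
apply: in_KnD; last exact: in_KnZ.
by apply: in_K2M; [exact: in_K2_eps|exact: (eps_center hA)].
Qed.

Lemma in_K2_prod (I : eqType) (r : seq I) (F : I -> A) (i : I) :
  i \in r -> in_Kn 2 (F i) -> in_Kn 2 (\prod_(j <- r) F j).
Proof.
by case/splitPr=> r1 r2 Fi; rewrite big_cat big_cons; apply/in_K2Ml/in_K2Mr.
Qed.

Lemma in_K2_prodB I (r : seq I) (F : I -> A) : (forall i, eps (F i) = 1) ->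
  in_Kn 2 (\prod_(i <- r) F i - 1 - \sum_(i <- r) (F i - 1)).
Proof.
move=> F1; have e1 x : eps x = 1 -> eps (x - 1) = 0.
  by move=> x1; rewrite (epsB hA) x1 (eps1 hA) subrr.
elim: r => [|i r IH]; first by rewrite !big_nil !subrr; exact: in_Kn0.
rewrite !big_cons; set p := \prod_(j <- r) _ in IH *; set s := \sum_(j <- r) _ in IH *.
have -> : F i * p - 1 - (F i - 1 + s) = (F i - 1) * (p - 1) + (p - 1 - s).
  rewrite mulrBl mul1r mulrBr mulr1 addrA subrK opprD addrA; congr (_ - s).
  by rewrite opprB addrA subrK.
apply: in_KnD => //; apply: in_K2M; apply: e1 => //.
by rewrite /p; elim: r {IH s p} => [|k r IH]; rewrite ?big_nil ?(eps1 hA) // big_cons (epsM hA) F1 IH mulr1.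
Qed.

Lemma eq_on_K2 (L L' : A -> C) :
  (forall c a b, L (c *: a + b) = c * L a + L b) ->
  (forall c a b, L' (c *: a + b) = c * L' a + L' b) ->
  (forall a b, eps a = 0 -> eps b = 0 -> L (star a * b) = L' (star a * b)) ->
  forall a, in_Kn 2 a -> L a = L' a.
Proof.
move=> hL hL' h; apply: in_K2_ind => [|c a b ha hb|a b a0 b0].
- have := hL (-1) 1 1; have := hL' (-1) 1 1; rewrite !scaleN1r !addNr !mulN1r !addNr.
  by move=> -> ->.
- by rewrite hL hL' ha hb.
by rewrite -[a](saK hA) h // (eps_star hA) a0 conjC0.
Qed.

Definition gen_functional (psi : A -> C) : Prop :=
  [/\ forall c a b, psi (c *: a + b) = c * psi a + psi b,
      forall a, psi (star a) = Num.conj (psi a),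
      psi 1 = 0
    & forall b, eps b = 0 -> 0 <= psi (star b * b)].

End PowersOfKernel.

(** * The decomposition of the algebra into K_2 and span {1, d_2, ..., d_N} *)

Section Splitting.
Variables (R : realType) (q : R) (A : algType R[i]) (star : A -> A) (eps : A -> R[i]).
Variables (N : nat) (u : 'I_N -> 'I_N -> A).
Local Notation C := R[i].
Hypotheses (q01 : 0 < q < 1) (hA : star_algebra star eps) (hu : su_generators q star eps u).
Local Notation K2 := (in_Kn eps 2).

Definition diag_gen (j : 'I_N) : A := (2 * 'i)^-1 *: (u j j - star (u j j)).

Definition in_span_1d (a : A) : Prop :=
  exists (c0 : C) (c : 'I_N -> C), a = c0 *: 1 + \sum_(j < N | (0 < j)%N) c j *: diag_gen j.

Definition proj_K2 (a : A) : A := xget 0 [set b | K2 b /\ in_span_1d (a - b)]%classic.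

(** Derivations at the counit vanish on K_2; they serve to prove that d_2, ..., d_N are independent
    modulo K_2. *)
Definition has_derivations := forall t : 'I_N -> C, \sum_i t i = 0 -> exists d : A -> C,
  [/\ forall c a b, d (c *: a + b) = c * d a + d b,
      forall a b, d (a * b) = d a * eps b + eps a * d b
    & forall j k : 'I_N, d (u j k) = (j == k)%:R * t j].
Hypothesis hder : has_derivations.

(** If x t = q t x for a diagonal generator t, then (1 - q) x = q (t - 1) x - x (t - 1). *)
Lemma offdiag_K2 j k : j != k -> K2 (u j k).
Proof.
have [q0 q1] := q_lt1C q01; have p1 : 1 - q%:C != 0 :> C by rewrite subr_eq0 gt_eqF.
move=> jk; have e0 : eps (u j k) = 0 by rewrite (su_eps hu) (negbTE jk).
have xx (l : 'I_N) : eps (u l l - 1) = 0.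
  by rewrite (epsB hA) (su_eps hu) (eps1 hA) eqxx subrr.
suff [l h] : exists l, u j k * u l l = q%:C *: (u l l * u j k).
  have -> : u j k = (1 - q%:C)^-1 *: (q%:C *: ((u l l - 1) * u j k) - u j k * (u l l - 1)).
    rewrite mulrBl mulrBr mul1r mulr1 h [q%:C *: (_ - _)]scalerBr opprB.
    rewrite [X in _ *: X]addrC addrA subrK.
    by rewrite -[X in _ *: (X - _)]scale1r -scalerBl scalerA mulVf // scale1r.
  by apply: in_KnZ; apply: in_KnB; [apply: in_KnZ|]; apply: in_K2M.
move: jk; rewrite -val_eqE neq_ltn => /orP[jk|kj].
  by exists k; exact: (u_column hu).
by exists j; exact: (u_row hu).
Qed.

(** Write v for u_jj: the sum is (v v^* - 1) - (v - 1)(v^* - 1), and v v^* - 1 is a sum of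
    off-diagonal products by unitarity. *)
Lemma diag_star_K2 j : K2 ((u j j - 1) + (star (u j j) - 1)).
Proof.
have eu s : s != j -> K2 (u j s * star (u j s)).
  by move=> sj; apply: (in_K2Mr hA); apply: offdiag_K2; rewrite eq_sym.
have e : u j j * star (u j j) - 1 = - \sum_(s | s != j) u j s * star (u j s).
  have := su_unitary hu j j; rewrite eqxx -[true%:R]/(1 : A) (bigD1 j) //= => <-.
  by rewrite opprD addrA subrr sub0r.
have -> : (u j j - 1) + (star (u j j) - 1) =
   (u j j * star (u j j) - 1) - (u j j - 1) * (star (u j j) - 1).
  rewrite mulrBl mul1r mulrBr mulr1 opprB [LHS]addrC [RHS]addrCA; congr (_ + _).
  by rewrite opprB [RHS]addrC addrA subrK.
apply: in_KnB.
  by rewrite e; apply: in_KnN; apply: in_Kn_sum => s; exact: eu.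
by apply: in_K2M; rewrite (epsB hA) ?(eps_star hA) (su_eps hu) (eps1 hA) eqxx ?conjC1 subrr.
Qed.

(** Modulo K_2, only the identity permutation contributes to D, and a product of elements of counit
    1 is 1 plus the sum of their differences from 1. With D = 1 this expresses u_11 through the
    other diagonal generators, so that d_1 is absent from the span. *)
Lemma trace_K2 : K2 (\sum_j (u j j - 1)).
Proof.
have e1 i : eps (u i i) = 1 by rewrite (su_eps hu) eqxx.
have h1 := in_K2_prodB hA (index_enum 'I_N) e1.
have -> : \sum_j (u j j - 1) = \prod_i u i i - 1 - (\prod_i u i i - 1 - \sum_j (u j j - 1)).
  by rewrite opprB addrC subrK.
apply: in_KnB => //; have := su_det hu; rewrite /qdet (bigD1 1%g) //= inversions1 expr0 scale1r.
rewrite (eq_bigr (fun i => u i i)) => [|i _]; last by rewrite mxE perm1.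
move=> det; rewrite -[X in _ - X]det opprD addrA subrr sub0r; apply: in_KnN; apply: in_Kn_sum => s s1.
have [i si]: exists i, i != s i.
  apply/existsP; rewrite -negb_forall; apply: contra s1 => /forallP h.
  by apply/eqP/permP => i; rewrite perm1; apply/esym/eqP/h.
apply: in_KnZ; apply: (in_K2_prod hA (i := i)); first exact: mem_index_enum.
by rewrite mxE; exact: offdiag_K2.
Qed.

Lemma span_1d_lin c a b : in_span_1d a -> in_span_1d b -> in_span_1d (c *: a + b).
Proof.
move=> [c0 [d ->]] [c0' [d' ->]]; exists (c * c0 + c0'), (fun j => c * d j + d' j).
rewrite scalerDr scalerA addrACA -scalerDl scaler_sumr -big_split; congr (_ + _).
by apply: eq_bigr => j _ /=; rewrite scalerA -scalerDl.
Qed.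

Lemma span_1d_1 : in_span_1d 1.
Proof. by exists 1, (fun=> 0); rewrite big1 ?addr0 ?scale1r // => j _; rewrite scale0r. Qed.

Lemma span_1d_gen (j : 'I_N) : (0 < j)%N -> in_span_1d (diag_gen j).
Proof.
move=> j0; exists 0, (fun i => (i == j)%:R); rewrite scale0r add0r (bigD1 j) //= eqxx scale1r.
by rewrite big1 ?addr0 // => i /andP[_ /negbTE ->]; rewrite scale0r.
Qed.

Lemma span_1d_0 : in_span_1d 0.
Proof. by rewrite -(addNr (1 : A)) -scaleN1r; apply: span_1d_lin; exact: span_1d_1. Qed.

Let Dec a := exists b, K2 b /\ in_span_1d (a - b).

Let Dec_lin c a b : Dec a -> Dec b -> Dec (c *: a + b).
Proof.
move=> [a' [ha sa]] [b' [hb sb]]; exists (c *: a' + b'); split; first exact: in_Kn_lin.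
by rewrite opprD addrACA -scalerBr; exact: span_1d_lin.
Qed.

Let Dec_K2 a : K2 a -> Dec a.
Proof. by exists a; split=> //; rewrite subrr; exact: span_1d_0. Qed.

Let Dec1 : Dec 1.
Proof. by exists 0; split; [exact: in_Kn0|rewrite subr0; exact: span_1d_1]. Qed.

Let DecD a b : Dec a -> Dec b -> Dec (a + b).
Proof. by rewrite -{2}[a]scale1r; exact: Dec_lin. Qed.

Let DecN a : Dec a -> Dec (- a).
Proof.
move=> h; rewrite -[- a]addr0 -scaleN1r; apply: Dec_lin => //; apply: Dec_K2; exact: in_Kn0.
Qed.

(** The hermitian part of u_jj - 1 is in K_2 and its skew part is i d_j. *)
Let Dec_pos (j : 'I_N) : (0 < j)%N -> Dec (u j j - 1).
Proof.
move=> j0; exists (2^-1 *: ((u j j - 1) + (star (u j j) - 1))); split.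
  by apply: in_KnZ; exact: diag_star_K2.
have i0 : 'i%C != 0 :> C by exact: neq0Ci.
have -> : u j j - 1 - 2^-1 *: (u j j - 1 + (star (u j j) - 1)) = 'i *: diag_gen j + 0.
  rewrite addr0 /diag_gen scalerA (_ : 'i * (2 * 'i)^-1 = 2^-1); last first.
    by rewrite invfM mulrCA mulfV ?mulr1.
  have e (x : A) : x = 2^-1 *: (x + x).
    by rewrite -(mulr2n x) -(scaler_nat 2 x) scalerA mulVf ?scale1r // pnatr_eq0.
  rewrite {1}(e (u j j - 1)) -scalerBr; congr (_ *: _).
  by rewrite opprD addrACA subrr add0r opprB addrA subrK.
by apply: span_1d_lin; [exact: span_1d_gen|exact: span_1d_0].
Qed.

Let Dec_gen j k : Dec (u j k).
Proof.
have [<-|jk] := eqVneq j k; last exact/Dec_K2/offdiag_K2.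
rewrite -(subrK 1 (u j j)); apply: DecD => //.
have [j0|] := posnP j; last exact: Dec_pos.
have -> : u j j - 1 = \sum_i (u i i - 1) - \sum_(i | i != j) (u i i - 1).
  by rewrite (bigD1 j) //= addrK.
apply: DecD; first exact/Dec_K2/trace_K2.
apply: DecN; apply: big_ind => [||i ij]; [apply: Dec_K2; exact: in_Kn0|exact: DecD|].
apply: Dec_pos; rewrite lt0n; apply: contra ij => /eqP i0.
by apply/eqP/val_inj; rewrite /= i0 j0.
Qed.

Lemma K2_decomposition a : exists b, K2 b /\ in_span_1d (a - b).
Proof.
elim/(su_ind hu): a => [c a b||j k a IH]; [exact: Dec_lin|exact: Dec1|].
have -> : u j k * a = (u j k - (eps (u j k))%:A) * (a - (eps a)%:A) +
    (eps (u j k) *: a + (eps a *: u j k + (- (eps a * eps (u j k))) *: 1)).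
  rewrite mulrBr mulr_algr mulrBl mulr_algl.
  set x := u j k; set z := x * a; rewrite scalerBr scalerA scaleNr.
  by rewrite [X in _ + X]addrC addrA !subrK.
apply: DecD; first by apply: Dec_K2; apply: in_K2M; exact: (eps_center hA).
apply: Dec_lin => //; apply: Dec_lin; first exact: Dec_gen.
rewrite -[_ *: 1]addr0; apply: Dec_lin => //; apply: Dec_K2; exact: in_Kn0.
Qed.


Lemma K2_span_trivial a : K2 a -> in_span_1d a -> a = 0.
Proof.
move=> a2 [c0 [c e]].
have ed j : eps (diag_gen j) = 0.
  by rewrite /diag_gen (epsZ hA) (epsB hA) (eps_star hA) (su_eps hu) eqxx conjC1 subrr mulr0.
have c00 : c0 = 0.
  have := in_K2_eps hA a2; rewrite e (epsD hA) (epsZ hA) (eps1 hA) mulr1 (eps_sum hA) big1 ?addr0 //.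
  by move=> j _; rewrite (epsZ hA) ed mulr0.
rewrite e c00 scale0r add0r big1 // => m m0; suff -> : c m = 0 by rewrite scale0r.
pose o : 'I_N := Ordinal (leq_ltn_trans (leq0n m) (ltn_ord m)).
have om : o != m by rewrite -val_eqE /= eq_sym -lt0n.
(* The weights of a derivation must add up to 0; the compensating -1 sits at the index 0, for which
   the span contains no d_j. This derivation reads off the coefficient of d_m. *)
pose t i : C := (i == m)%:R - (i == o)%:R.
have [|d [dP dM dg]] := hder (t := t).
  have one (i : 'I_N) : \sum_j (j == i)%:R = 1 :> C.
    by rewrite (bigD1 i) //= eqxx big1 ?addr0 // => j /negbTE ->.
  by rewrite /t sumrB !one subrr.
have d0 : d 0 = 0 by have := dP (-1) 1 1; rewrite scaleN1r mulN1r !addNr.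
have dD x y : d (x + y) = d x + d y by have := dP 1 x y; rewrite scale1r mul1r.
have dZ k x : d (k *: x) = k * d x by have := dP k x 0; rewrite d0 !addr0.
have dB x y : d (x - y) = d x - d y by rewrite dD -(scaleN1r y) dZ mulN1r.
have d1 : d 1 = 0.
  have := dM 1 1; rewrite mulr1 (eps1 hA) mulr1 mul1r => /eqP.
  by rewrite -subr_eq0 opprD addrA subrr sub0r oppr_eq0 => /eqP.
have dK b : K2 b -> d b = 0.
  move: b; apply: in_K2_ind => [//|k x y hx hy|x y x0 y0].
    by rewrite dP hx hy mulr0 addr0.
  by rewrite dM x0 y0 mulr0 mul0r addr0.
have ds j : d (star (u j j)) = - t j.
  apply/eqP; rewrite -addr_eq0; apply/eqP.
  have := dK _ (diag_star_K2 j); rewrite dD !dB d1 !subr0 dg eqxx mul1r addrC => <-.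
  by [].
have dd j : d (diag_gen j) = 'i^-1 * t j.
  rewrite /diag_gen dZ dB ds dg eqxx mul1r opprK -mulr2n -(mulr_natl (t j)) mulrA invfM.
  by congr (_ * _); rewrite mulrAC mulVf ?mul1r // pnatr_eq0.
have := dK _ a2; rewrite e c00 scale0r add0r (big_morph d dD d0) (bigD1 m) //= dZ dd big1 => [|i].
  rewrite addr0 /t eqxx eq_sym (negbTE om) subr0 mulr1 => /eqP.
  by rewrite mulf_eq0 invr_eq0 (negbTE (neq0Ci _)) orbF => /eqP.
move=> /andP[i0 im]; rewrite dZ dd /t (negbTE im) -val_eqE /= (gtn_eqF i0).
by rewrite subrr !mulr0.
Qed.

Lemma proj_K2P a : K2 (proj_K2 a) /\ in_span_1d (a - proj_K2 a).
Proof. by rewrite /proj_K2; case: xgetP => // h; have [b hb] := K2_decomposition a; case: (h b). Qed.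

Lemma proj_K2_uniq a b : K2 b -> in_span_1d (a - b) -> proj_K2 a = b.
Proof.
move=> b2 sb; have [p2 sp] := proj_K2P a.
apply/eqP; rewrite -subr_eq0; apply/eqP/K2_span_trivial; first exact: in_KnB.
have -> : proj_K2 a - b = (-1) *: (a - proj_K2 a) + (a - b).
  by rewrite scaleN1r opprB addrA subrK.
exact: span_1d_lin.
Qed.

Lemma proj_K2_id b : K2 b -> proj_K2 b = b.
Proof. by move=> b2; apply: proj_K2_uniq; rewrite ?subrr //; exact: span_1d_0. Qed.

Lemma proj_K2_lin c a b : proj_K2 (c *: a + b) = c *: proj_K2 a + proj_K2 b.
Proof.
have [a2 sa] := proj_K2P a; have [b2 sb] := proj_K2P b.
apply: proj_K2_uniq; first exact: in_Kn_lin.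
by rewrite opprD addrACA -scalerBr; exact: span_1d_lin.
Qed.

Lemma proj_K2_1 : proj_K2 1 = 0.
Proof. by apply: proj_K2_uniq; [exact: in_Kn0|rewrite subr0; exact: span_1d_1]. Qed.

Lemma star_diag_gen j : star (diag_gen j) = diag_gen j.
Proof.
rewrite /diag_gen (saZ hA) (saB hA) (saK hA) -[u j j - _]opprB scalerN -scaleNr; congr (_ *: _).
by rewrite fmorphV rmorphM /= conjCi conjC_nat mulrN invrN.
Qed.

Lemma span_1d_star a : in_span_1d a -> in_span_1d (star a).
Proof.
move=> [c0 [c ->]]; exists (Num.conj c0), (fun j => Num.conj (c j)).
rewrite (saD hA) (saZ hA) (sa1 hA) (big_morph star (saD hA) (sa0 hA)); congr (_ + _).
by apply: eq_bigr => j _; rewrite (saZ hA) star_diag_gen.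
Qed.

Lemma proj_K2_star a : proj_K2 (star a) = star (proj_K2 a).
Proof.
have [a2 sa] := proj_K2P a; apply: proj_K2_uniq; first exact: (in_K2_star hA).
by rewrite -(saB hA); exact: span_1d_star.
Qed.

Lemma proj_K2_functional_ext (L L' : A -> C) :
  (forall c a b, L (c *: a + b) = c * L a + L b) ->
  (forall c a b, L' (c *: a + b) = c * L' a + L' b) ->
  (forall a, L (proj_K2 a) = L a) -> (forall a, L' (proj_K2 a) = L' a) ->
  (forall a b, eps a = 0 -> eps b = 0 -> L (star a * b) = L' (star a * b)) ->
  L =1 L'.
Proof.
move=> hL hL' LP LP' h a; rewrite -LP -LP'; apply: (eq_on_K2 hA hL hL' h).
by have [] := proj_K2P a.
Qed.

End Splitting.

Section PureCocycle.
Variables (R : realType) (q : R) (A : algType R[i]) (star : A -> A) (eps : A -> R[i]).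
Variables (n : nat) (u : 'I_n.+1 -> 'I_n.+1 -> A).
Local Notation C := R[i].
Hypotheses (q01 : 0 < q < 1) (hA : star_algebra star eps) (hu : su_generators q star eps u).
Hypothesis hder : has_derivations eps u.
Variables (H : hilbertSpace R) (rho : A -> H -> H) (eta : A -> H).
Local Notation D := (hdot H).
Let hD := hdot_psd H.
Hypotheses (hrho : star_rep star rho) (heta : rep_cocycle eps rho eta).
Local Notation t := (u ord_max ord_max).
Hypothesis pure : forall b, null D (fun k => cesaro (rho t) k (eta b)).
Local Notation K2 := (in_Kn eps 2).
Local Notation P := (proj_K2 star eps u).

Theorem pure_functional : exists psi : A -> C,
  [/\ gen_functional star eps psi, forall a, psi (P a) = psi a
    & forall a b, eps a = 0 -> eps b = 0 -> psi (star a * b) = D (eta b) (eta a)].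
Proof.
pose v k := - eta (ces t k).
(* The vector functional of v_k, corrected to vanish at 1; its cocycle is the coboundary b |-> (rho
   b - eps b) v_k. *)
pose phi k a := D (rho a (v k)) (v k) - eps a * D (v k) (v k).
have phiP k c a b : phi k (c *: a + b) = c * phi k a + phi k b.
  rewrite /phi (repP hrho) (psdP hD) (epsP hA); ring.
have phi_star k a : phi k (star a) = Num.conj (phi k a).
  rewrite /phi (rep_adj hrho) (psdC hD) rmorphB rmorphM /= (eps_star hA).
  by rewrite -(psdC hD (v k) (v k)).
have lim2 a b : eps a = 0 -> eps b = 0 ->
    cvg_to (fun k => phi k (star a * b)) (D (eta b) (eta a)).
  move=> a0 b0; have ap := coboundary_approximation q01 hA hu hrho heta pure.
  apply: cvg_ext (cvg_form hD (ap b b0) (ap a a0)) => k.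
  by rewrite /phi (epsM hA) b0 mulr0 mul0r subr0 (repM hrho) (rep_adj hrho).
have limK a : K2 a -> exists l, cvg_to (phi^~ a) l.
  move: a; apply: in_K2_ind => [|c a b [la ha] [lb hb]|a b a0 b0].
  - exists 0; apply: cvg_ext (cvg_cst 0) => k.
    by rewrite /phi (rep_0l hrho) (psd0l hD) (eps0 hA) mul0r subrr.
  - by exists (c * la + lb); apply: cvg_ext (cvg_lin c ha hb) => k; rewrite phiP.
  exists (D (eta b) (eta (star a))); rewrite -{1}[a](saK hA); apply: lim2 => //.
  by rewrite (eps_star hA) a0 conjC0.
(* The limits exist on K_2, so P is applied first. Since P commutes with the involution, psi is
   hermitian. *)
have /choice[psi hpsi] a : exists l, cvg_to (fun k => phi k (P a)) l.
  by apply: limK; have [] := proj_K2P q01 hA hu a.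
have psiP c a b : psi (c *: a + b) = c * psi a + psi b.
  apply: (cvg_uniq (hpsi _)); apply: cvg_ext (cvg_lin c (hpsi a) (hpsi b)) => k.
  by rewrite (proj_K2_lin q01 hA hu hder) phiP.
have psiM a b : eps a = 0 -> eps b = 0 -> psi (star a * b) = D (eta b) (eta a).
  move=> a0 b0; apply: (cvg_uniq (hpsi _)); apply: cvg_ext (lim2 a b a0 b0) => k.
  rewrite (proj_K2_id q01 hA hu hder) //; apply: in_K2M => //.
  by rewrite (eps_star hA) a0 conjC0.
have psiPP a : psi (P a) = psi a.
  apply: (cvg_uniq (hpsi _)); apply: cvg_ext (hpsi a) => k.
  by rewrite (proj_K2_id q01 hA hu hder (b := P a)) //; have [] := proj_K2P q01 hA hu a.
exists psi; split=> //; split=> // [a||b b0].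
- apply: (cvg_uniq (hpsi _)); apply: cvg_ext (cvg_conj (hpsi a)) => k.
  by rewrite (proj_K2_star q01 hA hu hder) phi_star.
- have := psiP (-1) 1 1; rewrite -(psiPP 1) (proj_K2_1 q01 hA hu hder).
  by rewrite scaleN1r addNr mulN1r addNr.
by rewrite psiM //; exact: psd_ge0.
Qed.

End PureCocycle.

(** * Hilbert space completion and the GNS construction *)

Section ComplexLimits.
Variable R : realType.
Local Notation C := R[i].

Lemma real_complete (x : nat -> R) :
  (forall e, 0 < e -> exists m, forall k l, (m <= k)%N -> (m <= l)%N -> `|x k - x l| < e) ->
  exists l, forall e, 0 < e -> exists m, forall k, (m <= k)%N -> `|x k - l| <= e.
Proof.
(* The limit is the supremum of the numbers that are eventually lower bounds. *)
move=> hx; pose S := [set y | exists m, forall k, (m <= k)%N -> y <= x k]%classic.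
have [m1 h1] := hx 1 ltr01.
have S0 : S (x m1 - 1).
  by exists m1 => k mk; have := h1 _ _ (leqnn _) mk; rewrite ltr_norml => /andP[_]; lra.
have ub e m : 0 < e -> (forall k l, (m <= k)%N -> (m <= l)%N -> `|x k - x l| < e) ->
    ubound S (x m + e).
  move=> e0 hm y [m' hm']; have := hm' _ (leq_maxr m m').
  by have := hm _ _ (leq_maxl m m') (leqnn m); rewrite ltr_norml => /andP[_]; lra.
have hS : has_sup S by split; [exists (x m1 - 1)|exists (x m1 + 1); exact: ub].
exists (sup S) => e e0; have e2 : 0 < e / 2 by rewrite divr_gt0.
have [m hm] := hx _ e2; exists m => k mk.
have l1 : sup S <= x m + e / 2 by apply: ge_sup; [exists (x m1 - 1)|exact: ub].
have l2 : x m - e / 2 <= sup S.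
  apply: (ub_le_sup hS.2); exists m => l ml.
  by have := hm _ _ (leqnn _) ml; rewrite ltr_norml => /andP[_]; lra.
by have := hm _ _ mk (leqnn m); rewrite ltr_norml ler_norml => /andP[]; lra.
Qed.

Lemma complex_complete (z : nat -> C) :
  (forall e : C, 0 < e -> exists m, forall k l, (m <= k)%N -> (m <= l)%N -> `|z k - z l| ^+ 2 < e) ->
  exists l, cvg_to z l.
Proof.
move=> hz.
have part (f : C -> R) : (forall x y, f (x - y) = f x - f y) ->
    (forall x, `|f x|%:C <= `|x|) -> exists l, cvg_to (fun k => (f (z k))%:C) l%:C.
  move=> fB fn; have [|l hl] := @real_complete (f \o z).
    move=> e e0; have [|m hm] := hz (e%:C ^+ 2); first by rewrite exprn_gt0 // ltcR.
    exists m => k l mk ml /=; rewrite -fB -ltcR; apply: le_lt_trans (fn _) _.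
    by have := hm _ _ mk ml; rewrite ltr_pXn2r // ?nnegrE // ltW // ltcR.
  exists l => _ /posC_real[e e0 ->]; have e2 : 0 < e / 2 by rewrite divr_gt0.
  have [m hm] := hl _ e2; exists m => k /hm /= h.
  rewrite -rmorphB /= normc_def /= expr0n addr0 sqrtr_sqr ltcR; apply: le_lt_trans h _; lra.
have [||a ha] := part (@complex.Re R); [by move=> [? ?] [? ?]|exact: normc_ge_Re|].
have [||b hb] := part (@complex.Im R); [by move=> [? ?] [? ?]| |].
  move=> x; have := normc_ge_Re (x * 'i); rewrite ReiNIm normrN normrM.
  by rewrite normCi mulr1.
by exists ('i * b%:C + a%:C); apply: cvg_ext (cvg_lin 'i hb ha) => k; rewrite addrC -complexE.
Qed.

Lemma cvg_le (z : nat -> C) l M m : (forall k, (m <= k)%N -> z k <= M) -> cvg_to z l -> l <= M.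
Proof.
move=> hz zl; rewrite -subr_ge0; apply: (@cvg_ge0 _ (fun k => M - z (k + m)%N)) => [k|].
  by rewrite subr_ge0 hz // leq_addl.
move=> e e0; have [m' hm'] := zl e e0; exists m' => k mk.
by rewrite opprB addrC addrA subrK distrC; apply: hm'; apply: leq_trans mk (leq_addr _ _).
Qed.

End ComplexLimits.

Section Completion.
Variables (R : realType) (V : lmodType R[i]) (B : V -> V -> R[i]).
Local Notation C := R[i].
Hypothesis hB : psd_form B.

Definition cauchy (v : nat -> V) := forall e : C, 0 < e ->
  exists m, forall k l, (m <= k)%N -> (m <= l)%N -> B (v k - v l) (v k - v l) < e.

Lemma cauchy_lin c v w : cauchy v -> cauchy w -> cauchy (fun k => c *: v k + w k).
Proof.
move=> hv hw e e0; have c0 : 0 < 4 * (`|c| ^+ 2 + 1) :> C.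
  by rewrite mulr_gt0 // ltr_wpDl // exprn_ge0.
have [m hm] := hv _ (divr_gt0 e0 c0).
have [|m' hm'] := hw (e / 4); first by rewrite divr_gt0.
exists (maxn m m') => k l; rewrite !geq_max => /andP[mk mk'] /andP[ml ml'].
rewrite opprD addrACA -scalerBr; apply: le_lt_trans (psdD_le hB _ _) _.
have := hm _ _ mk ml; have := hm' _ _ mk' ml'; rewrite (psdZZ hB).
move: (psd_ge0 hB (v k - v l)) (exprn_ge0 2 (normr_ge0 c)).
set x := B (v k - v l) _; set y := B _ _; set d := `|c| ^+ 2 => x0 d0 y1 x1.
rewrite [ltRHS](_ : e = 2 * (e / 4 + e / 4)); last by field.
rewrite ltr_pM2l //; apply: ler_ltD => //; move: x1; rewrite ltr_pdivlMr // => /ltW.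
rewrite ler_pdivlMr // => h; apply: le_trans h.
have -> : x * (4 * (d + 1)) = d * x * 4 + x * 4 by ring.
by rewrite lerDl mulr_ge0.
Qed.

Lemma cauchy_cst x : cauchy (fun=> x).
Proof. by move=> e e0; exists 0%N => k l _ _; rewrite subrr (psd0l hB). Qed.

Lemma cauchy_bounded v : cauchy v -> exists m (M : C), 0 < M /\ forall k, (m <= k)%N -> B (v k) (v k) <= M.
Proof.
move=> hv; have [m hm] := hv 1 ltr01; exists m, (2 * (1 + B (v m) (v m))).
have p := psd_ge0 hB (v m).
split; first by rewrite mulr_gt0 // ltr_wpDr.
move=> k mk; rewrite -{1 2}(subrK (v m) (v k)); apply: le_trans (psdD_le hB _ _) _.
by rewrite ler_pM2l // lerD2r ltW // hm.
Qed.

Lemma cauchy_pairing v w : cauchy v -> cauchy w -> exists l, cvg_to (fun k => B (v k) (w k)) l.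
Proof.
move=> hv hw; apply: complex_complete => e e0.
have [m1 [M1 [M10 h1]]] := cauchy_bounded hv; have [m2 [M2 [M20 h2]]] := cauchy_bounded hw.
have c1 : 0 < 4 * M1 by rewrite mulr_gt0.
have c2 : 0 < 4 * M2 by rewrite mulr_gt0.
have [m3 h3] := hv _ (divr_gt0 e0 c2); have [m4 h4] := hw _ (divr_gt0 e0 c1).
exists (maxn (maxn m1 m2) (maxn m3 m4)) => k l.
rewrite !geq_max => /andP[/andP[k1 k2] /andP[k3 k4]] /andP[/andP[l1 l2] /andP[l3 l4]].
have -> : B (v k) (w k) - B (v l) (w l) = B (v k - v l) (w k) + B (v l) (w k - w l).
  by rewrite !(psdE hB); ring.
set x := B (v k - v l) _; set y := B (v l) _.
have hx : `|x| ^+ 2 < e / 4.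
  apply: le_lt_trans (psd_CS hB _ _) _.
  apply: le_lt_trans (ler_wpM2l (psd_ge0 hB _) (h2 k k2)) _.
  rewrite -ltr_pdivlMr // -mulrA -invfM; exact: h3.
have hy : `|y| ^+ 2 < e / 4.
  apply: le_lt_trans (psd_CS hB _ _) _.
  apply: le_lt_trans (ler_wpM2r (psd_ge0 hB _) (h1 l l1)) _.
  rewrite mulrC -ltr_pdivlMr // -mulrA -invfM; exact: h4.
have a0 := normr_ge0 x; have b0 := normr_ge0 y.
have ab : `|x + y| ^+ 2 <= (`|x| + `|y|) ^+ 2.
  by rewrite ler_pXn2r ?nnegrE ?normr_ge0 ?addr_ge0 //; exact: ler_normD.
apply: le_lt_trans ab _.
have h : 0 <= (`|x| - `|y|) ^+ 2 by rewrite real_exprn_even_ge0 // realB // ger0_real.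
have -> : (`|x| + `|y|) ^+ 2 = 2 * (`|x| ^+ 2 + `|y| ^+ 2) - (`|x| - `|y|) ^+ 2 by ring.
apply: le_lt_trans (_ : _ <= 2 * (`|x| ^+ 2 + `|y| ^+ 2)) _; first by rewrite lerBlDr lerDl.
by rewrite [ltRHS](_ : e = 2 * (e / 4 + e / 4)); [rewrite ltr_pM2l // ltrD|field].
Qed.

(* A point of the completion is encoded as the functional b |-> lim B(v_k, b) of a
   Cauchy sequence v. *)
Definition represents (v : nat -> V) (f : V -> C) :=
  cauchy v /\ forall b, cvg_to (fun k => B (v k) b) (f b).

Lemma represents_lin c v w f g : represents v f -> represents w g ->
  represents (fun k => c *: v k + w k) (fun b => c * f b + g b).
Proof.
move=> [hv vf] [hw wg]; split; first exact: cauchy_lin.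
by move=> b; apply: cvg_ext (cvg_lin c (vf b) (wg b)) => k; rewrite (psdP hB).
Qed.

Lemma represents_cst x : represents (fun=> x) (B x).
Proof. by split=> [|b]; [exact: cauchy_cst|exact: cvg_cst]. Qed.

Lemma represents_exists v : cauchy v -> exists f, represents v f.
Proof.
move=> hv; have /choice[f hf] b : exists l, cvg_to (fun k => B (v k) b) l.
  exact: (cauchy_pairing hv (cauchy_cst b)).
by exists f.
Qed.

(** The limit of B(v_k, w_k) depends on v only through f. By symmetry it depends on w only through
    its functional, so the inner product of the completion is well defined. *)
Lemma represents_pairing v w f l : represents v f -> cauchy w ->
  cvg_to (fun k => B (v k) (w k)) l -> cvg_to (fun k => f (w k)) l.
Proof.
move=> [hv vf] hw vwl e e0; have e3 : 0 < e / 3 by rewrite divr_gt0.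
have [m1 [M [M0 h1]]] := cauchy_bounded hw.
have [m2 h2] := hv _ (divr_gt0 (exprn_gt0 2 e3) M0).
have [m3 h3] := vwl _ e3.
exists (maxn m1 (maxn m2 m3)) => k; rewrite !geq_max => /andP[k1 /andP[k2 k3]].
have [m4 h4] := vf (w k) _ e3; pose j := maxn m2 m4.
have -> : f (w k) - l = - (B (v j) (w k) - f (w k)) + B (v j - v k) (w k) + (B (v k) (w k) - l).
  by rewrite !(psdE hB); ring.
have n1 : `|B (v j - v k) (w k)| < e / 3.
  have h : `|B (v j - v k) (w k)| ^+ 2 < (e / 3) ^+ 2.
    apply: le_lt_trans (psd_CS hB _ _) _.
    apply: le_lt_trans (ler_wpM2l (psd_ge0 hB _) (h1 k k1)) _.
    by rewrite -ltr_pdivlMr //; apply: h2 => //; exact: leq_maxl.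
  by move: h; rewrite ltr_pXn2r // ?nnegrE // ltW.
apply: le_lt_trans (ler_normD _ _) _.
apply: le_lt_trans (lerD (ler_normD _ _) (lexx _)) _; rewrite normrN.
rewrite [ltRHS](_ : e = e / 3 + e / 3 + e / 3); last by field.
by apply: ltrD; [apply: ltrD => //; apply: h4; exact: leq_maxr|exact: h3].
Qed.

Lemma represents_uniq v w v' w' f g l l' :
  represents v f -> represents w g -> represents v' f -> represents w' g ->
  cvg_to (fun k => B (v k) (w k)) l -> cvg_to (fun k => B (v' k) (w' k)) l' -> l = l'.
Proof.
move=> vf wg vf' wg' hl hl'.
have [l2 h2] := cauchy_pairing vf'.1 wg.1.
have -> : l = l2.
  by apply: cvg_uniq (represents_pairing vf wg.1 hl) (represents_pairing vf' wg.1 h2).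
have sw x y z : cvg_to (fun k => B (x k) (y k)) z -> cvg_to (fun k => B (y k) (x k)) (Num.conj z).
  by move=> h; apply: cvg_ext (cvg_conj h) => k; rewrite -(psdC hB).
apply: (can_inj conjCK); apply: cvg_uniq (represents_pairing wg vf'.1 (sw _ _ _ h2)) _.
exact: (represents_pairing wg' vf'.1 (sw _ _ _ hl')).
Qed.

End Completion.

(** The proof of [psd_form B] is an argument so that the type [completion] carries it and its
    algebraic structures can refer to it. *)
Definition completable (R : realType) (V : lmodType R[i]) (B : V -> V -> R[i])
  of psd_form B : {pred V -> R[i]} := fun f => `[< exists v, represents B v f >].

Section CompletionSpace.
Variables (R : realType) (V : lmodType R[i]) (B : V -> V -> R[i]) (hB : psd_form B).
Local Notation C := R[i].

Record completion := MkCompletion { cval :> V -> C; _ : cval \in completable hB }.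
HB.instance Definition _ := [isSub for cval].
HB.instance Definition _ := [Choice of completion by <:].

Fact completion_lin_subproof c (f g : completion) :
  (fun b => c * f b + g b) \in completable hB.
Proof.
case: f g => f /= /asboolP[v vf] [g /= /asboolP[w wg]]; apply/asboolP.
by exists (fun k => c *: v k + w k); exact: represents_lin.
Qed.

Fact completable_cst x : B x \in completable hB.
Proof. by apply/asboolP; exists (fun=> x); exact: represents_cst. Qed.

Definition completion_embed x : completion := MkCompletion (completable_cst x).

(** Sum, opposite and scalar multiple are all obtained from c f + g, so that closure is proved
    once. *)
Let lin c f g := MkCompletion (completion_lin_subproof c f g).
Let zero := completion_embed 0.

Let zeroE b : zero b = 0. Proof. exact: psd0l. Qed.

Let ext (f g : completion) : (forall b, f b = g b) -> f = g.
Proof. by move=> h; apply: val_inj; exact/funext. Qed.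

Fact completion_addA : associative (lin 1).
Proof. by move=> f g h; apply: ext => b /=; rewrite !mul1r addrA. Qed.

Fact completion_addC : commutative (lin 1).
Proof. by move=> f g; apply: ext => b /=; rewrite !mul1r addrC. Qed.

Fact completion_add0 : left_id zero (lin 1).
Proof. by move=> f; apply: ext => b /=; rewrite mul1r [B 0 b](zeroE b) add0r. Qed.

Fact completion_addN : left_inverse zero (fun f => lin (-1) f zero) (lin 1).
Proof. by move=> f; apply: ext => b /=; rewrite mul1r mulN1r [B 0 b](zeroE b) addr0 addNr. Qed.

HB.instance Definition _ := GRing.isZmodule.Build completion
  completion_addA completion_addC completion_add0 completion_addN.

Let scale c f := lin c f zero.

Let addE (f g : completion) b : (f + g) b = f b + g b.
Proof. by rewrite -[f b]mul1r. Qed.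

Let scaleE c f b : scale c f b = c * f b.
Proof. by rewrite /= [B 0 b](zeroE b) addr0. Qed.

Fact completion_scaleA c d f : scale c (scale d f) = scale (c * d) f.
Proof. by apply: ext => b; rewrite !scaleE mulrA. Qed.

Fact completion_scale1 : left_id 1 scale.
Proof. by move=> f; apply: ext => b; rewrite scaleE mul1r. Qed.

Fact completion_scaleDr : right_distributive scale +%R.
Proof. by move=> c f g; apply: ext => b; rewrite addE !scaleE addE mulrDr. Qed.

Fact completion_scaleDl f : {morph scale^~ f : c d / c + d}.
Proof. by move=> c d; apply: ext => b; rewrite addE !scaleE mulrDl. Qed.

HB.instance Definition _ := GRing.Zmodule_isLmodule.Build C completion
  completion_scaleA completion_scale1 completion_scaleDr completion_scaleDl.

Lemma cval_lin c (f g : completion) : cval (c *: f + g) = fun b => c * f b + g b.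
Proof. by apply/funext => b; rewrite addE scaleE. Qed.

Lemma completion_repr (f : completion) : exists v, represents B v f.
Proof. by case: f => f /= /asboolP. Qed.

Let rv f := sval (cid (completion_repr f)).
Let rvP f : represents B (rv f) f. Proof. by rewrite /rv; case: cid. Qed.

Lemma completion_pairing f g : exists l, cvg_to (fun k => B (rv f k) (rv g k)) l.
Proof. exact: (cauchy_pairing hB (rvP f).1 (rvP g).1). Qed.

Definition completion_dot (f g : completion) : C := sval (cid (completion_pairing f g)).

Lemma completion_dotP v w (f g : completion) : represents B v f -> represents B w g ->
  cvg_to (fun k => B (v k) (w k)) (completion_dot f g).
Proof.
move=> vf wg; have [l hl] := cauchy_pairing hB vf.1 wg.1.
suff -> : completion_dot f g = l by [].
exact: (represents_uniq hB (rvP f) (rvP g) vf wg (svalP (cid (completion_pairing f g))) hl).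
Qed.

Lemma completion_dot_psd : psd_form completion_dot.
Proof.
split=> [c f g h|f g|f].
- apply: (cvg_uniq (completion_dotP (v := fun k => c *: rv f k + rv g k) _ (rvP h))).
    by rewrite cval_lin; exact: represents_lin.
  have := cvg_lin c (completion_dotP (rvP f) (rvP h)) (completion_dotP (rvP g) (rvP h)).
  by apply: cvg_ext => k; rewrite (psdP hB).
- apply: (cvg_uniq (completion_dotP (rvP g) (rvP f))).
  by apply: cvg_ext (cvg_conj (completion_dotP (rvP f) (rvP g))) => k; rewrite -(psdC hB).
by apply: cvg_ge0 (completion_dotP (rvP f) (rvP f)) => k; exact: (psd_ge0 hB).
Qed.
Let hD := completion_dot_psd.

Lemma completion_dot_eq0 f : completion_dot f f = 0 -> f = 0.
Proof.
move=> f0; have nf : null B (rv f).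
  move=> e e0; have := completion_dotP (rvP f) (rvP f); rewrite f0 => /(_ e e0)[m hm].
  by exists m => k /hm; rewrite subr0 ger0_norm // (psd_ge0 hB).
apply: ext => b; rewrite [RHS](zeroE b).
exact: (cvg_uniq ((rvP f).2 b) (null_pairing b hB nf)).
Qed.

HB.instance Definition _ := bilinear_isBilinear.Build C completion completion C
  ( *%R : GRing.Scale.law C C) (Num.conj \; *%R : GRing.Scale.law C C) completion_dot
  ((fun g c f h => psdP hD c f h g),
   (fun g c f h => etrans (psdDr hD _ _ _) (congr1 (fun x => x + completion_dot g h) (psdZr hD _ _ _)))).
HB.instance Definition _ := isHermitianSesquilinear.Build C completion false Num.conj
  completion_dot (fun f g => etrans (psdC hD g f) (esym (mul1r _))).

Fact completion_dot_gt0 (f : completion) : f != 0 -> 0 < completion_dot f f.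
Proof.
move=> f0; rewrite lt_def (psd_ge0 hD) andbT; apply: contra f0 => /eqP h.
by apply/eqP/completion_dot_eq0.
Qed.
HB.instance Definition _ := isDotProduct.Build C completion completion_dot completion_dot_gt0.

Lemma completion_embed_lin c x y :
  completion_embed (c *: x + y) = c *: completion_embed x + completion_embed y.
Proof.
apply: ext => b; rewrite cval_lin.
exact: (psdP hB).
Qed.

Lemma completion_embed_dot x y : completion_dot (completion_embed x) (completion_embed y) = B x y.
Proof.
apply: (cvg_uniq (completion_dotP (f := completion_embed x) (g := completion_embed y)
  (represents_cst hB x) (represents_cst hB y))).
exact: cvg_cst.
Qed.

Lemma null_represents v (f : completion) : represents B v f ->
  null completion_dot (fun k => completion_embed (v k) - f).
Proof.
move=> vf e e0; have e2 : 0 < e / 2 by rewrite divr_gt0.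
have [m hm] := vf.1 _ e2; exists m => l ml.
suff : completion_dot (completion_embed (v l) - f) (completion_embed (v l) - f) <= e / 2.
  move=> h; apply: le_lt_trans h _; rewrite ltr_pdivrMr // ltr_pMr //.
  by rewrite ltr1n.
have hr : represents B (fun k => -1 *: v k + v l) (completion_embed (v l) - f : completion).
  rewrite [_ - f]addrC -(scaleN1r f) cval_lin.
  by apply: represents_lin => //; exact: represents_cst.
apply: (cvg_le (m := m) _ (completion_dotP hr hr)) => k mk.
by rewrite scaleN1r addrC ltW // hm.
Qed.

Lemma completion_dense f : exists v, null completion_dot (fun k => completion_embed (v k) - f).
Proof. by have [v vf] := completion_repr f; exists v; exact: null_represents. Qed.

(** Choose v_n in V within 1 / (n + 1) of f_n in squared norm; then v is Cauchy, and the point it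
    represents is the limit of f. *)
Lemma completion_complete (f : nat -> completion) :
  (forall e : C, 0 < e -> exists m, forall k l, (m <= k)%N -> (m <= l)%N ->
     completion_dot (f k - f l) (f k - f l) < e) ->
  exists x, forall e : C, 0 < e -> exists m, forall k, (m <= k)%N ->
     completion_dot (f k - x) (f k - x) < e.
Proof.
move=> hf; pose E := completion_embed.
have /choice[v hv] n : exists x, completion_dot (f n - E x) (f n - E x) < n.+1%:R^-1.
  have [w hw] := completion_dense (f n).
  have [|m hm] := hw (n.+1%:R^-1); first by rewrite invr_gt0 ltr0Sn.
  by exists (w m); rewrite (psdB_sym hD); exact: hm.
have nfv : null completion_dot (fun n => f n - E (v n)).
  by move=> e /inv_small[m hm]; exists m => k /hm; exact: lt_trans (hv k).
have cv : cauchy B v.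
  (* 10 = 2 (1 + 2 (1 + 1)), from two uses of |x + y|^2 <= 2 (|x|^2 + |y|^2). *)
  move=> e e0; have e6 : 0 < e / 10 by rewrite divr_gt0.
  have [m hm] := hf _ e6; have [m' hm'] := nfv _ e6.
  exists (maxn m m') => k l; rewrite !geq_max => /andP[mk mk'] /andP[ml ml'].
  have -> : B (v k - v l) (v k - v l) = completion_dot (E (v k) - E (v l)) (E (v k) - E (v l)).
    rewrite -completion_embed_dot; congr (completion_dot _ _).
      by rewrite addrC -scaleN1r completion_embed_lin scaleN1r addrC.
    by rewrite addrC -scaleN1r completion_embed_lin scaleN1r addrC.
  have -> : E (v k) - E (v l) = (f k - f l) + (- (f k - E (v k)) + (f l - E (v l))).
    rewrite opprB [X in _ = _ + X]addrC [RHS]addrA [X in _ = X + _]addrA subrK.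
    by rewrite [RHS]addrC addrA subrK.
  apply: le_lt_trans (psdD_le hD _ _) _.
  apply: le_lt_trans (_ : _ <= 2 * (completion_dot (f k - f l) (f k - f l) + 2 *
    (completion_dot (f k - E (v k)) (f k - E (v k)) + completion_dot (f l - E (v l)) (f l - E (v l))))) _.
    rewrite ler_pM2l // lerD2l; apply: le_trans (psdD_le hD _ _) _.
    by rewrite (psdNl hD) (psdNr hD) opprK.
  rewrite [ltRHS](_ : e = 2 * (e / 10 + 2 * (e / 10 + e / 10))); last by field.
  rewrite ltr_pM2l //; apply: ltrD; first exact: hm.
  by rewrite ltr_pM2l //; apply: ltrD; exact: hm'.
have [F hF] := represents_exists hB cv.
have FP : F \in completable hB by apply/asboolP; exists v.
exists (MkCompletion FP : completion); apply: null_ext (nullD hD nfv (null_represents (f := MkCompletion FP) hF)) => n /=.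
by rewrite addrA subrK.
Qed.

Definition completion_space : hilbertSpace R :=
  @HilbertSpace R completion completion_dot completion_complete.

End CompletionSpace.

Theorem hilbert_completion (R : realType) (V : lmodType R[i]) (B : V -> V -> R[i]) :
  psd_form B -> exists (H : hilbertSpace R) (E : V -> H),
    [/\ forall c x y, E (c *: x + y) = c *: E x + E y,
        forall x y, hdot H (E x) (E y) = B x y
      & forall f, exists v, null (hdot H) (fun k => E (v k) - f)].
Proof.
move=> hB; exists (completion_space hB), (@completion_embed R V B hB); split.
- exact: completion_embed_lin.
- exact: completion_embed_dot.
exact: completion_dense.
Qed.

Section Extension.
Variables (R : realType) (V : lmodType R[i]) (B : V -> V -> R[i]).
Variables (H : hilbertSpace R) (E : V -> H).
Local Notation C := R[i].
Local Notation D := (hdot H).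
Let hD := hdot_psd H.
Hypotheses (hB : psd_form B) (Elin : forall c x y, E (c *: x + y) = c *: E x + E y).
Hypothesis Edot : forall x y, D (E x) (E y) = B x y.
Hypothesis Edense : forall f, exists v, null D (fun k => E (v k) - f).

Lemma dense_embedB x y : E (x - y) = E x - E y.
Proof. by rewrite addrC -scaleN1r Elin scaleN1r addrC. Qed.

Lemma null_closed x y z : null D (fun k => x k - y) -> null D (fun k => x k - z) -> y = z.
Proof.
move=> h1 h2; apply/eqP; rewrite -subr_eq0; apply/eqP/hdot_eq0.
exact: (null_uniq hD h1 h2).
Qed.

Lemma null_cauchy (x : nat -> H) y : null D (fun k => x k - y) -> cauchy D x.
Proof.
move=> h e e0; have e4 : 0 < e / 4 by rewrite divr_gt0.
have [m hm] := h _ e4; exists m => k l mk ml.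
have -> : x k - x l = (x k - y) + - (x l - y) by rewrite opprB addrA subrK.
apply: le_lt_trans (psdD_le hD _ _) _; rewrite (psdNl hD) (psdNr hD) opprK.
by rewrite [ltRHS](_ : e = 2 * (e / 4 + e / 4)); [rewrite ltr_pM2l // ltrD // hm|field].
Qed.

Lemma bounded_extension (T : V -> V) (M : C) :
  (forall c x y, T (c *: x + y) = c *: T x + T y) -> 0 <= M ->
  (forall x, B (T x) (T x) <= M * B x x) ->
  exists T' : H -> H, forall v f, null D (fun k => E (v k) - f) ->
    null D (fun k => E (T (v k)) - T' f).
Proof.
move=> Tlin M0 TM; have TB x y : T (x - y) = T x - T y.
  by rewrite addrC -scaleN1r Tlin scaleN1r addrC.
have Tc v : cauchy D (E \o v) -> cauchy D (E \o T \o v).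
  move=> cv e e0; have M1 : 0 < M + 1 by rewrite ltr_wpDl.
  have [m hm] := cv _ (divr_gt0 e0 M1); exists m => k l mk ml /=.
  rewrite -dense_embedB -TB Edot; apply: le_lt_trans (TM _) _.
  apply: le_lt_trans (_ : _ <= (M + 1) * B (v k - v l) (v k - v l)) _.
    by rewrite ler_wpM2r ?(psd_ge0 hB) // lerDl.
  by rewrite mulrC -ltr_pdivlMr // -Edot dense_embedB; exact: hm.
have /choice[T' hT'] f : exists g, forall v, null D (fun k => E (v k) - f) ->
    null D (fun k => E (T (v k)) - g).
  have [v hv] := Edense f; have [g hg] := hcomplete (Tc _ (null_cauchy hv)).
  exists g => w hw; have hwv : null D (fun k => E (T (w k - v k))).
    apply: (null_dom (B := D) hD M0 (x := fun k => E (w k - v k))).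
      by move=> k; rewrite !Edot; exact: TM.
    apply: null_ext (null_lin hD (-1) hv hw) => k.
    by rewrite scaleN1r opprB dense_embedB addrC addrA subrK.
  apply: null_ext (nullD hD hwv hg) => k /=.
  by rewrite TB dense_embedB addrA subrK.
by exists T' => v f; exact: hT'.
Qed.

End Extension.

(** * The GNS construction *)

Section GNS.
Variables (R : realType) (q : R) (A : algType R[i]) (star : A -> A) (eps : A -> R[i]).
Variables (N : nat) (u : 'I_N -> 'I_N -> A) (psi : A -> R[i]).
Local Notation C := R[i].
Hypotheses (hA : star_algebra star eps) (hu : su_generators q star eps u).
Hypothesis hpsi : gen_functional star eps psi.

Let psiP c a b : psi (c *: a + b) = c * psi a + psi b. Proof. by case: hpsi. Qed.
Let psi_star a : psi (star a) = Num.conj (psi a). Proof. by case: hpsi. Qed.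
Let psi_ge0 b : eps b = 0 -> 0 <= psi (star b * b). Proof. by case: hpsi => ? ? ?; exact. Qed.

Lemma functional0 : psi 0 = 0.
Proof. by have := psiP (-1) 1 1; rewrite !scaleN1r !mulN1r !addNr. Qed.

Lemma functionalD a b : psi (a + b) = psi a + psi b.
Proof. by rewrite -[a in LHS]scale1r psiP mul1r. Qed.

Lemma functionalZ c a : psi (c *: a) = c * psi a.
Proof. by rewrite -[c *: a]addr0 psiP functional0 addr0. Qed.

Lemma functionalB a b : psi (a - b) = psi a - psi b.
Proof. by rewrite functionalD -(scaleN1r b) functionalZ mulN1r. Qed.

(** The form psi (b^* a) is positive on the kernel of the counit. Composing with this projection
    onto the kernel gives a semi-inner product on the whole algebra, and no type for the kernel is
    needed. *)
Definition centered a : A := a - (eps a)%:A.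

Lemma centered_lin c a b : centered (c *: a + b) = c *: centered a + centered b.
Proof.
by rewrite /centered (epsP hA) scalerDl opprD addrACA -scalerA scalerBr.
Qed.

Lemma centered_eps a : eps (centered a) = 0. Proof. exact: (eps_center hA). Qed.

Lemma centered_id a : eps a = 0 -> centered a = a.
Proof. by move=> a0; rewrite /centered a0 scale0r subr0. Qed.

Definition functional_form a b : C := psi (star (centered b) * centered a).

Lemma functional_form_psd : psd_form functional_form.
Proof.
rewrite /functional_form; split=> [c x y z|x y|x].
- by rewrite centered_lin mulrDr -scalerAr psiP.
- by rewrite -psi_star (saM hA) (saK hA).
by rewrite psi_ge0 // centered_eps.
Qed.
Let hB := functional_form_psd.

Let L a x := a * centered x.

Let LP a c x y : L a (c *: x + y) = c *: L a x + L a y.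
Proof. by rewrite /L centered_lin mulrDr -scalerAr. Qed.

Let cL a x : centered (L a x) = L a x.
Proof. by rewrite centered_id // (epsM hA) centered_eps mulr0. Qed.

Let Lform a x y : functional_form (L a x) (L a y) = psi (star (centered y) * (star a * a) * centered x).
Proof. by rewrite /functional_form !cL /L (saM hA) !mulrA. Qed.

Let Lbound a : exists2 M : C, 0 <= M &
  forall x, functional_form (L a x) (L a x) <= M * functional_form x x.
Proof.
elim/(su_ind hu): a => [c a b [M M0 hM] [M' M'0 hM']||j k a [M M0 hM]].
- exists (2 * (`|c| ^+ 2 * M + M')).
    by rewrite mulr_ge0 // addr_ge0 // mulr_ge0 // exprn_ge0.
  move=> x; have -> : L (c *: a + b) x = c *: L a x + L b x by rewrite /L mulrDl scalerAl.
  apply: le_trans (psdD_le hB _ _) _; rewrite -mulrA ler_pM2l // mulrDl; apply: lerD => //.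
  by rewrite (psdZZ hB) -[leRHS]mulrA ler_wpM2l // exprn_ge0.
- by exists 1 => // x; rewrite mul1r Lform (sa1 hA) !mulr1.
exists M => // x; apply: le_trans (hM x).
have e l : functional_form (L (u l k * a) x) (L (u l k * a) x) =
    psi (star (L a x) * (star (u l k) * u l k) * L a x).
  by rewrite Lform /L !(saM hA) !mulrA.
(* By unitarity, the squared norms for the generators of column k add up to that for [a], so each of
   them is at most that. *)
have -> : functional_form (L a x) (L a x) =
    \sum_l functional_form (L (u l k * a) x) (L (u l k * a) x).
  rewrite (eq_bigr _ (fun l _ => e l)) -(big_morph psi functionalD functional0).
  rewrite -mulr_suml -mulr_sumr (su_unitary_star hu) eqxx mulr1.
  by rewrite /functional_form !cL.
by rewrite (bigD1 j) //= lerDl; apply: sumr_ge0 => l _; exact: (psd_ge0 hB).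
Qed.

Theorem gns : exists (H : hilbertSpace R) (rho : A -> H -> H) (eta : A -> H),
  [/\ star_rep star rho, rep_cocycle eps rho eta,
      forall a b, hdot H (eta b) (eta a) =
        psi (star a * b) - psi (star a) * eps b - eps (star a) * psi b
    & forall f, exists v, null (hdot H) (fun k => eta (v k) - f)].
Proof.
have [H [E [Elin Edot Edense]]] := hilbert_completion hB; pose D := hdot H.
have hD := hdot_psd H.
have /choice[rho hrho] a : exists T' : H -> H, forall v f, null D (fun k => E (v k) - f) ->
    null D (fun k => E (L a (v k)) - T' f).
  by have [M M0 hM] := Lbound a; exact: (bounded_extension hB Elin Edot Edense (LP a) M0 hM).
(* The embedding ignores scalars, which lets it serve as the cocycle itself. *)
have Eext x y : centered x = centered y -> E x = E y.
  move=> xy; apply/eqP; rewrite -subr_eq0 -(dense_embedB Elin); apply/eqP/hdot_eq0.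
  have c0 : centered (x - y) = 0.
    by rewrite addrC -scaleN1r centered_lin xy scaleN1r addNr.
  by rewrite Edot /functional_form c0 mulr0 functional0.
have rhoE a x : rho a (E x) = E (L a x).
  have := @hrho a (fun=> x) (E x); rewrite subrr => /(_ (null_cst0 hD)) h.
  apply/esym; apply: (null_closed (x := fun=> E (L a x)) _ h).
  by rewrite subrr; exact: (null_cst0 hD).
have lin2 c (x y : nat -> H) f g : null D (fun k => x k - f) -> null D (fun k => y k - g) ->
    null D (fun k => (c *: x k + y k) - (c *: f + g)).
  move=> hx hy; apply: null_ext (null_lin hD c hx hy) => k.
  by rewrite opprD addrACA -scalerBr.
exists H, rho, E; split=> //; last first.
- move=> a b; rewrite Edot /functional_form /centered (saB hA) (saZ hA) (sa1 hA).
  have [_ _ psi1 _] := hpsi.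
  rewrite mulrBr mulr_algr mulrBl mulr_algl.
  rewrite !(functionalB, functionalZ) psi1 mulr0 subr0 (eps_star hA); ring.
- split=> [c a b|a b]; first exact: Elin.
  rewrite rhoE addrC -Elin; apply: Eext.
  rewrite /L centered_lin [centered (a * centered b)]cL /centered.
  rewrite (epsM hA) /L mulrBr mulr_algr scalerBr scalerA [eps b * _]mulrC.
  by rewrite [RHS]addrC addrA subrK.
split=> [a c x y|c a b x|x|a b x|a x y].
- have [v hv] := Edense x; have [w hw] := Edense y.
  apply: (null_closed (x := fun k => E (L a (c *: v k + w k)))).
    by apply: hrho; apply: null_ext (lin2 c _ _ _ _ hv hw) => k; rewrite Elin.
  by apply: null_ext (lin2 c _ _ _ _ (hrho a _ _ hv) (hrho a _ _ hw)) => k; rewrite LP Elin.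
- have [v hv] := Edense x.
  apply: (null_closed (hrho _ _ _ hv)).
  apply: null_ext (lin2 c _ _ _ _ (hrho a _ _ hv) (hrho b _ _ hv)) => k.
  by rewrite -Elin /L mulrDl scalerAl.
- have [v hv] := Edense x; apply: (null_closed (hrho _ _ _ hv)).
  apply: null_ext hv => k; congr (_ - _); apply: Eext.
  by rewrite cL /L mul1r.
- have [v hv] := Edense x; apply: (null_closed (hrho _ _ _ hv)).
  apply: null_ext (hrho a _ _ (hrho b _ _ hv)) => k; congr (E _ - _).
  by rewrite /L (cL b) mulrA.
have [v hv] := Edense x; have [w hw] := Edense y.
apply: (cvg_uniq (cvg_form hD (hrho (star a) _ _ hv) hw)).
apply: cvg_ext (cvg_form hD hv (hrho a _ _ hw)) => k.
by rewrite !Edot /functional_form !cL /L (saM hA) mulrA.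
Qed.

End GNS.

(** * Pure and completely non-gaussian functionals *)

Section Functionals.
Variables (R : realType) (q : R) (A : algType R[i]) (star : A -> A) (eps : A -> R[i]).
Local Notation C := R[i].
Hypothesis hA : star_algebra star eps.
Local Notation gen := (gen_functional star eps).
Local Notation K2 := (in_Kn eps 2).

Lemma gen_functional_eq psi psi' : psi =1 psi' -> gen psi -> gen psi'.
Proof.
move=> h [h1 h2 h3 h4]; split=> [c a b|a||b b0]; rewrite -?h //.
exact: h4.
Qed.

Lemma gen_functionalD psi psi' : gen psi -> gen psi' -> gen (fun a => psi a + psi' a).
Proof.
move=> [h1 h2 h3 h4] [h1' h2' h3' h4']; split=> [c a b|a||b b0].
- by rewrite h1 h1'; ring.
- by rewrite h2 h2' rmorphD.
- by rewrite h3 h3' addr0.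
by rewrite addr_ge0 // ?h4 ?h4'.
Qed.

Lemma gen_functional0 : gen (fun=> 0).
Proof. by split=> *; rewrite ?mulr0 ?addr0 ?conjC0 ?lexx. Qed.

Lemma gen_functional_sum I (r : seq I) (P : pred I) (F : I -> A -> C) :
  (forall i, P i -> gen (F i)) -> gen (fun a => \sum_(i <- r | P i) F i a).
Proof.
move=> h; elim: r => [|i r IH].
  by apply: gen_functional_eq gen_functional0 => a; rewrite big_nil.
have [Pi|nPi] := boolP (P i).
  by apply: gen_functional_eq (gen_functionalD (h i Pi) IH) => a; rewrite big_cons Pi.
by apply: gen_functional_eq IH => a; rewrite big_cons (negbTE nPi).
Qed.

Section OneFunctional.
Variable psi : A -> C.
Hypothesis hpsi : gen psi.

Lemma functional_CS a b : eps a = 0 -> eps b = 0 ->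
  `|psi (star a * b)| ^+ 2 <= psi (star b * b) * psi (star a * a).
Proof.
move=> a0 b0; have := psd_CS (functional_form_psd hA hpsi) b a.
by rewrite /functional_form (centered_id a0) (centered_id b0).
Qed.

Lemma functional_drift : (forall a, eps a = 0 -> psi (star a * a) = 0) ->
  forall a, K2 a -> psi a = 0.
Proof.
move=> h; apply: (eq_on_K2 hA (L' := fun=> 0)) => [c a b|c a b|a b a0 b0].
- by case: hpsi => ->.
- by rewrite mulr0 addr0.
have := functional_CS a0 b0; rewrite h // mul0r => h0.
by apply/eqP; rewrite -normr_eq0 -sqrf_eq0 eq_le h0 exprn_ge0.
Qed.

End OneFunctional.

Lemma pullback_functional (A' : algType C) (star' : A' -> A') (eps' : A' -> C)
    (s : A -> A') psi' :
  (forall c a b, s (c *: a + b) = c *: s a + s b) -> (forall a b, s (a * b) = s a * s b) ->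
  s 1 = 1 -> (forall a, s (star a) = star' (s a)) -> (forall a, eps' (s a) = eps a) ->
  gen_functional star' eps' psi' -> gen (psi' \o s).
Proof.
move=> sP sM s1 ss se [h1 h2 h3 h4]; split=> [c a b|a||b b0] /=.
- by rewrite sP h1.
- by rewrite ss h2.
- by rewrite s1.
by rewrite sM ss h4 // se.
Qed.

Lemma pushforward_functional (A' : algType C) (star' : A' -> A') (eps' : A' -> C)
    (s : A -> A') psi' :
  (forall c a b, s (c *: a + b) = c *: s a + s b) -> (forall a b, s (a * b) = s a * s b) ->
  s 1 = 1 -> (forall a, s (star a) = star' (s a)) -> (forall a, eps' (s a) = eps a) ->
  (forall a', exists a, s a = a') ->
  gen (psi' \o s) -> gen_functional star' eps' psi'.
Proof.
move=> sP sM s1 ss se surj [h1 h2 h3 h4]; split=> [c a b|a||b].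
- by have [[a0 <-] [b0 <-]] := (surj a, surj b); rewrite -sP; exact: h1.
- by have [a0 <-] := surj a; rewrite -ss; exact: h2.
- by rewrite -s1; exact: h3.
by have [b0 <-] := surj b; rewrite se -ss -sM; exact: h4.
Qed.

Definition gns_triple (H : hilbertSpace R) (rho : A -> H -> H) (eta : A -> H) psi :=
  [/\ star_rep star rho, rep_cocycle eps rho eta,
      forall a b, hdot H (eta b) (eta a) =
        psi (star a * b) - psi (star a) * eps b - eps (star a) * psi b
    & forall f, exists v, null (hdot H) (fun k => eta (v k) - f)].

Lemma gns_dot (H : hilbertSpace R) (rho : A -> H -> H) (eta : A -> H) psi a b :
  gns_triple rho eta psi -> eps a = 0 -> eps b = 0 ->
  hdot H (eta b) (eta a) = psi (star a * b).
Proof.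
by move=> [_ _ h _] a0 b0; rewrite h (eps_star hA) a0 b0 conjC0 mulr0 mul0r !subr0.
Qed.

Definition non_gaussian psi := exists (H : hilbertSpace R) (rho : A -> H -> H) (eta : A -> H),
  gns_triple rho eta psi /\
  forall V : H -> Prop, [/\ V 0, forall c x y, V x -> V y -> V (c *: x + y)
      & forall a x, V x -> V (rho a x)] ->
    (forall a x, eps a = 0 -> V x -> rho a x = 0) -> forall x, V x -> x = 0.

(* Complete non-gaussianity makes eta(K_2) dense, and a gaussian functional does
   not distinguish b from b - c for c in K_2. *)
Lemma non_gaussian_drift psi g : gen psi -> non_gaussian psi -> gen g ->
  (forall a, in_Kn eps 3 a -> g a = 0) ->
  (forall a, eps a = 0 -> g (star a * a) <= psi (star a * a)) ->
  forall a, K2 a -> g a = 0.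
Proof.
move=> hpsi [H [rho [eta [ht cng]]]] hg g3 gpsi; apply: functional_drift => // b b0.
have [hrho heta _ dense] := ht; have hD := hdot_psd H.
have rep0 a y : (forall c, eps c = 0 -> hdot H (eta (star a * c)) y = 0) -> rho a y = 0.
  move=> h; apply: hdot_eq0; have [v hv] := dense (rho a y).
  have e k : hdot H (eta (v k)) (rho a y) = 0.
    have -> : eta (v k) = eta (v k - (eps (v k))%:A).
      by rewrite (cocB heta) (coc_alg hA hrho heta) subr0.
    have c0 := eps_center hA (v k).
    rewrite -(rep_adj hrho) -(cocMK heta (star a) c0); exact: h.
  apply/eqP; rewrite -oppr_eq0; apply/eqP.
  apply: cvg_uniq (cvg_cst _) _; apply: cvg_ext (null_pairing (rho a y) hD hv) => k.
  by rewrite (psdDl hD) e (psdNl hD) add0r.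
pose M x := exists2 c, K2 c & x = eta c.
(* Let y be the component of eta (b) orthogonal to eta (K_2). Then K_1 annihilates y, because eta
   (a^* c) with a, c in K_1 lies in eta (K_2) and is orthogonal to y. *)
have [|y [y0 [m hm lim]]] := @orthogonal_projection _ H M (eta b).
  split; first by exists 0; rewrite ?(coc0 heta) //; exact: in_Kn0.
  move=> c x y [a ha ->] [a' ha' ->]; exists (c *: a + a'); first exact: in_Kn_lin.
  by rewrite (cocP heta).
have yW a : eps a = 0 -> rho a y = 0.
  move=> a0; apply: rep0 => c c0; rewrite (psdC hD) y0 ?conjC0 //.
  by exists (star a * c) => //; apply: in_K2M => //; rewrite (eps_star hA) a0 conjC0.
have y00 : y = 0.
  (* All vectors annihilated by K_1 form an invariant subspace, which is {0} by complete
     non-gaussianity. *)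
  apply: (cng (fun x => forall a, eps a = 0 -> rho a x = 0)) => [|a x a0 hx|]; [|exact: hx|exact: yW].
  split=> [a _|c x z hx hz a a0|a x hx a' a'0].
  - exact: (rep_0r hrho).
  - by rewrite (rep_lin hrho) hx // hz // scaler0 addr0.
  by rewrite -(repM hrho) hx // (epsM hA) a'0 mul0r.
have small e : 0 < e -> g (star b * b) < e.
  move=> e0; have [j hj] := lim e e0; have [c c2 mc] := hm j.
  have := hj j (leqnn j); rewrite y00 subr0 mc -(cocB heta).
  have c0 := in_K2_eps hA c2.
  have bc0 : eps (b - c) = 0 by rewrite (epsB hA) b0 c0 subrr.
  rewrite (gns_dot ht) //; apply: le_lt_trans; apply: le_trans (gpsi _ bc0).
  have K3l x z : eps x = 0 -> K2 z -> g (x * z) = 0 /\ g (z * x) = 0.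
    move=> x0; move: z; apply: in_K2_ind => [|d z z' [h1 h2] [h1' h2']|z z' z0 z'0].
    - by rewrite mulr0 mul0r (functional0 hg).
    - rewrite mulrDr mulrDl -scalerAr -scalerAl !(functionalD hg) !(functionalZ hg).
      by rewrite h1 h2 h1' h2' mulr0 addr0.
    by rewrite mulrA; split; apply: g3; apply: in_K3M.
  have sb0 : eps (star b) = 0 by rewrite (eps_star hA) b0 conjC0.
  rewrite (saB hA) mulrBl mulrBr [star c * _]mulrBr !(functionalB hg).
  have [-> _] := K3l _ _ sb0 c2; have [_ ->] := K3l _ _ b0 (in_K2_star hA c2).
  by have [_ ->] := K3l _ _ c0 (in_K2_star hA c2); rewrite !subr0.
apply: ge0_eps => //; case: hg => _ _ _; exact.
Qed.

End Functionals.

(** * Pure functionals *)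

Section Pure.
Variables (R : realType) (q : R) (A : algType R[i]) (star : A -> A) (eps : A -> R[i]).
Variables (n : nat) (u : 'I_n.+1 -> 'I_n.+1 -> A).
Local Notation C := R[i].
Hypotheses (q01 : 0 < q < 1) (hA : star_algebra star eps) (hu : su_generators q star eps u).
Local Notation gen := (gen_functional star eps).
Local Notation K2 := (in_Kn eps 2).
Local Notation h := (ces (u ord_max ord_max)).

(* In the GNS representation: u_nn has no fixed vector but 0. *)
Definition pure (psi : A -> C) := forall a, eps a = 0 ->
  cvg_to (fun k => psi (star (h k * a) * (h k * a))) 0.

Lemma eps_h k : eps (h k) = 1.
Proof. by apply: (eps_ces hA); rewrite (su_eps hu) eqxx. Qed.

Lemma eps_hM k a : eps a = 0 -> eps (h k * a) = 0.
Proof. by move=> a0; rewrite (epsM hA) a0 mulr0. Qed.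

Lemma pure_null (H : hilbertSpace R) rho (eta : A -> H) psi :
  gns_triple star eps rho eta psi -> pure psi ->
  forall a, null (hdot H) (fun k => rho (h k) (eta a)).
Proof.
move=> ht hp a e e0; have [hrho heta _ _] := ht.
have a0 := eps_center hA a; have [m hm] := hp _ a0 e e0; exists m => k /hm.
have -> : rho (h k) (eta a) = eta (h k * (a - (eps a)%:A)).
  by rewrite (cocMK heta) // (cocB heta) (coc_alg hA hrho heta) subr0.
by rewrite (gns_dot hA ht) ?eps_hM // subr0 ger0_norm // -(gns_dot hA ht) ?eps_hM // (psd_ge0 (hdot_psd H)).
Qed.

Lemma pure_pairing psi a b : gen psi -> pure psi -> eps a = 0 -> eps b = 0 ->
  cvg_to (fun k => psi (star a * (h k * b))) 0.
Proof.
move=> hpsi hp a0 b0; apply: cvg_sq => e e0.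
have g0 c : eps c = 0 -> 0 <= psi (star c * c) by case: hpsi => _ _ _; exact.
have M1 : 0 < psi (star a * a) + 1 by rewrite ltr_wpDl // g0.
have [m hm] := hp _ b0 _ (divr_gt0 e0 M1); exists m => k /hm; rewrite !subr0.
rewrite ger0_norm ?g0 ?eps_hM // ltr_pdivlMr // => lt; apply: le_lt_trans lt.
apply: le_trans (functional_CS hA hpsi a0 (eps_hM k b0)) _.
by rewrite ler_wpM2l ?g0 ?eps_hM // lerDl.
Qed.

(** If K_1 annihilates x, then h_k^* x = x because eps (h_k) = 1. So the product of eta (a) and x
    equals that of h_k eta (a) and x, which tends to 0, and x is orthogonal to a dense set. *)
Lemma pure_non_gaussian psi : gen psi -> pure psi -> non_gaussian star eps psi.
Proof.
move=> hpsi hp; have [H [rho [eta ht]]] := gns hA hu hpsi.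
exists H, rho, eta; split=> // V _ V0 x Vx; have hD := hdot_psd H.
have [hrho heta _ dense] := ht.
have rx a : rho a x = eps a *: x.
  rewrite -{1}(subrK (eps a)%:A a) (rep_Dl hrho) V0 ?(eps_center hA) // add0r.
  by rewrite (rep_Zl hrho) (rep1 hrho).
have ort a : hdot H (eta a) x = 0.
  apply: cvg_uniq (cvg_cst _) _.
  apply: cvg_ext (null_pairing x hD (pure_null ht hp a)) => k.
  by rewrite (rep_adjr hA hrho) rx (eps_star hA) eps_h conjC1 scale1r.
have [v hv] := dense x; apply: hdot_eq0; apply/eqP; rewrite -oppr_eq0; apply/eqP.
apply: cvg_uniq (cvg_cst _) _; apply: cvg_ext (null_pairing x hD hv) => k.
by rewrite (psdDl hD) ort (psdNl hD) add0r.
Qed.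

(* psi' (s (a^* a)) = psi' (s ((h_k a)^* (h_k a))) <= psi ((h_k a)^* (h_k a)), which
   tends to 0. *)
Lemma pure_minimal psi (A' : algType C) (star' : A' -> A') (eps' : A' -> C)
    (s : A -> A') psi' :
  (forall c a b, s (c *: a + b) = c *: s a + s b) -> (forall a b, s (a * b) = s a * s b) ->
  s 1 = 1 -> (forall a, s (star a) = star' (s a)) -> (forall a, eps' (s a) = eps a) ->
  (forall k, s (h k) = 1) ->
  pure psi -> gen_functional star' eps' psi' -> gen (fun a => psi a - psi' (s a)) ->
  forall a, K2 a -> psi' (s a) = 0.
Proof.
move=> sP sM s1 ss se sh hp hpsi' hd.
have hs := pullback_functional sP sM s1 ss se hpsi'.
apply: (functional_drift hA hs) => a a0; apply: ge0_eps => [|e e0].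
  by case: hs => _ _ _; exact.
have [m hm] := hp _ a0 e e0; have := hm m (leqnn m); rewrite subr0.
apply: le_lt_trans; rewrite /= -[leLHS]addr0.
have -> : psi' (s (star a * a)) = psi' (s (star (h m * a) * (h m * a))).
  by rewrite !(sM, ss) sh mul1r.
have := eps_hM m a0; case: hd => _ _ _ /[apply]; rewrite subr_ge0 addr0 => le.
have p : 0 <= psi' (s (star (h m * a) * (h m * a))).
  by case: hs => _ _ _; apply; exact: eps_hM.
by rewrite ger0_norm //; exact: le_trans p le.
Qed.

End Pure.

(** * The descent step *)

Section Restriction.
Variables (R : realType) (q : R).
Local Notation C := R[i].

Record restriction (A A' : algType C) (star : A -> A) (eps : A -> C) (star' : A' -> A')
    (eps' : A' -> C) (n N : nat) (u : 'I_N -> 'I_N -> A) (s : A -> A') : Prop := Restriction {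
  rsP : forall c a b, s (c *: a + b) = c *: s a + s b;
  rsM : forall a b, s (a * b) = s a * s b;
  rs1 : s 1 = 1;
  rs_star : forall a, s (star a) = star' (s a);
  rs_eps : forall a, eps' (s a) = eps a;
  rs_surj : forall a', exists a, s a = a';
  rs_out : forall j k : 'I_N, (n <= j)%N || (n <= k)%N -> s (u j k) = (j == k)%:R;
  rs_ker : forall I : A -> Prop, two_sided_ideal I ->
    (forall j k : 'I_N, (n <= j)%N || (n <= k)%N -> I (u j k - (j == k)%:R)) ->
    forall a, s a = 0 -> I a }.

Section OneRestriction.
Variables (A A' : algType C) (star : A -> A) (eps : A -> C) (star' : A' -> A').
Variables (eps' : A' -> C) (n N : nat) (u : 'I_N -> 'I_N -> A) (s : A -> A').
Hypothesis hs : restriction star eps star' eps' n u s.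

Lemma rs0 : s 0 = 0.
Proof. by have := rsP hs (-1) 1 1; rewrite !scaleN1r !addNr. Qed.

Lemma rsD a b : s (a + b) = s a + s b.
Proof. by have := rsP hs 1 a b; rewrite !scale1r. Qed.

Lemma rsZ c a : s (c *: a) = c *: s a.
Proof. by have := rsP hs c a 0; rewrite rs0 !addr0. Qed.

Lemma rsB a b : s (a - b) = s a - s b.
Proof. by rewrite rsD -(scaleN1r b) rsZ scaleN1r. Qed.

Lemma rs_ces a k : s (ces a k) = ces (s a) k.
Proof.
rewrite /ces rsZ (big_morph s rsD rs0); congr (_ *: _); apply: eq_bigr => i _.
by elim: (i : nat) => [|j IH]; rewrite ?expr0 ?(rs1 hs) // !exprS (rsM hs) IH.
Qed.

Lemma rs_ces1 a k : s a = 1 -> s (ces a k) = 1.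
Proof.
move=> a1; rewrite rs_ces a1 /ces (eq_bigr (fun=> 1)) => [|i _]; last by rewrite expr1n.
by rewrite sumr_const card_ord -(scaler_nat k.+1 (1 : A')) scalerA mulVf ?scale1r // pnatr_eq0.
Qed.

Lemma rs_pullback psi : gen_functional star' eps' psi -> gen_functional star eps (psi \o s).
Proof. exact: (pullback_functional (rsP hs) (rsM hs) (rs1 hs) (rs_star hs) (rs_eps hs)). Qed.

Lemma rs_pushforward psi : gen_functional star eps (psi \o s) -> gen_functional star' eps' psi.
Proof.
exact: (pushforward_functional (rsP hs) (rsM hs) (rs1 hs) (rs_star hs) (rs_eps hs) (rs_surj hs)).
Qed.

Lemma ker_two_sided : two_sided_ideal (fun a => s a = 0).
Proof.
split=> [|c a b ha hb|a b hb|a b ha]; first exact: rs0.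
- by rewrite (rsP hs) ha hb scaler0 addr0.
- by rewrite (rsM hs) hb mulr0.
by rewrite (rsM hs) ha mul0r.
Qed.

End OneRestriction.

Section Factor.
Variables (A A' : algType C) (star : A -> A) (eps : A -> C) (star' : A' -> A').
Variables (eps' : A' -> C) (n N : nat) (u : 'I_N -> 'I_N -> A) (s : A -> A').
Hypotheses (hA : star_algebra star eps) (hs : restriction star eps star' eps' n u s).
Variables (H : hilbertSpace R) (rho : A -> H -> H) (eta : A -> H).
Hypotheses (hrho : star_rep star rho) (heta : rep_cocycle eps rho eta).
Hypothesis trivial : forall j k : 'I_N, (n <= j)%N || (n <= k)%N ->
  (forall x, rho (u j k) x = (j == k)%:R *: x) /\ eta (u j k) = 0.
Hypothesis hu : forall j k, eps (u j k) = (j == k)%:R.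

Lemma factor_ker a : s a = 0 -> (forall x, rho a x = 0) /\ eta a = 0.
Proof.
(* The condition on the counit is what makes I stable under left multiplication: eta (b d) contains
   the term eps d * eta b. *)
pose I a := [/\ forall x, rho a x = 0, eta a = 0 & eps a = 0].
suff h : s a = 0 -> I a by move=> /h[].
have delta j k : (j == k)%:R = ((j == k)%:R : C)%:A :> A by case: eqP; rewrite ?scale1r ?scale0r.
apply: (rs_ker hs (I := I)) => [|j k jk].
  split=> [|c b d [h1 h2 h3] [h1' h2' h3']|b d [h1 h2 h3]|b d [h1 h2 h3]].
  - by split=> [x||]; rewrite ?(rep_0l hrho) ?(coc0 heta) ?(eps0 hA).
  - split=> [x||]; first by rewrite (repP hrho) h1 h1' scaler0 addr0.
      by rewrite (cocP heta) h2 h2' scaler0 addr0.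
    by rewrite (epsP hA) h3 h3' mulr0 addr0.
  - split=> [x||]; first by rewrite (repM hrho) h1 (rep_0r hrho).
      by rewrite (cocM heta) h2 h3 (rep_0r hrho) scale0r addr0.
    by rewrite (epsM hA) h3 mulr0.
  split=> [x||]; first by rewrite (repM hrho) h1.
    by rewrite (cocM heta) h1 h2 scaler0 addr0.
  by rewrite (epsM hA) h3 mul0r.
have [h1 h2] := trivial jk; rewrite delta; split=> [x||].
- by rewrite (rep_Bl hrho) h1 (rep_Zl hrho) (rep1 hrho) subrr.
- by rewrite (cocB heta) h2 (coc_alg hA hrho heta) subrr.
by rewrite (epsB hA) hu (eps_alg hA) subrr.
Qed.

Lemma factor_cong a b : s a = s b -> (forall x, rho a x = rho b x) /\ eta a = eta b.
Proof.
move=> ab; have [|h1 h2] := @factor_ker (a - b); first by rewrite (rsB hs) ab subrr.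
split=> [x|]; apply/eqP; rewrite -subr_eq0; apply/eqP.
  by rewrite -(rep_Bl hrho) h1.
by rewrite -(cocB heta) h2.
Qed.

Lemma factor : exists (rho' : A' -> H -> H) (eta' : A' -> H),
  [/\ star_rep star' rho', rep_cocycle eps' rho' eta',
      forall a x, rho' (s a) x = rho a x & forall a, eta' (s a) = eta a].
Proof.
have /choice[t ht] := rs_surj hs.
have E1 a x : rho (t (s a)) x = rho a x by have [] := @factor_cong (t (s a)) a (ht _).
have E2 a : eta (t (s a)) = eta a by have [] := @factor_cong (t (s a)) a (ht _).
exists (fun a => rho (t a)), (eta \o t); split=> //.
  split=> [a c x y|c a b x|x|a b x|a x y].
  - by rewrite (rep_lin hrho).
  - by rewrite -{1}(ht a) -{1}(ht b) -(rsP hs) E1 (repP hrho).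
  - by rewrite -(rs1 hs) E1 (rep1 hrho).
  - by rewrite -{1}(ht a) -{1}(ht b) -(rsM hs) E1 (repM hrho).
  by rewrite -{1}(ht a) -(rs_star hs) E1 (rep_adj hrho).
split=> [c a b|a b] /=.
  by rewrite -{1}(ht a) -{1}(ht b) -(rsP hs) E2 (cocP heta).
by rewrite -{1}(ht a) -{1 3}(ht b) -(rsM hs) E2 (cocM heta) (rs_eps hs).
Qed.

End Factor.

Section Descent.
Variables (A A' : algType C) (star : A -> A) (eps : A -> C) (star' : A' -> A').
Variables (eps' : A' -> C) (N : nat) (u : 'I_N -> 'I_N -> A) (s : A -> A') (m : 'I_N).
Variable u' : 'I_m.+1 -> 'I_m.+1 -> A'.
Hypotheses (q01 : 0 < q < 1) (hA : star_algebra star eps) (hu : su_generators q star eps u).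
Hypotheses (hA' : star_algebra star' eps') (hu' : su_generators q star' eps' u').
Hypotheses (hder' : has_derivations eps' u') (hs : restriction star eps star' eps' m.+1 u s).
Hypothesis s_max : s (u m m) = u' ord_max ord_max.
Variables (H : hilbertSpace R) (rho : A -> H -> H) (eta : A -> H).
Local Notation D := (hdot H).
Let hD := hdot_psd H.
Hypotheses (hrho : star_rep star rho) (heta : rep_cocycle eps rho eta).
Hypothesis hm : forall (k : 'I_N) x, (m < k)%N -> rho (u k k) x = x.

(** Q commutes with rho, so both Q eta and (1 - Q) eta are cocycles, for rho cut down to the two
    ranges. Their ranges are orthogonal, so the inner products of eta add up: (1 - Q) eta yields
    psi', and Q eta is passed on. *)
Lemma descent_step : exists (rho1 : A -> H -> H) (eta1 : A -> H) (psi' : A' -> C),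
  [/\ star_rep star rho1, rep_cocycle eps rho1 eta1,
      forall (k : 'I_N) x, (m <= k)%N -> rho1 (u k k) x = x,
      [/\ gen_functional star' eps' psi', forall a, psi' (proj_K2 star' eps' u' a) = psi' a
        & pure star' eps' u' psi']
    & forall a b, eps a = 0 -> eps b = 0 ->
        D (eta b) (eta a) = D (eta1 b) (eta1 a) + psi' (s (star a * b))].
Proof.
have [Q [Qlim [Qlin Qadj QQ Qcomm] [Qfix fixQ]]] := rep_ergodic q01 hu hrho hm.
have Q0 : Q 0 = 0 by have := Qlin (-1) 0 0; rewrite scaler0 addr0 scaleN1r addNr.
have QB x y : Q (x - y) = Q x - Q y by rewrite addrC -scaleN1r Qlin scaleN1r addrC.
pose P x := x - Q x.
have Plin c x y : P (c *: x + y) = c *: P x + P y.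
  by rewrite /P Qlin opprD addrACA -scalerBr.
have Padj x y : D (P x) y = D x (P y).
  by rewrite /P !(psdE hD) Qadj.
have QP x : Q (P x) = 0 by rewrite /P QB QQ subrr.
have PP x : P (P x) = P x by rewrite {1}/P QP subr0.
have Pcomm a x : P (rho a x) = rho a (P x) by rewrite /P (rep_Br hrho) Qcomm.
pose rho0 := cut_rep eps rho P; pose eta0 := P \o eta.
have hrho0 : star_rep star rho0 by exact: cut_star_rep.
have heta0 : rep_cocycle eps rho0 eta0 by exact: cut_cocycle.
have rho0E a x : rho0 a (P x) = rho a (P x) by exact: cut_rep_range.
have [q0 q1] := q_lt1C q01; have p1 : 1 - q%:C != 0 :> C by rewrite subr_eq0 gt_eqF.
have eq0 (x : H) : x = q%:C *: x -> x = 0.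
  move=> e; have := scalerBl 1 q%:C x; rewrite scale1r -e subrr => /eqP.
  by rewrite scaler_eq0 (negbTE p1) => /eqP.
have ab (j k : 'I_N) x : (m < j)%N || (m < k)%N -> rho0 (u j k) x = (j == k)%:R *: x.
  move=> jk; rewrite /rho0 /cut_rep (rep_above q01 hu hrho hm _ jk) (su_eps hu).
  by rewrite -scalerDr addrC subrK.
have above (j k : 'I_N) : (m < j)%N || (m < k)%N -> eta0 (u j k) = 0.
  have e j' : eps (u j' j') = 1 by rewrite (su_eps hu) eqxx.
  have [<-|] := eqVneq j k.
    rewrite orbb => mj; apply: (etrans (esym (PP _))).
    rewrite -[P (eta _)]/(eta0 (u j j)); set g := eta0 (u j j).
    (* [eta0] applied to the diagonal relation between u_mm and u_jj. A fixed vector of u_mm is in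
       the range of Q, but g is in the range of P = 1 - Q, so g = 0. *)
    have Tg : rho (u m m) g = g.
      have := u_diagonal hu mj mj => /(congr1 eta0).
      rewrite (cocB heta0) (cocZ heta0) !(cocM heta0) !e !scale1r.
      have mj' : (m == j) = false by rewrite -val_eqE ltn_eqF.
      rewrite (ab j j) ?mj // (ab m j) ?mj ?orbT // eqxx scale1r (su_eps hu) [j == m]eq_sym mj' !scale0r addr0.
      rewrite scaler0 subr0 [RHS]addrC => /addIr gE.
      exact: etrans (esym (rho0E (u m m) (eta (u j j)))) gE.
    by rewrite /P (fixQ _ Tg) subrr.
  (* Off the diagonal, applying [eta0] to u_jk u_kk = q u_kk u_jk, or to its row analogue, leaves x
     = q x for x = eta0 (u_jk). *)
  rewrite -val_eqE neq_ltn => /orP[jk|kj] h; apply: eq0.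
    have mk : (m < k)%N by case/orP: h => // mj; exact: ltn_trans mj jk.
    have njk : (j == k) = false by rewrite -val_eqE ltn_eqF.
    have := u_column hu k jk => /(congr1 eta0).
    rewrite (cocZ heta0) !(cocM heta0) e scale1r !ab ?mk ?orbT // njk scale0r add0r.
    by rewrite eqxx scale1r (su_eps hu) njk scale0r addr0.
  have mj : (m < j)%N by case/orP: h => // mk; exact: ltn_trans mk kj.
  have njk : (j == k) = false by rewrite -val_eqE gtn_eqF.
  have := u_row hu j kj => /(congr1 eta0).
  rewrite (cocZ heta0) !(cocM heta0) e scale1r !ab ?mj ?orbT // njk scale0r add0r.
  by rewrite eqxx scale1r (su_eps hu) njk scale0r addr0.
have triv (j k : 'I_N) : (m.+1 <= j)%N || (m.+1 <= k)%N ->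
    (forall x, rho0 (u j k) x = (j == k)%:R *: x) /\ eta0 (u j k) = 0.
  by move=> jk; split=> [x|]; [exact: ab|exact: above].
have [rho' [eta' [hrho' heta' rhoE etaE]]] := factor hA hs hrho0 heta0 triv (su_eps hu).
have pur a' : null D (fun k => cesaro (rho' (u' ord_max ord_max)) k (eta' a')).
  have [a <-] := rs_surj hs a'; rewrite etaE.
  apply: null_ext (Qlim (eta0 a)) => k.
  rewrite -(rep_ces _ _ _ hrho) -(rep_ces _ _ _ hrho') -s_max -(rs_ces hs) rhoE rho0E.
  by rewrite [Q _]QP subr0.
have [psi' [gpsi' Ppsi' psiE]] := pure_functional q01 hA' hu' hder' hrho' heta' pur.
(* The cut representation is eps off the range of Q, and u_mm fixes that range, so u_mm now acts as
   the identity on the whole space. *)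
exists (cut_rep eps rho Q), (Q \o eta), psi'; split=> //.
- exact: cut_star_rep.
- exact: cut_cocycle.
- move=> k x; rewrite /cut_rep (su_eps hu) eqxx scale1r leq_eqVlt => /predU1P[/val_inj <-|mk].
    by rewrite Qfix addrC subrK.
  by rewrite hm // addrC subrK.
- split=> // a a0 e e0; have [k0 hk] := pur a e e0; exists k0 => k /hk.
  have ha0 : eps' (ces (u' ord_max ord_max) k * a) = 0 by rewrite (epsM hA') a0 mulr0.
  rewrite psiE // subr0 (cocMK heta' _ a0) (rep_ces _ _ _ hrho').
  by rewrite ger0_norm // (psd_ge0 hD).
move=> a b a0 b0; rewrite (rsM hs) (rs_star hs) psiE ?(rs_eps hs) // !etaE /=.
rewrite Qadj QQ (_ : D (eta0 b) (eta0 a) = D (eta b) (P (eta a))); last first.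
  by rewrite /eta0 /= Padj PP.
by rewrite /P (psdDr hD) (psdNr hD) addrC subrK.
Qed.

End Descent.
End Restriction.

(** * Existence and uniqueness of the decomposition *)

Section Tower.
Variables (R : realType) (q : R) (A : nat -> algType R[i]).
Variables (star : forall n, A n -> A n) (eps : forall n, A n -> R[i]).
Variables (u : forall n, 'I_n -> 'I_n -> A n) (s : forall n N, A N -> A n).
Arguments star {n}.
Arguments eps {n}.
Arguments u {n}.
Local Notation C := R[i].
Hypothesis q01 : 0 < q < 1.

Record su_tower : Prop := SuTower {
  tw_alg : forall n, star_algebra (@star n) (@eps n);
  tw_gen : forall n, su_generators q (@star n) (@eps n) (@u n);
  tw_der : forall n, has_derivations (@eps n) (@u n);
  tw_res : forall n N, (n <= N)%N ->
    restriction (@star N) (@eps N) (@star n) (@eps n) n (@u N) (@s n N);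
  tw_max : forall N (i : 'I_N), s i.+1 (u i i) = u ord_max ord_max }.
Hypothesis tw : su_tower.

Let hA n : star_algebra (@star n) (@eps n) := tw_alg tw n.
Let hu n : su_generators q (@star n) (@eps n) (@u n) := tw_gen tw n.
Let hr N (i : 'I_N) := tw_res tw (ltn_ord i).

Local Notation fgen := (gen_functional star eps).
Local Notation P := (proj_K2 star eps u).

Definition is_gaussian n (psi : A n -> C) := fgen psi /\ forall a, in_Kn eps 3 a -> psi a = 0.

Definition is_irreductible n (psi : A n -> C) :=
  [/\ fgen psi, non_gaussian star eps psi
    & forall psi' : A n.-1 -> C, fgen psi' -> fgen (fun a => psi a - psi' (s n.-1 a)) ->
        forall a : A n, in_Kn eps 2 a -> psi' (s n.-1 a) = 0].

Definition component (Q : forall n, (A n -> C) -> Prop) N (i : 'I_N) (f : A N -> C) :=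
  exists psi' : A i.+1 -> C,
    [/\ Q i.+1 psi', forall a, psi' (P a) = psi' a & forall a, f a = psi' (s i.+1 a)].

Definition decomposition (Q : forall n, (A n -> C) -> Prop) N (psi : A N -> C)
    (psis : 'I_N -> A N -> C) :=
  [/\ forall a, psi a = \sum_(i < N) psis i a,
      forall i : 'I_N, i = 0%N :> nat -> is_gaussian (psis i)
    & forall i : 'I_N, (0 < i)%N -> component Q i (psis i)].

(** Purity refers to the last generator, hence the case distinction on the size; components live on
    sizes i + 1. *)
Definition is_pure n (psi : A n -> C) : Prop := fgen psi /\
  match n return (A n -> C) -> Prop with
  | 0 => fun=> True
  | m.+1 => fun psi => pure (@star m.+1) (@eps m.+1) (@u m.+1) psi
  end psi.

Lemma generator1 : u ord0 ord0 = 1 :> A 1.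
Proof.
have := su_det (hu 1); rewrite /qdet (bigD1 1%g) //= inversions1 expr0 scale1r big_ord1 mxE perm1.
rewrite big1 ?addr0 // => t /eqP[]; apply/permP => i.
exact: etrans (ord1 _) (esym (ord1 _)).
Qed.

Lemma pure_decomposition_exists n (psi : A n.+1 -> C) : fgen psi ->
  exists psis, decomposition is_pure psi psis.
Proof.
set N := n.+1 in psi * => hpsi; have [H [rho0 [eta0 ht]]] := gns (hA N) (hu N) hpsi.
have hD := hdot_psd H.
(* After d steps the components with index i >= N - d are split off, and eta is the cocycle of what
   remains. The descent stops at d = N - 1, which leaves the index 0 to the gaussian term. *)
have step d : (d <= n)%N -> exists (rho : A N -> H -> H) eta (psis : 'I_N -> A N -> C),
    [/\ star_rep star rho, rep_cocycle eps rho eta,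
        forall (k : 'I_N) x, (N - d <= k)%N -> rho (u k k) x = x,
        forall i : 'I_N, (N - d <= i)%N -> component is_pure i (psis i)
      & forall a b, eps a = 0 -> eps b = 0 -> psi (star a * b) =
          hdot H (eta b) (eta a) + \sum_(i < N | (N - d <= i)%N) psis i (star a * b)].
  elim: d => [_|d IH dn].
    have noi (i : 'I_N) : (N - 0 <= i)%N = false by rewrite subn0 leqNgt ltn_ord.
    exists rho0, eta0, (fun _ _ => 0); have [h1 h2 _ _] := ht; split=> // [k x|i|a b a0 b0].
    - by rewrite noi.
    - by rewrite noi.
    by rewrite (gns_dot (hA N) ht) // big_pred0 ?addr0.
  have [rho [eta [psis [hrho heta hfix hpsis hsum]]]] := IH (ltnW dn).
  have mN : (N - d.+1 < N)%N by rewrite ltn_subrL.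
  pose m := Ordinal mN; have mE : (N - d)%N = m.+1.
    exact: (esym (subnSK (ltnW dn : (d < N)%N))).
  have hm (k : 'I_N) x : (m < k)%N -> rho (u k k) x = x by move=> mk; apply: hfix; rewrite mE.
  have [rho1 [eta1 [psi' [hrho1 heta1 hfix1 [g1 P1 pu1] hsum1]]]] :=
    descent_step q01 (hA N) (hu N) (hA m.+1) (hu m.+1) (tw_der tw (n := m.+1)) (hr m)
      (tw_max tw m) hrho heta hm.
  exists rho1, eta1, (fun i a => if i == m then psi' (s m.+1 a) else psis i a); split=> //.
    move=> i; rewrite leq_eqVlt => /predU1P[im|mi].
      have -> : i = m by exact/val_inj.
      by rewrite eqxx; exists psi'.
    case: eqP mi => [->|_ mi]; first by rewrite ltnn.
    by apply: hpsis; rewrite mE.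
  move=> a b a0 b0; rewrite hsum // hsum1 // [X in _ = _ + X](bigD1 m) //= eqxx -addrA; congr (_ + (_ + _)).
  apply: eq_big => [i|i]; first by rewrite -val_eqE /= mE ltn_neqAle andbC eq_sym.
  by rewrite mE -val_eqE /= => /gtn_eqF ->.
have [rho [eta [psis [hrho heta hfix hpsis hsum]]]] := step n (leqnn n).
have N1 : (N - n)%N = 1%N by rewrite /N subSnn.
have hfix0 (k : 'I_N) x : ((ord0 : 'I_N) < k)%N -> rho (u k k) x = x.
  by move=> k0; apply: hfix; rewrite N1.
have above (j k : 'I_N) x : (1 <= j)%N || (1 <= k)%N -> rho (u j k) x = (j == k)%:R *: x.
  exact: (rep_above q01 (hu N) hrho hfix0).
(* No descent step treats the index 0. Instead, u_00 - 1 lies in the kernel of s_{1,N}, as D = 1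
   says u_00 = 1 in SU_q(1), and rho annihilates this kernel. *)
have rho00 x : rho (u ord0 ord0) x = x.
  pose I a := forall x, rho a x = 0.
  have hI : two_sided_ideal I.
    split=> [y|c a b ha hb y|a b hb y|a b ha y].
    - exact: (rep_0l hrho).
    - by rewrite (repP hrho) ha hb scaler0 addr0.
    - by rewrite (repM hrho) hb (rep_0r hrho).
    by rewrite (repM hrho) ha.
  have r1 := hr (ord0 : 'I_N).
  have h : I (u ord0 ord0 - 1).
    apply: (rs_ker r1 hI) => [j k jk y|].
      rewrite (rep_Bl hrho) above //; case: (j == k); first by rewrite scale1r (rep1 hrho) subrr.
      by rewrite scale0r (rep_0l hrho) subrr.
    rewrite (rsB r1) (rs1 r1) (tw_max tw (ord0 : 'I_N)).
    by rewrite (_ : ord_max = ord0) ?generator1 ?subrr //; exact: val_inj.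
  by rewrite -[LHS](subrK x) -{2}(rep1 hrho x) -(rep_Bl hrho) h add0r.
have rhoE a x : rho a x = eps a *: x.
  elim/(su_ind (hu N)): a => [c a b ha hb||j k a ha].
  - by rewrite (repP hrho) ha hb scalerA -scalerDl (epsP (hA N)).
  - by rewrite (rep1 hrho) (eps1 (hA N)) scale1r.
  rewrite (repM hrho) (epsM (hA N)) ha -scalerA (su_eps (hu N)).
  have [jk|] := boolP ((1 <= j)%N || (1 <= k)%N); first exact: above.
  rewrite negb_or -!leqNgt !leqn0 => /andP[/eqP j0 /eqP k0].
  have -> : j = ord0 by exact/val_inj. have -> : k = ord0 by exact/val_inj.
  by rewrite rho00 eqxx scale1r.
(* This makes the rest vanish on K_3. *)
have eta2 a : in_Kn eps 2 a -> eta a = 0.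
  move: a; apply: in_K2_ind => [|c a b ha hb|a b a0 b0].
  - exact: (coc0 heta).
  - by rewrite (cocP heta) ha hb scaler0 addr0.
  by rewrite (cocMK heta) // rhoE a0 scale0r.
(* Defined by subtraction, so it receives the drift; it is positive because on products a^* b it is
   given by the inner product of the remaining cocycle. *)
pose psi1 a := psi a - \sum_(i < N | (0 < i)%N) psis i a.
have gsum : fgen (fun a => \sum_(i < N | (0 < i)%N) psis i a).
  apply: gen_functional_sum => // i i0.
  have [|psi' [[g1 _] _ e]] := hpsis i; first by rewrite N1.
  by apply: gen_functional_eq (rs_pullback (hr i) g1) => a; rewrite e.
have psi1E a b : eps a = 0 -> eps b = 0 -> psi1 (star a * b) = hdot H (eta b) (eta a).
  by move=> a0 b0; rewrite /psi1 hsum // N1 addrK.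
have gpsi1 : fgen psi1.
  have [h1 h2 h3 _] := hpsi; have [h1' h2' h3' _] := gsum.
  split=> [c a b|a||b b0]; rewrite ?psi1E ?(psd_ge0 hD) // /psi1.
  - by rewrite h1 h1'; ring.
  - by rewrite h2 h2' rmorphB.
  by rewrite h3 h3' subr0.
exists (fun i a => if i == ord0 then psi1 a else psis i a); split=> [a|i i0|i i0].
- rewrite (bigD1 ord0) //= /psi1 [X in _ = _ + X](_ : _ = \sum_(i < N | (0 < i)%N) psis i a) ?subrK //.
  apply: eq_big => [i|i /negbTE -> //]; by rewrite lt0n -val_eqE.
- have -> : i = ord0 by exact/val_inj.
  rewrite eqxx; split=> //; apply: in_K3_ind => [||a b c a0 b0 c0].
  + exact: (functional0 gpsi1).
  + by move=> c a b ha hb; case: gpsi1 => ->; rewrite ha hb mulr0 addr0.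
  rewrite -mulrA -[a](saK (hA N)) psi1E ?(eps_star (hA N)) ?a0 ?conjC0 //.
    by rewrite eta2 ?(psd0l hD) //; exact: in_K2M.
  by rewrite (epsM (hA N)) b0 mul0r.
by case: eqP i0 => [->//|_ i0]; apply: hpsis; rewrite N1.
Qed.

Lemma component_gen Q N (i : 'I_N) f : (forall n psi, Q n psi -> fgen psi) ->
  component Q i f -> fgen f.
Proof.
by move=> hQ [psi' [/hQ g _ e]]; apply: gen_functional_eq (rs_pullback (hr i) g) => a; rewrite e.
Qed.

Lemma is_pure_gen n psi : @is_pure n psi -> fgen psi. Proof. by case. Qed.

(** In a pure decomposition of psi, the sum G of the middle terms factors through s_N, so
    irreductibility makes it a drift. Gaussian term plus G then vanishes on K_3 and is dominated by
    psi, hence vanishes on K_2 by [non_gaussian_drift]. So psi agrees on K_2 with its top term, and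
    purity concerns values on K_2 only. *)
Lemma irreductible_pure n (psi : A n.+1 -> C) : (0 < n)%N ->
  is_irreductible psi -> pure star eps u psi.
Proof.
move=> n0 [gpsi ng min]; have [psis [sumE gau comp]] := pure_decomposition_exists gpsi.
set N := n.+1 in psi gpsi ng min psis sumE gau comp *.
pose mid (i : 'I_N) := (i != ord0) && (i != ord_max).
have mid0 i : mid i -> (0 < i)%N /\ (i < n)%N.
  by case/andP=> i0 im; rewrite lt0n ltn_neqAle -ltnS ltn_ord andbT; move: i0 im; rewrite -!val_eqE.
pose G a := \sum_(i < N | mid i) psis i a.
have om : (ord_max : 'I_N) != ord0 by rewrite -val_eqE /= -lt0n.
have psiE a : psi a = psis ord0 a + (psis ord_max a + G a).
  rewrite sumE (bigD1 ord0) //= (bigD1 ord_max) //.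
have gG : fgen G.
  by apply: gen_functional_sum => // i /mid0[i0 _]; exact: component_gen is_pure_gen (comp i i0).
have rn := tw_res tw (leqnSn n).
(* For i < n the kernel of s_{n,N} is contained in that of s_{i+1,N}, which is checked on its
   generators. *)
have Gker (a b : A N) : s n a = s n b -> G a = G b.
  move=> ab; apply: eq_bigr => i /mid0[i0 ii]; have [psi' [_ _ e]] := comp i i0.
  rewrite !e; congr (psi' _); apply/eqP; rewrite -subr_eq0 -(rsB (hr i)); apply/eqP.
  apply: (rs_ker rn (ker_two_sided (hr i))) => [j k jk|]; last by rewrite (rsB rn) ab subrr.
  rewrite (rsB (hr i)) (rs_out (hr i)); last first.
    by case/orP: jk => h; rewrite (leq_trans ii h) ?orbT.
  by case: (j == k); rewrite ?(rs1 (hr i)) ?(rs0 (hr i)) subrr.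
have /choice[t ht] := rs_surj rn; pose psi' := G \o t.
have psi'E a : psi' (s n a) = G a by apply: Gker; rewrite ht.
have gpsi' : fgen psi'.
  by apply: (rs_pushforward rn); apply: gen_functional_eq gG => a /=; rewrite psi'E.
have [g0 K30] := gau ord0 erefl.
have [top [[gtop ptop] _ etop]] := comp ord_max n0.
have gmax : fgen (psis ord_max) := component_gen is_pure_gen (comp ord_max n0).
have G2 a : in_Kn eps 2 a -> G a = 0.
  move=> a2; rewrite -psi'E; apply: min => //.
  apply: gen_functional_eq (gen_functionalD g0 gmax) => b /=.
  by rewrite psi'E psiE addrA addrK.
pose g a := psis ord0 a + G a.
have gg : fgen g by exact: gen_functionalD.
have g2 : forall a, in_Kn eps 2 a -> g a = 0.
  apply: (non_gaussian_drift (hA N) gpsi ng gg) => a.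
    move=> a3; rewrite /g K30 // add0r; apply: G2.
    move: a a3; apply: in_K3_ind => [|c a b|a b c a0 b0 c0]; [exact: in_Kn0|exact: in_Kn_lin|].
    by apply: in_K2M => //; rewrite (epsM (hA N)) a0 mul0r.
  move=> a0; rewrite psiE /g [psis ord_max _ + _]addrC addrA lerDl.
  by case: gmax => _ _ _; exact.
move=> a a0; have sa0 : eps (s n.+1 a) = 0 by rewrite (rs_eps (hr ord_max)).
apply: cvg_ext (ptop _ sa0) => k; have eh : eps (ces (u ord_max ord_max) k * a) = 0.
  by rewrite (epsM (hA N)) a0 mulr0.
set x := _ * a; have -> : psi (star x * x) = psis ord_max (star x * x) + g (star x * x).
  by rewrite psiE /g addrCA.
rewrite g2 ?addr0; last by apply: in_K2M => //; rewrite (eps_star (hA N)) eh conjC0.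
rewrite etop (rsM (hr ord_max)) (rs_star (hr ord_max)) /x (rsM (hr ord_max)) (rs_ces (hr ord_max)).
by rewrite (tw_max tw (ord_max : 'I_N)).
Qed.

Lemma pure_irreductible n (psi : A n.+1 -> C) : is_pure psi -> is_irreductible psi.
Proof.
move=> [gpsi hp]; have rn := tw_res tw (leqnSn n); split=> //.
  exact: (pure_non_gaussian (hA n.+1) (hu n.+1)).
rewrite -pred_Sn => psi' g' gd a a2.
have sh k : s n (ces (u ord_max ord_max) k : A n.+1) = 1.
  by apply: (rs_ces1 rn); rewrite (rs_out rn) ?eqxx //= leqnn.
exact: (pure_minimal (hA n.+1) (rsP rn) (rsM rn) (rs1 rn) (rs_star rn) (rs_eps rn) sh hp g' gd a2).
Qed.

Theorem decomposition_exists n (psi : A n.+1 -> C) : fgen psi ->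
  exists psis, decomposition is_irreductible psi psis.
Proof.
move=> /pure_decomposition_exists[psis [h1 h2 h3]]; exists psis; split=> // i i0.
have [psi' [p e1 e2]] := h3 i i0; exists psi'; split=> //; exact: pure_irreductible.
Qed.

Theorem decomposition_uniq n (psi : A n.+1 -> C) psis psis' :
  decomposition is_irreductible psi psis -> decomposition is_irreductible psi psis' ->
  forall i a, psis i a = psis' i a.
Proof.
set N := n.+1 in psi psis psis' *; move=> [sumE gau comp] [sumE' gau' comp'].
(* Descending induction on i, with d bounding N - i: the higher terms are already known to agree. *)
have pos d (i : 'I_N) : (0 < i)%N -> (N - i <= d)%N -> forall a, psis i a = psis' i a.
  elim: d i => [i _|d IH i i0 id].
    by rewrite leqn0 subn_eq0 leqNgt ltn_ord.
  have above (j : 'I_N) : (i < j)%N -> forall a, psis j a = psis' j a.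
    move=> ij; apply: IH; first exact: ltn_trans ij.
    by rewrite -ltnS; apply: leq_trans id; rewrite ltn_sub2l.
  have ri := hr i.
  have [f [irf Pf ef]] := comp i i0; have [f' [irf' Pf' ef']] := comp' i i0.
  have pf := irreductible_pure i0 irf; have pf' := irreductible_pure i0 irf'.
  have [gf _ _] := irf; have [gf' _ _] := irf'.
  suff ff' : f =1 f' by move=> a; rewrite ef ef' ff'.
  have [fP _ _ _] := gf; have [fP' _ _ _] := gf'.
  apply: (proj_K2_functional_ext q01 (hA i.+1) (hu i.+1) fP fP' Pf Pf') => a' b'.
  have [[a <-] [b <-]] := (rs_surj ri a', rs_surj ri b') => {a' b'}.
  rewrite !(rs_eps ri) => a0 b0; pose h k := ces (u i i) k.
  have eh k : eps (h k) = 1 by apply: (eps_ces (hA N)); rewrite (su_eps (hu N)) eqxx.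
  (* For j = 0 the argument is in K_3, where a gaussian functional vanishes; for 0 < j < i the
     homomorphism s_{j+1,N} sends h_k to 1. *)
  have low k (j : 'I_N) ps : decomposition is_irreductible psi ps -> (j < i)%N ->
      ps j (star a * ((1 - h k) * b)) = 0.
    move=> [_ gp cp] ji; have [j0|j0] := posnP j.
      have [_ K3] := gp j j0; rewrite K3 // mulrA; apply: in_K3M => //.
        by rewrite (eps_star (hA N)) a0 conjC0.
      by rewrite (epsB (hA N)) eh (eps1 (hA N)) subrr.
    have [p [[gp' _ _] _ ep]] := cp j j0; rewrite ep.
    have rj := hr j; rewrite !(rsM rj) (rsB rj) (rs1 rj) (rs_ces1 rj) ?subrr ?mul0r ?mulr0.
      exact: (functional0 gp').
    by rewrite (rs_out rj) ?eqxx // ji.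
  (* At a^* (1 - h_k) b the two decompositions have the same higher terms and vanishing lower ones,
     so their i-th terms agree. The right-hand side tends to 0 by purity, while the left-hand side
     does not depend on k. *)
  have key k : f (star (s i.+1 a) * s i.+1 b) - f' (star (s i.+1 a) * s i.+1 b) =
      f (star (s i.+1 a) * (ces (u ord_max ord_max) k * s i.+1 b)) -
      f' (star (s i.+1 a) * (ces (u ord_max ord_max) k * s i.+1 b)).
    pose x := star a * ((1 - h k) * b).
    have e : psis i x = psis' i x.
      have split_sum ps : decomposition is_irreductible psi ps ->
          psi x = ps i x + \sum_(j < N | (i < j)%N) ps j x.
        move=> dp; have [-> _ _] := dp; rewrite (bigD1 i) //=; congr (_ + _).
        rewrite (bigID (fun j : 'I_N => (i < j)%N)) /= [X in _ + X]big1 ?addr0.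
          apply: eq_bigl => j; rewrite andbC -val_eqE /=.
          by case: ltnP => // ij; rewrite gtn_eqF.
        move=> j /andP[ji]; rewrite -leqNgt leq_eqVlt => /predU1P[/val_inj ij|ji'].
          by rewrite ij eqxx in ji.
        exact: low.
      have := split_sum psis (And3 sumE gau comp).
      rewrite (split_sum psis' (And3 sumE' gau' comp')).
      have -> : \sum_(j < N | (i < j)%N) psis j x = \sum_(j < N | (i < j)%N) psis' j x.
        by apply: eq_bigr => j ij; rewrite above.
      by move/addIr.
    move: e; rewrite ef ef' /x !(rsM ri) (rsB ri) (rs1 ri) (rs_star ri) (rs_ces ri) (tw_max tw i).
    rewrite mulrBl mul1r mulrBr !(functionalB gf) !(functionalB gf').
    have swap (x1 x2 x3 x4 : C) : x1 - x2 = x3 - x4 -> x1 - x3 = x2 - x4.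
      by move=> e; rewrite -[x1](subrK x2) e; ring.
    exact: swap.
  apply/eqP; rewrite -subr_eq0; apply/eqP; apply: cvg_uniq (cvg_cst _) _.
  have sa0 : eps (s i.+1 a) = 0 by rewrite (rs_eps ri).
  have sb0 : eps (s i.+1 b) = 0 by rewrite (rs_eps ri).
  have lf := pure_pairing (hA i.+1) gf pf sa0 sb0.
  have lf' := pure_pairing (hA i.+1) gf' pf' sa0 sb0.
  have := cvg_lin (-1) lf' lf; rewrite mulr0 addr0; apply: cvg_ext => k.
  by rewrite (key k) mulN1r addrC.
have pos' (i : 'I_N) : (0 < i)%N -> forall a, psis i a = psis' i a by move=> /pos; apply.
move=> i a; have [i0|] := posnP i; last by move=> /pos'.
have {i i0} -> : i = ord0 by exact/val_inj.
have := sumE a; rewrite sumE' [LHS](bigD1 ord0) //= [RHS](bigD1 ord0) //=.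
have -> : \sum_(j < N | j != ord0) psis j a = \sum_(j < N | j != ord0) psis' j a.
  by apply: eq_bigr => j j0; rewrite pos' // lt0n.
by move/addIr.
Qed.

End Tower.

(** * SU_q(N) *)

(** The missing axioms, a^** = a and the compatibility of the counit with the involution, follow on
    generators from unitarity and then extend by multiplicativity. *)
Lemma generated_star_algebra (R : realType) (A : algType R[i]) (star : A -> A)
    (eps : A -> R[i]) (N : nat) (u : 'I_N -> 'I_N -> A) :
  (forall c a b, star (c *: a + b) = Num.conj c *: star a + star b) ->
  (forall a b, star (a * b) = star b * star a) -> star 1 = 1 ->
  (forall c a b, eps (c *: a + b) = c * eps a + eps b) ->
  (forall a b, eps (a * b) = eps a * eps b) -> eps 1 = 1 ->
  (forall P : A -> Prop, (forall c a b, P a -> P b -> P (c *: a + b)) -> P 1 ->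
     (forall j k a, P a -> P (u j k * a)) -> forall a, P a) ->
  (forall j k, \sum_s u j s * star (u k s) = (j == k)%:R) ->
  (forall j k, \sum_s star (u s j) * u s k = (j == k)%:R) ->
  (forall j k, eps (u j k) = (j == k)%:R) -> star_algebra star eps.
Proof.
move=> sP sM s1 eP eM e1 ind uu uu' eu.
have s0 : star 0 = 0 by have := sP (-1) 1 1; rewrite rmorphN1 !scaleN1r !addNr.
have sD a b : star (a + b) = star a + star b by have := sP 1 a b; rewrite conjC1 !scale1r.
have e0 : eps 0 = 0 by have := eP (-1) 1 1; rewrite scaleN1r mulN1r !addNr.
have eD a b : eps (a + b) = eps a + eps b by have := eP 1 a b; rewrite scale1r mul1r.
(* u^** and u are both inverse to u^*. *)
have ss j k : star (star (u j k)) = u j k.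
  have uus k' j' : \sum_t star (star (u k' t)) * star (u j' t) = (j' == k')%:R.
    have := congr1 star (uu j' k'); rewrite (big_morph star sD s0) => e.
    rewrite -(eq_bigr _ (fun t _ => sM (u j' t) (star (u k' t)))) e.
    by case: (j' == k').
  pose W t := star (star (u j t)).
  transitivity (\sum_t \sum_r W t * (star (u r t) * u r k)).
    rewrite (bigD1 k) //= -mulr_sumr uu' eqxx mulr1 big1 ?addr0 // => t tk.
    by rewrite -mulr_sumr uu' (negbTE tk) mulr0.
  rewrite exchange_big /= (bigD1 j) //= [X in _ + X]big1 => [|r rj].
    rewrite addr0 (eq_bigr (fun t => W t * star (u j t) * u j k)) => [|t _]; last by rewrite mulrA.
    by rewrite -mulr_suml uus eqxx mul1r.
  rewrite (eq_bigr (fun t => W t * star (u r t) * u r k)) => [|t _]; last by rewrite mulrA.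
  by rewrite -mulr_suml uus (negbTE rj) mul0r.
have es j k : eps (star (u j k)) = (j == k)%:R.
  have := congr1 eps (uu k j); rewrite (big_morph eps eD e0) (bigD1 k) //= eM eu eqxx mul1r.
  rewrite big1 ?addr0 => [->|t tk]; last by rewrite eM eu eq_sym (negbTE tk) mul0r.
  by rewrite eq_sym; case: (j == k).
split=> // a; elim/ind: a => [c a b ha hb||j k a ha].
- by rewrite !sP conjCK ha hb.
- by rewrite !s1.
- by rewrite !sM ss ha.
- by rewrite sP !eP ha hb rmorphD rmorphM /=.
- by rewrite s1 e1 conjC1.
by rewrite sM !eM ha es eu rmorphM /= conjC_nat mulrC.
Qed.

Section Concrete.
Variables (R : realType) (q : R).
Local Notation C := R[i].
Hypothesis q01 : 0 < q < 1.
Local Notation star := (@SUq_star R q _).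
Local Notation eps := (@counit R q _).
Local Notation u := (@SUq_gen R q _).

Let q_gt0 : 0 < q. Proof. by case/andP: q01. Qed.

Let star_genE n : (fun j k : 'I_n => SUq_star (SUq_gen q j k)) = @SUq_gen_star R q n.
Proof. by apply/funext => j; apply/funext => k; exact: (star_gen q_gt0 j k). Qed.

Lemma SUq_unitaryE n (j k : 'I_n) :
  \sum_s SUq_gen q j s * SUq_star (SUq_gen q k s) = (j == k)%:R.
Proof.
exact: (eq_ind_r (fun G : 'I_n -> 'I_n -> SUq q n => \sum_s SUq_gen q j s * G k s = (j == k)%:R)
  (SUq_unitary q_gt0 j k) (star_genE n)).
Qed.

Lemma SUq_unitary_starE n (j k : 'I_n) :
  \sum_s SUq_star (SUq_gen q s j) * SUq_gen q s k = (j == k)%:R.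
Proof.
exact: (eq_ind_r (fun G : 'I_n -> 'I_n -> SUq q n => \sum_s G s j * SUq_gen q s k = (j == k)%:R)
  (SUq_unitary_star q_gt0 j k) (star_genE n)).
Qed.

Lemma SUq_star_algebra n : star_algebra (@SUq_star R q n) (@counit R q n).
Proof.
apply: (@generated_star_algebra R (SUq q n) _ _ n (@SUq_gen R q n)).
- exact: (starP q_gt0).
- exact: (starM q_gt0).
- exact: (star1 n q_gt0).
- exact: counitP.
- exact: counitM.
- exact: counit1.
- exact: SUq_ind.
- exact: SUq_unitaryE.
- exact: SUq_unitary_starE.
exact: counit_gen.
Qed.

Lemma SUq_su_generators n :
  su_generators q (@SUq_star R q n) (@counit R q n) (@SUq_gen R q n).
Proof.
split.
- exact: SUq_ind.
- exact: SUq_unitaryE.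
- exact: SUq_unitary_starE.
- exact: counit_gen.
- exact: SUq_matrix_quantum.
exact: SUq_matrix_det.
Qed.

Lemma SUq_restriction n N : (n <= N)%N ->
  restriction (@SUq_star R q N) (@counit R q N) (@SUq_star R q n) (@counit R q n) n
    (@SUq_gen R q N) (@SUq_res R q n N).
Proof.
move=> nN; split.
- exact: (SUq_resP nN).
- exact: (SUq_resM nN).
- exact: SUq_res1.
- exact: (SUq_res_star q_gt0 nN).
- exact: (SUq_res_counit nN).
- exact: (SUq_res_surj nN).
- move=> j k jk; exact: (etrans (@SUq_res_genE R q n N nN j k)
    (@block_one_delta R (SUq q n) n N (SUq_matrix q n) j k jk)).
by move=> I hI hg a; exact: (SUq_res_ker nN hI hg).
Qed.

Lemma SUq_tower : su_tower q (A := fun n => SUq q n : algType C) (@SUq_star R q)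
  (@counit R q) (@SUq_gen R q) (@SUq_res R q).
Proof.
split.
- exact: SUq_star_algebra.
- exact: SUq_su_generators.
- exact: SUq_derivation.
- exact: SUq_restriction.
move=> N i; apply: (etrans (@SUq_res_genE R q i.+1 N (ltn_ord i) i i)).
apply: (etrans (block_oneE _ (ltnSn i) (ltnSn i))); apply: (etrans (mxE _ _ _ _)).
by congr SUq_gen; exact: val_inj.
Qed.

End Concrete.

(** * From the abstract notions to those of the statement *)

Section Translation.
Variables (R : realType) (q : R).
Local Notation C := R[i].
Hypothesis q01 : 0 < q < 1.
Local Notation T := (SUq_tower q01).

Lemma generating_functionalE n (psi : SUq q n -> C) :
  generating_functional psi <-> gen_functional (@SUq_star R q n) (@counit R q n) psi.
Proof. by split=> -[h1 h2 h3 h4]; split. Qed.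

Lemma completely_non_gaussianE n (psi : SUq q n -> C) : generating_functional psi ->
  completely_non_gaussian psi <-> non_gaussian (@SUq_star R q n) (@counit R q n) psi.
Proof.
move=> gpsi; split=> -[H [rho [eta [ht hV]]]]; exists H, rho, eta; have hD := hdot_psd H; split=> //.
  have [[h1 h2 h3 h4 h5] [[h6 h7] h8] _ h9] := ht; split=> //.
    by split=> // a c x y; have [l _] := h1 a; exact: l.
  move=> f; have /choice[v hv] (k : nat) :
      exists a, hdot H (f - eta a) (f - eta a) < (k.+1%:R)^-1.
    by apply: h8; rewrite invr_gt0 ltr0Sn.
  exists v => e /inv_small[m hm]; exists m => k /hm; rewrite (psdB_sym hD); exact: lt_trans (hv k).
have [hrho heta hdot_eq dense] := ht; split=> //.
- split=> [a|c a b x|x|a b x|a x y].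
  + split; first by move=> c x y; exact: (rep_lin hrho).
    by have [M _ hM] := rep_bounded (SUq_su_generators q01 n) hrho a; exists M.
  + exact: (repP hrho).
  + exact: (rep1 hrho).
  + exact: (repM hrho).
  exact: (rep_adj hrho).
- split; first by split=> [c a b|a b]; [exact: (cocP heta)|exact: (cocM heta)].
  move=> x e e0; have [v hv] := dense x; have [m hm] := hv e e0.
  by exists (v m); rewrite (psdB_sym hD); exact: hm.
Qed.

Lemma irreductibleE n (psi : SUq q n -> C) :
  irreductible psi <-> is_irreductible (@SUq_star R q) (@counit R q) (@SUq_res R q) psi.
Proof.
split=> -[h1 h2 h3].
  split=> [||psi' g' gd]; [exact/generating_functionalE|exact/completely_non_gaussianE|].
  by have [] := h3 psi' ((generating_functionalE _).2 g') ((generating_functionalE _).2 gd).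
have g1 := (generating_functionalE _).2 h1.
split=> [//||psi' g' gd]; first exact/completely_non_gaussianE.
(* Besides vanishing on K_2, a drift has to be a generating functional; here it is one as a
   pullback. *)
split; last exact: (h3 psi' ((generating_functionalE _).1 g') ((generating_functionalE _).1 gd)).
apply/generating_functionalE; apply: (rs_pullback (tw_res T (leq_pred n))).
exact/generating_functionalE.
Qed.

Lemma decompositionE n (psi : SUq q n -> C) (psis : 'I_n -> SUq q n -> C) :
  [/\ forall a, psi a = \sum_(i < n) psis i a,
      forall i : 'I_n, i = 0%N :> nat -> gaussian (psis i)
    & forall i : 'I_n, (0 < i)%N ->
        exists psi' : SUq q i.+1 -> R[i],
          [/\ irreductible psi',
              forall a, psi' (projK2 a) = psi' a
            & forall a, psis i a = psi' (SUq_res i.+1 a)]] <->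
  decomposition (@SUq_star R q) (@counit R q) (@SUq_gen R q) (@SUq_res R q)
    (@is_irreductible R (fun n => SUq q n : algType C) (@SUq_star R q) (@counit R q) (@SUq_res R q))
    psi psis.
Proof.
split=> -[h1 h2 h3]; split=> // i i0.
  have [psi' [irr hP e]] := h3 i i0; exists psi'; split=> //; exact/irreductibleE.
- have [psi' [irr hP e]] := h3 i i0; exists psi'; split=> //; exact/irreductibleE.
Qed.

End Translation.

(* The index i : 'I_N stands for n = i + 1. *)
Theorem theorem4p17 (R : realType) (q : R) (hq : 0 < q < 1) (N : nat)
    (hN : (2 <= N)%N) (psi : SUq q N -> R[i])
    (hpsi : generating_functional psi) :
  exists! psis : 'I_N -> SUq q N -> R[i],
    [/\ forall a, psi a = \sum_(i < N) psis i a,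
        forall i : 'I_N, i = 0%N :> nat -> gaussian (psis i)
      & forall i : 'I_N, (0 < i)%N ->
          exists psi' : SUq q i.+1 -> R[i],
            [/\ irreductible psi',
                forall a, psi' (projK2 a) = psi' a
              & forall a, psis i a = psi' (SUq_res i.+1 a)]].
Proof.
case: N hN psi hpsi => // n _ psi /generating_functionalE hpsi.
have T := SUq_tower hq; have [psis dec] := decomposition_exists hq T hpsi.
exists psis; split; first exact/(decompositionE hq).
move=> psis' /(decompositionE hq) dec'; apply/funext => i; apply/funext => a.
exact: (decomposition_uniq hq T dec dec' i a).
Qed.
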